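(* Let $X$ be the multivariate Bessel process of type $A_{N-1}$ (parameter $k>0$) or of type $B_N$ (parameters $k>0,\alpha>0$), with open Weyl chamber $W$, and let $k'=k$ in type $A_{N-1}$ and $k'=k\min(1,\alpha)$ in type $B_N$. For every $0<k'<\frac12$ and every $x\in\partial W$, the inequality $$\dim X^{-1}(\partial W)\le \frac12-k'$$ holds $\mathbb{P}^x$-almost surely.
   Context: Type $A_{N-1}$ ($N\ge 2$): $W=\{x\in\mathbb{R}^N: x_1<\dots<x_N\}$, and $X$ is the unique strong solution in $\overline{W}$ of $\mathrm{d}X_{t,i}=\mathrm{d}B_{t,i}+k\sum_{j\ne i}\frac{\mathrm{d}t}{X_{t,i}-X_{t,j}}$, $i=1,\dots,N$, with $X_0=x$, $B$ a standard $N$-dimensional Brownian motion. Type $B_N$: $W=\{x\in\mathbb{R}^N: 0<x_1<\dots<x_N\}$, and $X$ is the unique strong solution in $\overline W$ of $\mathrm{d}X_{t,i}=\mathrm{d}B_{t,i}+k\alpha\frac{\mathrm{d}t}{X_{t,i}}+k\sum_{j\neq i}\Big(\frac{1}{X_{t,i}-X_{t,j}}+\frac{1}{X_{t,i}+X_{t,j}}\Big)\mathrm{d}t$, $X_0=x$. $\mathbb{P}^x$ is the law of the process started at $x$. $\partial W$ is the topological boundary of $W$, $X^{-1}(\partial W)=\{t\ge0: X_t\in\partial W\}$, and $\dim$ is Hausdorff dimension. *)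

(* Defs.v *)
From HB Require Import structures.
From mathcomp Require Import all_boot all_order all_algebra.
From mathcomp Require Import all_classical all_reals all_analysis.
Set Implicit Arguments. Unset Strict Implicit. Unset Printing Implicit Defensive.
Import Order.TTheory GRing.Theory Num.Theory.
Import numFieldNormedType.Exports.
Local Open Scope ring_scope.
Local Open Scope classical_set_scope.

(* diameter of a set of reals (sup of |x-y|, -oo for the empty set) *)
Definition diam {R : realType} (U : set R) : \bar R :=
  ereal_sup [set (`|x - y|)%:E | x in U & y in U].

Definition hterm {R : realType} (s : R) (U : set R) : \bar R :=
  if pselect (U = set0) then 0%E else ((fine (diam U)) `^ s)%:E.

Definition hausdorff_content {R : realType} (s delta : R) (A : set R) : \bar R :=
  ereal_inf [set (\sum_(0 <= i <oo) hterm s (U i))%E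
            | U in [set U : nat -> set R |
                     A `<=` \bigcup_i U i /\ forall i, (diam (U i) <= delta%:E)%E]].

(* s-dimensional Hausdorff measure H^s(A) = lim_{delta -> 0+} H^s_delta(A)
   (= sup over delta > 0, since H^s_delta(A) is nonincreasing in delta) *)
Definition hausdorff_measure {R : realType} (s : R) (A : set R) : \bar R :=
  ereal_sup [set hausdorff_content s delta A | delta in [set delta : R | 0 < delta]].

Definition hausdorff_dim {R : realType} (A : set R) : \bar R :=
  ereal_inf [set s%:E | s in [set s : R | 0 <= s /\ hausdorff_measure s A = 0%E]].

Definition mutually_independent {d} {T : measurableType d} {R : realType}
  (P : probability T R) (I : finType) (Y : I -> T -> R) : Prop :=
  forall A : I -> set R, (forall i, measurable (A i)) ->
    P (\bigcap_(i in [set: I]) (Y i @^-1` A i)) = (\prod_(i : I) P (Y i @^-1` A i))%E.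

Definition brownian_motion {d} {T : measurableType d} {R : realType}
  (P : probability T R) (N : nat) (B : R -> T -> 'rV[R]_N) : Prop :=
  (forall t (i : 'I_N), measurable_fun [set: T] (fun w => B t w ord0 i)) /\
  {ae P, forall w, B 0 w = 0 /\ {within [set t : R | 0 <= t], continuous (fun t => B t w)}} /\
  (forall (tt : nat -> R), 0 <= tt 0%N -> (forall j, tt j < tt j.+1) ->
     forall n : nat,
       mutually_independent P
         (fun ij : 'I_N * 'I_n =>
            fun w => B (tt ij.2.+1) w ord0 ij.1 - B (tt ij.2) w ord0 ij.1) /\
       forall (i : 'I_N) (j : 'I_n) (A : set R), measurable A ->
         P ((fun w => B (tt j.+1) w ord0 i - B (tt j) w ord0 i) @^-1` A)
         = normal_prob 0 (Num.sqrt (tt j.+1 - tt j)) A).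

Inductive bessel_type (R : Type) := typeA | typeB of R.
Arguments typeA {R}.
Arguments typeB {R} _.

Definition admissible {R : realType} (typ : bessel_type R) (N : nat) (k : R) : Prop :=
  match typ with
  | typeA => (2 <= N)%N /\ 0 < k
  | typeB alpha => (1 <= N)%N /\ 0 < k /\ 0 < alpha
  end.

Definition weyl_chamber {R : realType} (typ : bessel_type R) (N : nat) : set 'rV[R]_N :=
  match typ with
  | typeA => [set x | forall i j : 'I_N, (i < j)%N -> x ord0 i < x ord0 j]
  | typeB _ => [set x | (forall i : 'I_N, 0 < x ord0 i) /\
                        forall i j : 'I_N, (i < j)%N -> x ord0 i < x ord0 j]
  end.

Arguments weyl_chamber {R} typ N.

Definition boundary {T : topologicalType} (A : set T) : set T :=
  closure A `\` interior A.

(* drift of the SDE (division by 0 is 0 in MathComp; irrelevant off W) *)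
Definition bessel_drift {R : realType} (typ : bessel_type R) (N : nat) (k : R)
  (x : 'rV[R]_N) : 'rV[R]_N :=
  match typ with
  | typeA => \row_i (k * \sum_(j < N | j != i) (x ord0 i - x ord0 j)^-1)
  | typeB alpha => \row_i (k * alpha / x ord0 i +
        k * \sum_(j < N | j != i) ((x ord0 i - x ord0 j)^-1 + (x ord0 i + x ord0 j)^-1))
  end.

Definition kprime {R : realType} (typ : bessel_type R) (k : R) : R :=
  match typ with
  | typeA => k
  | typeB alpha => k * Num.min 1 alpha
  end.

Definition bessel_solution {d} {T : measurableType d} {R : realType}
  (P : probability T R) (typ : bessel_type R) (N : nat) (k : R)
  (B : R -> T -> 'rV[R]_N) (x : 'rV[R]_N) (X : R -> T -> 'rV[R]_N) : Prop :=
  (forall t (i : 'I_N), measurable_fun [set: T] (fun w => X t w ord0 i)) /\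
  {ae P, forall w,
     {within [set t : R | 0 <= t], continuous (fun t => X t w)} /\
     forall t : R, 0 <= t ->
       closure (weyl_chamber typ N) (X t w) /\
       (forall i : 'I_N, (@lebesgue_measure R).-integrable `[0, t]
           (fun s => (bessel_drift typ k (X s w) ord0 i)%:E)) /\
       X t w = x + B t w +
               \row_i Rintegral (@lebesgue_measure R) `[0, t]
                        (fun s => bessel_drift typ k (X s w) ord0 i)}.

(* Main.v *)
(** Type A and type B solutions satisfy dX = dB + b(X) dt where
    b(y) = sum_p k_p / <al_p, y> al_p runs over the positive roots; b is monotone on the
    chamber.  Since X need not be adapted, Ito calculus is applied not to X but to the
    implicit Euler scheme Y driven by the increments of B, which stays in the chamber.
    For 1 - 2 k' < a < 1 the drift of sum_p <al_p, Y>^a dominates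
    sum_p <al_p, Y>^(a - 2), the mixed terms being nonnegative, so the time integral of
    the latter has bounded mean and is almost surely bounded along a sequence of meshes.
    Monotonicity of b makes Y converge to X path by path, provided X spends no time on
    the boundary, and gives Y the modulus of continuity of B.  Hence a dyadic interval of
    length 2^-m on which X hits the boundary contributes about 2^-m rho^(m (a - 2)) to
    the integral for every rho > 2^(-1/2); this bounds the number of such intervals, and
    covering by them shows that the s-dimensional Hausdorff measure vanishes for all
    s > 1/2 - k'. *)
Require Import Defs.
From HB Require Import structures.
From mathcomp Require Import all_boot all_order all_algebra.
From mathcomp Require Import all_classical all_reals all_analysis.
From mathcomp Require Import measurable_realfun.
From mathcomp Require Import ring lra zify.
Import Order.TTheory GRing.Theory Num.Theory.
Import numFieldNormedType.Exports.
Set Implicit Arguments. Unset Strict Implicit. Unset Printing Implicit Defensive.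
Local Open Scope ring_scope.
Local Open Scope classical_set_scope.

(** * Euclidean geometry of the roots *)

(** The threshold [1 - 2 k'] is one-dimensional: with drift [k / u] the generator maps [u^a] to
    [a (k - (1 - a) / 2) u^(a - 2)], which is positive exactly when [a > 1 - 2 k]. The number of
    intervals hit at level [m] is of order [2^m rho^(m (2 - a))]; as [rho] tends to [2^(-1/2)] and
    [a] to [1 - 2 k'], its growth exponent tends to [a / 2 = 1/2 - k']. The power is singular on the
    walls, so [(u + e)^a] replaces it. The errors that depend on [e] vanish with the mesh, and the
    remaining bound does not depend on [e]; hence [e] can be matched afterwards to the scale [rho^m]
    of an interval. That [X] spends no time on the boundary has to be proved: with [1 / 0 = 0] the
    equation does not visibly forbid resting on a wall. The argument is pathwise. Along a root, [X]
    is a linear image of the Brownian path plus a function of bounded variation. If its zero set had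
    positive measure, many of its short translates would overlap substantially, which forces too
    many Brownian increments to be atypically small. *)

Lemma cvg_sumr {R : realType} {T : Type} (F : set_system T) {FF : Filter F}
    (I : Type) (r : seq I) (Q : pred I) (f : I -> T -> R) (a : I -> R) :
  (forall i, Q i -> f i x @[x --> F] --> a i) ->
  \sum_(i <- r | Q i) f i x @[x --> F] --> \sum_(i <- r | Q i) a i.
Proof.
move=> fa; elim: r => [|i r IH].
  rewrite big_nil; under eq_cvg do rewrite big_nil; exact: cvg_cst.
rewrite big_cons; under eq_cvg do rewrite big_cons.
by case: ifPn => // Qi; apply: cvgD => //; exact: fa.
Qed.

Section dot_product.
Context {R : realType} {N : nat}.
Implicit Types x y z : 'rV[R]_N.

Definition dotv x y : R := \sum_i x ord0 i * y ord0 i.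

Definition nrm x : R := Num.sqrt (dotv x x).

Lemma dotvC x y : dotv x y = dotv y x.
Proof. by apply: eq_bigr => i _; rewrite mulrC. Qed.

Lemma dotvDl x y z : dotv (x + y) z = dotv x z + dotv y z.
Proof. by rewrite -big_split; apply: eq_bigr => i _; rewrite mxE mulrDl. Qed.

Lemma dotvDr x y z : dotv z (x + y) = dotv z x + dotv z y.
Proof. by rewrite !(dotvC z) dotvDl. Qed.

Lemma dotvZl c x y : dotv (c *: x) y = c * dotv x y.
Proof. by rewrite mulr_sumr; apply: eq_bigr => i _; rewrite mxE mulrA. Qed.

Lemma dotvZr c x y : dotv x (c *: y) = c * dotv x y.
Proof. by rewrite !(dotvC x) dotvZl. Qed.

Lemma dotvNl x y : dotv (- x) y = - dotv x y.
Proof. by rewrite -scaleN1r dotvZl mulN1r. Qed.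

Lemma dotvNr x y : dotv x (- y) = - dotv x y.
Proof. by rewrite !(dotvC x) dotvNl. Qed.

Lemma dotvBl x y z : dotv (x - y) z = dotv x z - dotv y z.
Proof. by rewrite dotvDl dotvNl. Qed.

Lemma dotvBr x y z : dotv z (x - y) = dotv z x - dotv z y.
Proof. by rewrite dotvDr dotvNr. Qed.

Lemma dotv0l x : dotv 0 x = 0.
Proof. by rewrite -(scale0r 0) dotvZl mul0r. Qed.

Lemma dotv0r x : dotv x 0 = 0.
Proof. by rewrite dotvC dotv0l. Qed.

Lemma dotv_suml (J : Type) (r : seq J) (Q : pred J) (F : J -> 'rV[R]_N) y :
  dotv (\sum_(j <- r | Q j) F j) y = \sum_(j <- r | Q j) dotv (F j) y.
Proof.
by elim/big_rec2: _ => [|j a b _ <-]; rewrite ?dotv0l// dotvDl.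
Qed.

Lemma dotv_sumr (J : Type) (r : seq J) (Q : pred J) (F : J -> 'rV[R]_N) y :
  dotv y (\sum_(j <- r | Q j) F j) = \sum_(j <- r | Q j) dotv y (F j).
Proof. by rewrite dotvC dotv_suml; apply: eq_bigr => j _; rewrite dotvC. Qed.

Lemma dotv_ge0 x : 0 <= dotv x x.
Proof. by apply: sumr_ge0 => i _; rewrite -expr2 sqr_ge0. Qed.

Lemma nrm_ge0 x : 0 <= nrm x.
Proof. exact: sqrtr_ge0. Qed.

Lemma sqr_nrm x : nrm x ^+ 2 = dotv x x.
Proof. by rewrite sqr_sqrtr// dotv_ge0. Qed.

Lemma coord_le_nrm x i : `|x ord0 i| <= nrm x.
Proof.
rewrite -sqrtr_sqr ler_wsqrtr// /dotv (bigD1 i)//= -expr2 lerDl.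
by apply: sumr_ge0 => j _; rewrite -expr2 sqr_ge0.
Qed.

Lemma dotv_eq0 x : dotv x x = 0 -> x = 0.
Proof.
move=> x0; apply/rowP => i; rewrite mxE; apply/normr0_eq0/eqP.
by rewrite eq_le normr_ge0 andbT (le_trans (coord_le_nrm x i))// /nrm x0 sqrtr0.
Qed.

Lemma dotv_le_nrm x y : `|dotv x y| <= nrm x * nrm y.
Proof.
have [->|y0] := eqVneq y 0.
  by rewrite dotv0r normr0 mulr_ge0// nrm_ge0.
have dy : 0 < dotv y y.
  by rewrite lt_neqAle dotv_ge0 andbT eq_sym; apply: contra_neq y0 => /dotv_eq0.
rewrite -sqrtrM ?dotv_ge0// -sqrtr_sqr ler_wsqrtr//.
(* The square norm of this vector is [dotv y y] times the Gram determinant of [x] and [y]. *)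
have := dotv_ge0 (dotv y y *: x - dotv x y *: y).
rewrite dotvBl !dotvBr !dotvZl !dotvZr (dotvC y x) => h.
suff : 0 <= dotv y y * (dotv x x * dotv y y - dotv x y ^+ 2).
  by rewrite pmulr_rge0// subr_ge0.
by apply: le_trans h _; rewrite le_eqVlt; apply/orP; left; apply/eqP; ring.
Qed.

Lemma dotv_le x y : dotv x y <= nrm x * nrm y.
Proof. exact: le_trans (ler_norm _) (dotv_le_nrm x y). Qed.

Lemma nrmN x : nrm (- x) = nrm x.
Proof. by rewrite /nrm dotvNl dotvNr opprK. Qed.

Lemma nrmB x y : nrm (x - y) = nrm (y - x).
Proof. by rewrite -nrmN opprB. Qed.

Lemma nrmD x y : nrm (x + y) <= nrm x + nrm y.
Proof.
rewrite -(ler_pXn2r (n := 2)) ?nnegrE ?addr_ge0 ?nrm_ge0// sqr_nrm.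
rewrite dotvDl !dotvDr sqrrD !sqr_nrm (dotvC y x).
have := dotv_le x y; lra.
Qed.

Lemma nrm_le_sum x : nrm x <= \sum_i `|x ord0 i|.
Proof.
have s0 : 0 <= \sum_i `|x ord0 i| by apply: sumr_ge0.
rewrite -(ler_pXn2r (n := 2)) ?nnegrE ?nrm_ge0// sqr_nrm expr2 mulr_suml.
apply: ler_sum => i _; rewrite -expr2 -real_normK ?num_real// expr2.
by rewrite ler_wpM2l// (bigD1 i)//= lerDl sumr_ge0.
Qed.

Lemma nrmZ c x : nrm (c *: x) = `|c| * nrm x.
Proof. by rewrite /nrm dotvZl dotvZr mulrA -expr2 sqrtrM ?sqr_ge0// sqrtr_sqr. Qed.

Lemma dotv_delta x i : dotv x (delta_mx ord0 i) = x ord0 i.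
Proof.
rewrite /dotv (bigD1 i)//= mxE !eqxx mulr1 big1 ?addr0// => j ji.
by rewrite mxE (negbTE ji) andbF mulr0.
Qed.

Lemma continuous_dotv x : continuous (dotv x : 'rV[R]_N -> R).
Proof.
move=> y; apply: (cvg_sumr (F := nbhs y)) => i _; apply: cvgMr; exact: coord_continuous.
Qed.

Lemma continuous_sqr_nrm : continuous (fun y : 'rV[R]_N => dotv y y).
Proof. by move=> y; apply: (cvg_sumr (F := nbhs y)) => i _; apply: cvgM; exact: coord_continuous. Qed.

End dot_product.

Section root_data.
Context {R : realType} {N : nat} {I : finType}.
Variables (al : I -> 'rV[R]_N) (kk : I -> R).
Hypothesis kk_gt0 : forall p, 0 < kk p.
Implicit Types y z w v : 'rV[R]_N.

(** On the chamber this is the gradient of the concave function [\sum_p kk p * ln (dotv (al p) y)].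
    Elsewhere the convention [1 / 0 = 0] drops the terms of the roots that vanish at [y]. *)
Definition rdrift y : 'rV[R]_N := \sum_p (kk p / dotv (al p) y) *: al p.

Definition chamber : set 'rV[R]_N := [set y | forall p, 0 < dotv (al p) y].

Lemma dot_rdrift w y :
  dotv w (rdrift y) = \sum_p kk p * dotv (al p) w / dotv (al p) y.
Proof.
rewrite dotv_sumr; apply: eq_bigr => p _.
by rewrite dotvZr (dotvC w) mulrAC.
Qed.

Lemma dot_rdrift_self y : chamber y -> dotv y (rdrift y) = \sum_p kk p.
Proof.
move=> Wy; rewrite dot_rdrift; apply: eq_bigr => p _.
by rewrite mulfK// gt_eqF// Wy.
Qed.

Lemma dot_rdrift_ge0 v y : (forall p, 0 <= dotv (al p) v) -> chamber y ->
  0 <= dotv v (rdrift y).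
Proof.
move=> Wv Wy; rewrite dot_rdrift; apply: sumr_ge0 => p _.
by apply: divr_ge0; [apply: mulr_ge0; [exact/ltW|exact: Wv]|exact/ltW/Wy].
Qed.

(** The point [z] may lie on a wall, as the starting point does. The bound makes the squared
    displacement of the scheme grow at most linearly in time. *)
Lemma dot_rdrift_le z y : (forall p, 0 <= dotv (al p) z) -> chamber y ->
  dotv (y - z) (rdrift y) <= \sum_p kk p.
Proof.
by move=> Wz Wy; rewrite dotvBl dot_rdrift_self// gerBl dot_rdrift_ge0.
Qed.

(** Root by root, [(a - b) (1/a - 1/b) = - (a - b)^2 / (a b)] for [a, b > 0]. *)
Lemma rdrift_dissipative y z : chamber y -> chamber z ->
  dotv (y - z) (rdrift y - rdrift z) <= 0.
Proof.
move=> Wy Wz; rewrite dotvBr !dot_rdrift -sumrB -oppr_ge0 -sumrN.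
apply: sumr_ge0 => p _.
rewrite (_ : - _ = kk p * - (dotv (al p) (y - z) *
  ((dotv (al p) y)^-1 - (dotv (al p) z)^-1))); last by ring.
rewrite mulr_ge0 ?(ltW (kk_gt0 p))// dotvBr.
have := Wy p; have := Wz p.
move: (dotv _ y) (dotv _ z) => a b b0 a0.
have -> : - ((a - b) * (a^-1 - b^-1)) = (a - b) ^+ 2 / (a * b).
  by field; rewrite !gt_eqF.
by rewrite mulr_ge0 ?sqr_ge0// invr_ge0 mulr_ge0 ?ltW.
Qed.

(** Tested against an interior point [v], all terms of the drift are positive and nothing cancels.
    Norms of the singular drift are thereby controlled by [dotv v] of it, whose sums and integrals
    telescope. *)
Lemma nrm_rdrift_le v : chamber v ->
  exists2 C, 0 <= C & forall y, chamber y ->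
    nrm (rdrift y) <= C * dotv v (rdrift y).
Proof.
move=> Wv; exists (\sum_p nrm (al p) / dotv (al p) v).
  by apply: sumr_ge0 => p _; rewrite mulr_ge0 ?nrm_ge0// invr_ge0 ltW.
move=> y Wy; rewrite mulr_suml.
apply: (@le_trans _ _ (\sum_p kk p / dotv (al p) y * nrm (al p))); last first.
  apply: ler_sum => p _.
  have -> : kk p / dotv (al p) y * nrm (al p) =
      nrm (al p) / dotv (al p) v * (kk p * dotv (al p) v / dotv (al p) y).
    by field; rewrite !gt_eqF// ?Wy ?Wv.
  rewrite ler_wpM2l ?divr_ge0 ?nrm_ge0 ?(ltW (Wv p))//.
  rewrite dot_rdrift (bigD1 p)//= lerDl sumr_ge0// => q _.
  by rewrite divr_ge0 ?mulr_ge0 ?(ltW (kk_gt0 q)) ?(ltW (Wy q)) ?(ltW (Wv q)).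
rewrite /rdrift; apply: (big_ind2 (fun a b => nrm a <= b)) => [|a b a' b' ab ab'|p _].
- by rewrite /nrm dotv0l sqrtr0.
- by rewrite (le_trans (nrmD _ _))// lerD.
- by rewrite nrmZ ger0_norm// divr_ge0 ?(ltW (kk_gt0 p)) ?(ltW (Wy p)).
Qed.

End root_data.

(** * Solvability of the implicit Euler step *)

Section resolvent.
Context {R : realType} {N : nat} {I : finType}.
Variables (al : I -> 'rV[R]_N) (kk : I -> R).
Hypothesis kk_gt0 : forall p, 0 < kk p.
Implicit Types y z w v : 'rV[R]_N.

(** Apply [ln (1 + u) <= u] at [u = - t / (1 + t)]. This second-order bound replaces differentiation
    of the energy. *)
Lemma ln1D_ge (t : R) : `|t| <= 2^-1 -> t - 2 * t ^+ 2 <= ln (1 + t).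
Proof.
rewrite ler_norml => /andP[t1 t2].
have p : 0 < 1 + t by lra.
have : t / (1 + t) <= ln (1 + t).
  have /le_ln1Dx : -1 < - (t / (1 + t)).
    by rewrite -subr_gt0 opprK addrC; have -> : 1 - t / (1 + t) = (1 + t)^-1;
      [field; rewrite gt_eqF|rewrite invr_gt0].
  have -> : 1 + - (t / (1 + t)) = (1 + t)^-1 by field; rewrite gt_eqF.
  by rewrite lnV ?posrE// lerN2.
apply: le_trans; rewrite ler_pdivlMr//.
have := sqr_ge0 t; nra.
Qed.

(** A critical point on the chamber satisfies [y - z = h *: rdrift al kk y], so that a minimiser is
    an implicit Euler step from [z]. *)
Definition energy (h : R) z y : R :=
  dotv (y - z) (y - z) / 2 - h * \sum_p kk p * ln (dotv (al p) y).

Lemma energy_continuous h z : {in chamber al, continuous (energy h z)}.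
Proof.
move=> y; rewrite inE => Wy.
have c0 : dotv (x - z) (x - z) @[x --> y] --> dotv (y - z) (y - z).
  have sqE x : dotv (x - z) (x - z) = dotv x x - 2 * dotv z x + dotv z z.
    by rewrite !(dotvBl, dotvBr) (dotvC x z); ring.
  rewrite sqE; under eq_cvg do rewrite sqE.
  have h2 : 2 * dotv z x @[x --> y] --> 2 * dotv z y.
    by apply: (cvgM (F := nbhs y)); [exact: cvg_cst|exact: (@continuous_dotv R N z y)].
  have h3 : dotv x x - 2 * dotv z x @[x --> y] --> dotv y y - 2 * dotv z y.
    by apply: (cvgB (F := nbhs y)) h2; exact: continuous_sqr_nrm.
  by apply: (cvgD (F := nbhs y)) h3 _; exact: cvg_cst.
have c1 : \sum_p kk p * ln (dotv (al p) x) @[x --> y] --> \sum_p kk p * ln (dotv (al p) y).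
  apply: (cvg_sumr (F := nbhs y)) => p _; apply: cvgMr.
  apply: (@continuous_comp _ _ _ (dotv (al p)) (@ln R)).
    exact: continuous_dotv.
  exact/continuous_ln/Wy.
apply: (cvgB (F := nbhs y)); first by apply: (cvgM (F := nbhs y)) c0 _; exact: cvg_cst.
by apply: (cvgM (F := nbhs y)) _ c1; exact: cvg_cst.
Qed.

(** Coercivity in two stages. Since [ln u <= u], the energy dominates a quadratic function centred
    at [z + h *: w], which bounds [y]. Every logarithm is then bounded above, so that each single
    [- ln (dotv (al p) y)] is bounded above too, and [y] stays away from the walls. *)
Lemma energy_box (h : R) z (c : R) : 0 < h ->
  exists r e, 0 < e /\ forall y, chamber al y -> energy h z y <= c ->
    (forall i, `|y ord0 i| <= r) /\ forall p, e <= dotv (al p) y.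
Proof.
move=> h0; pose w := \sum_p kk p *: al p.
pose r1 := Num.sqrt `|2 * c + 2 * h * dotv w z + h ^+ 2 * dotv w w|.
pose r := r1 + nrm (z + h *: w).
pose L := c + h * \sum_p kk p * (nrm (al p) * r).
pose e := \big[Num.min/1]_p expR (- (L / (h * kk p))).
exists r, e; split.
  by rewrite /e; elim/big_ind: _ => // [a b a0 b0|p _]; rewrite ?lt_min ?a0// expR_gt0.
move=> y Wy Ey.
have lnle p : ln (dotv (al p) y) <= dotv (al p) y by rewrite ltW// ln_sublinear.
have sumle : \sum_p kk p * ln (dotv (al p) y) <= dotv w y.
  rewrite /w dotv_suml; apply: ler_sum => p _.
  by rewrite dotvZl ler_wpM2l ?(ltW (kk_gt0 p)).
have ny : nrm (y - (z + h *: w)) <= r1.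
  rewrite -(ler_pXn2r (n := 2)) ?nnegrE ?sqrtr_ge0// sqr_nrm sqr_sqrtr//.
  apply: le_trans (ler_norm _).
  have : dotv (y - z) (y - z) / 2 - h * dotv w y <= c.
    by apply: le_trans Ey; rewrite lerD2l lerN2 ler_wpM2l// ltW.
  rewrite !(dotvBl, dotvBr, dotvDl, dotvDr, dotvZl, dotvZr).
  rewrite (dotvC y z) (dotvC y w) (dotvC z w); nra.
have nyr : nrm y <= r.
  have -> : y = (y - (z + h *: w)) + (z + h *: w) by rewrite subrK.
  by rewrite (le_trans (nrmD _ _))// lerD2r.
have yi i : `|y ord0 i| <= r by exact: le_trans (coord_le_nrm y i) nyr.
split=> // p.
have r0 : 0 <= r by apply: le_trans nyr; exact: nrm_ge0.
have up q : dotv (al q) y <= nrm (al q) * r.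
  by rewrite (le_trans (dotv_le _ _))// ler_wpM2l ?nrm_ge0.
have : h * kk p * - ln (dotv (al p) y) <= L.
  have : - (h * \sum_p kk p * ln (dotv (al p) y)) <= c.
    apply: le_trans Ey; rewrite /energy lerDr divr_ge0// dotv_ge0//.
  rewrite (bigD1 p)//= /L [in X in _ -> _ <= X](bigD1 p)//=.
  have : \sum_(i | i != p) kk i * ln (dotv (al i) y) <=
     \sum_(i | i != p) kk i * (nrm (al i) * r).
    by apply: ler_sum => q _; rewrite ler_wpM2l ?(ltW (kk_gt0 _))// (le_trans (lnle q)).
  move=> /(ler_wpM2l (ltW h0)).
  have : 0 <= h * (kk p * (nrm (al p) * r)).
    by rewrite !mulr_ge0 ?nrm_ge0 ?(ltW h0) ?(ltW (kk_gt0 p)).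
  move: (\sum_(_ | _) _) (\sum_(_ | _) _) => S1 S2.
  rewrite !mulrDr; move: (kk p * (_ * _)) => S3 ? ? ?.
  rewrite -mulrA mulrN mulrN; lra.
rewrite -ler_pdivlMl ?mulr_gt0//  => Lp.
have -> : dotv (al p) y = expR (ln (dotv (al p) y)) by rewrite lnK ?posrE.
apply: (@le_trans _ _ (expR (- (L / (h * kk p))))).
  rewrite /e; exact: bigmin_le_cond.
by rewrite ler_expR lerNl mulrC.
Qed.

Lemma energy_min (h : R) z v : 0 < h -> chamber al v ->
  exists2 y, chamber al y & forall y', chamber al y' -> energy h z y <= energy h z y'.
Proof.
move=> h0 Wv.
have [r [e [e0 box]]] := energy_box z (energy h z v) h0.
pose K := [set y : 'rV[R]_N | (forall i, y ord0 i \in `[- r, r]%R) /\ forall p, e <= dotv (al p) y].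
have KW : K `<=` chamber al by move=> y [_ Ky] p; apply: lt_le_trans (Ky p).
have Kv : K v.
  have [v1 v2] := box v Wv (lexx _); split => // i.
  by rewrite in_itv/= -ler_norml.
have cK : compact K.
  apply: (@subclosed_compact _ K [set y : 'rV[R]_N | forall i, y ord0 i \in `[- r, r]%R]).
  - rewrite (_ : K = (\bigcap_i ((fun y : 'rV[R]_N => y ord0 i) @^-1` `[- r, r])) `&`
       \bigcap_p ((dotv (al p)) @^-1` [set t | e <= t])); last first.
      apply/seteqP; split => [y [y1 y2]|y [y1 y2]]; split.
      + by move=> i _; exact: y1.
      + by move=> p _; exact: y2.
      + by move=> i; exact: (y1 i).
      + by move=> p; exact: (y2 p).
    apply: closedI; apply: closed_bigI => i _; apply: preimage_closed.
    + by move=> y _; exact: coord_continuous.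
    + exact: itv_closed.
    + by move=> y _; exact: continuous_dotv.
    + exact: closed_ge.
  - apply: (@rV_compact _ _ (fun=> `[- r, r]%classic)) => _; exact: segment_compact.
  - by move=> y [].
have [|y Ky ymin] := EVT_min_rV (A := K) (ex_intro _ v Kv) cK (f := energy h z).
  apply: continuous_in_subspaceT => y /set_mem Ky; apply: energy_continuous.
  by rewrite inE; exact: KW.
rewrite inE in Ky.
exists y; first exact: KW.
move=> y' Wy'; have [Ey'|/ltW Ey'] := leP (energy h z y') (energy h z v).
  have [y1 y2] := box y' Wy' Ey'; apply: ymin; rewrite inE; split => // i.
  by rewrite in_itv/= -ler_norml.
by apply: le_trans Ey'; apply: ymin; rewrite inE.
Qed.

(** First variation at the minimiser [y]: if the residual [g] were nonzero, moving to [y - t *: g]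
    would change the energy by at most [- t * dotv g g + t ^+ 2 * M], which is negative for small
    [t]. *)
Lemma resolvent_ex (h : R) v z : 0 < h -> chamber al v ->
  exists y, chamber al y /\ y = z + h *: rdrift al kk y.
Proof.
move=> h0 Wv; have [y Wy ymin] := energy_min z h0 Wv.
exists y; split=> //; pose g := y - z - h *: rdrift al kk y.
suff /dotv_eq0/eqP : dotv g g = 0.
  by rewrite /g -addrA -opprD subr_eq0 => /eqP.
apply/eqP; rewrite eq_le dotv_ge0 andbT leNgt; apply/negP => g0.
have gE : y - z = g + h *: rdrift al kk y by rewrite /g subrK.
clearbody g.
pose s p := dotv (al p) g / dotv (al p) y.
pose M := dotv g g / 2 + 2 * h * \sum_p kk p * s p ^+ 2.
have M0 : 0 <= M.
  rewrite addr_ge0 ?divr_ge0 ?dotv_ge0// mulr_ge0 ?mulr_ge0 ?(ltW h0)//.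
  by apply: sumr_ge0 => p _; rewrite mulr_ge0 ?sqr_ge0 ?(ltW (kk_gt0 p)).
pose S := \sum_p `|s p|; have S0 : 0 <= S by apply: sumr_ge0.
(* With [t = 1 / D], the term [2 * S] keeps each [t * s p] within the range of [ln1D_ge], and the
   last term gives [t * M < dotv g g]. *)
pose D := 1 + 2 * S + M / dotv g g.
have MD : 0 <= M / dotv g g by rewrite divr_ge0 ?(ltW g0).
have D0 : 0 < D by rewrite /D; lra.
pose t := D^-1; have t0 : 0 < t by rewrite invr_gt0.
have tM : t * M < dotv g g.
  by rewrite /t mulrC ltr_pdivrMr// mulrC -ltr_pdivrMr// /D; lra.
have ts p : `|- (t * s p)| <= 2^-1.
  rewrite normrN normrM (gtr0_norm t0) /t mulrC ler_pdivrMr//.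
  have : `|s p| <= S by rewrite /S (bigD1 p)//= lerDl sumr_ge0.
  rewrite /D; lra.
have uE p : dotv (al p) (y - t *: g) = dotv (al p) y * (1 + - (t * s p)).
  by rewrite dotvBr dotvZr /s; field; rewrite gt_eqF// Wy.
have pos p : 0 < 1 + - (t * s p).
  by have := ts p; rewrite ler_norml => /andP[]; lra.
have Wt : chamber al (y - t *: g) by move=> p; rewrite uE mulr_gt0 ?Wy.
have := ymin _ Wt; apply/negP; rewrite -ltNge /energy.
have lnE : \sum_p kk p * ln (dotv (al p) y) - t * dotv g (rdrift al kk y)
     - 2 * t ^+ 2 * \sum_p kk p * s p ^+ 2 <= \sum_p kk p * ln (dotv (al p) (y - t *: g)).
  rewrite dot_rdrift !mulr_sumr -!sumrB; apply: ler_sum => p _.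
  rewrite uE lnM ?posrE// ?Wy// mulrDr.
  have := ln1D_ge (ts p) => /(ler_wpM2l (ltW (kk_gt0 p))).
  have -> : kk p * dotv (al p) g / dotv (al p) y = kk p * s p by rewrite /s mulrA.
  by rewrite sqrrN exprMn; lra.
move: lnE => /(ler_wpM2l (ltW h0)).
have -> : y - t *: g - z = (y - z) - t *: g by rewrite addrAC.
rewrite gE; have : t * (t * M) < t * dotv g g by rewrite ltr_pM2l.
rewrite /M; move: (\sum_p kk p * s p ^+ 2) (\sum_p kk p * ln _) (\sum_p kk p * ln _) => A B C.
rewrite !(dotvBl, dotvBr, dotvDl, dotvDr, dotvZl, dotvZr, dotvNl, dotvNr) (dotvC (rdrift al kk y) g).
move: (dotv g (rdrift _ _ _)) => E; rewrite expr2; lra.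
Qed.

End resolvent.

(** * The power profile *)

Lemma mvt_sym {R : realType} (g dg : R -> R) (e x y : R) : e <= x -> e <= y ->
  (forall w, e <= w -> is_derive w 1 g (dg w)) ->
  exists z, [/\ e <= z, `|z - x| <= `|y - x| & g y - g x = dg z * (y - x)].
Proof.
have main a b : e <= a -> a <= b -> (forall w, e <= w -> is_derive w 1 g (dg w)) ->
    exists2 z, a <= z <= b & g b - g a = dg z * (b - a).
  move=> ea ab dg'; have := @MVT_segment R g dg a b ab; case.
  - by move=> w; rewrite in_itv/= => /andP[/ltW aw _]; apply: dg'; exact: le_trans ea aw.
  - apply: derivable_within_continuous => w; rewrite in_itv/= => /andP[aw _].
    by apply: ex_derive; apply: dg'; exact: le_trans ea aw.
  - by move=> z; rewrite in_itv/= => abz E; exists z.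
move=> ex ey d; have [xy|/ltW yx] := leP x y.
  have [z /andP[xz zy] E] := main _ _ ex xy d; exists z; split => //.
    exact: le_trans ex xz.
  by rewrite !ger0_norm ?subr_ge0// lerD2r.
have [z /andP[xz zy] E] := main _ _ ey yx d; exists z; split => //.
  exact: le_trans ey xz.
  by rewrite !ler0_norm ?subr_le0// lerN2 lerD2r.
by rewrite -opprB E -mulrN opprB.
Qed.

Section power_profile.
Context {R : realType}.
Variables (a e : R).
Hypotheses (a_gt0 : 0 < a) (a_lt1 : a < 1) (e_gt0 : 0 < e).
Implicit Types k u v w x y z : R.

Ltac slra := move: a_gt0 a_lt1 e_gt0; lra.
Ltac snra := move: a_gt0 a_lt1 e_gt0; nra.

Definition prof1 (u : R) : R := a * (u + e) `^ (a - 1).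
Definition prof2 (u : R) : R := a * (a - 1) * (u + e) `^ (a - 2).

(* Below zero the power is continued by its second Taylor polynomial, so that the
   profile stays concave on the whole line and keeps a cubic Taylor remainder. *)
Definition prof (u : R) : R :=
  if 0 <= u then (u + e) `^ a
  else e `^ a + prof1 0 * u + prof2 0 / 2 * u ^+ 2.

Lemma powR_mvt (c x y : R) : e <= x -> e <= y ->
  exists z, [/\ e <= z, `|z - x| <= `|y - x| &
    y `^ c - x `^ c = c * z `^ (c - 1) * (y - x)].
Proof.
move=> ex ey; apply: (@mvt_sym _ (fun w => w `^ c) (fun w => c * w `^ (c - 1))) => // w ew.
by apply: is_derive1_powR; exact: lt_le_trans ew.
Qed.

Lemma powR_neg_le (c x : R) : c <= 0 -> e <= x -> x `^ c <= e `^ c.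
Proof.
move=> c0 ex; have x0 := lt_le_trans e_gt0 ex.
rewrite -(opprK c) (powRN x) (powRN e) lef_pV2 ?posrE ?powR_gt0//.
by rewrite ge0_ler_powR ?nnegrE ?oppr_ge0 ?(ltW e_gt0) ?(ltW x0).
Qed.

Lemma powR_neg_lip (c x y : R) : c <= 0 -> e <= x -> e <= y ->
  `|y `^ c - x `^ c| <= `|c| * e `^ (c - 1) * `|y - x|.
Proof.
move=> c0 ex ey; have [z [ez zx ->]] := powR_mvt c ex ey.
rewrite !normrM ler_wpM2r// ler_wpM2l// ger0_norm ?powR_ge0//.
by apply: powR_neg_le => //; slra.
Qed.

(** The mean value theorem is used on the remainder [g] as a function of [y], then on its
    derivative, and the remaining difference is estimated by the Lipschitz bound for a negative
    power on [[e, +oo)]. *)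
Lemma powR_taylor : exists2 C, 0 <= C & forall x y, e <= x -> e <= y ->
  `|y `^ a - x `^ a - a * x `^ (a - 1) * (y - x)
    - a * (a - 1) / 2 * x `^ (a - 2) * (y - x) ^+ 2| <= C * `|y - x| ^+ 3.
Proof.
exists (`|a * (a - 1)| * (`|a - 2| * e `^ (a - 3))).
  by rewrite !mulr_ge0 ?powR_ge0//.
move=> x y ex ey.
pose g w := w `^ a - (a * x `^ (a - 1)) * w
  - (a * (a - 1) / 2 * x `^ (a - 2)) * (w - x) ^+ 2.
pose dg w := a * w `^ (a - 1) - a * x `^ (a - 1)
  - a * (a - 1) * x `^ (a - 2) * (w - x).
have [|z [ez zx E]] := @mvt_sym _ g dg e x y ex ey.
  move=> w ew; have w0 := lt_le_trans e_gt0 ew.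
  have := is_derive1_powR a w0 => dw.
  rewrite /g /dg; apply: is_derive_eq; rewrite /GRing.scale/=.
  by field.
have -> : y `^ a - x `^ a - a * x `^ (a - 1) * (y - x)
    - a * (a - 1) / 2 * x `^ (a - 2) * (y - x) ^+ 2 = g y - g x.
  by rewrite /g subrr expr0n/=; ring.
rewrite E normrM (exprSr _ 2) [leRHS]mulrA ler_wpM2r// /dg.
have [z' [ez' zx' E']] := powR_mvt (a - 1) ex ez.
have -> : a * z `^ (a - 1) - a * x `^ (a - 1) - a * (a - 1) * x `^ (a - 2) * (z - x)
   = a * (a - 1) * ((z' `^ (a - 2) - x `^ (a - 2)) * (z - x)).
  rewrite -mulrBr E' (_ : a - 1 - 1 = a - 2); last by slra.
  by ring.
rewrite normrM -mulrA ler_wpM2l// normrM expr2 mulrA ler_pM//.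
have am2 : a - 2 <= 0 by slra.
apply: le_trans (powR_neg_lip am2 ex ez') _.
rewrite (_ : a - 2 - 1 = a - 3); last by slra.
by rewrite ler_wpM2l ?mulr_ge0 ?powR_ge0// (le_trans zx').
Qed.

Lemma prof1_ge0 u : 0 <= prof1 u.
Proof. by rewrite mulr_ge0 ?powR_ge0 ?ltW. Qed.

Lemma prof1_le u : 0 <= u -> prof1 u <= prof1 0.
Proof.
have am1 : a - 1 <= 0 by slra.
by move=> u0; rewrite /prof1 ler_wpM2l ?(ltW a_gt0)// add0r (powR_neg_le am1)// lerDr.
Qed.

Lemma prof2_le0 u : prof2 u <= 0.
Proof. by rewrite nmulr_rle0 ?powR_ge0// pmulr_rlt0//; slra. Qed.

Lemma prof2_ge u : 0 <= u -> prof2 0 <= prof2 u.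
Proof.
move=> u0; rewrite /prof2 ler_nM2l; last by rewrite pmulr_rlt0//; slra.
have am2 : a - 2 <= 0 by slra.
by rewrite add0r (powR_neg_le am2)// lerDr.
Qed.

Lemma prof_le u : e <= 1 -> 0 <= u -> prof u <= 2 + u.
Proof.
move=> e1 u0; rewrite /prof u0 (@le_trans _ _ ((2 + u) `^ a))//.
  by rewrite ge0_ler_powR ?nnegrE//; slra.
by apply: ler1_powR; slra.
Qed.

(* Supporting lines of the concave extension at points of the half-line. *)
Lemma prof_concave y z : 0 <= y -> prof z <= prof y + prof1 y * (z - y).
Proof.
move=> y0.
have main w : 0 <= w -> (w + e) `^ a <= (y + e) `^ a + prof1 y * (w - y).
  move=> w0; have ey : e <= y + e by slra.
  have ew : e <= w + e by slra.
  rewrite -lerBlDl.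
  have h x1 x2 : e <= x1 -> x1 <= x2 -> exists2 t, x1 <= t <= x2 &
      x2 `^ a - x1 `^ a = a * t `^ (a - 1) * (x2 - x1).
    move=> ex x12; have ex2 := le_trans ex x12.
    have := @MVT_segment R (fun w => w `^ a) (fun w => a * w `^ (a - 1)) x1 x2 x12; case.
    - move=> v; rewrite in_itv/= => /andP[xv _]; apply: is_derive1_powR.
      by apply: lt_le_trans e_gt0 _; rewrite (le_trans ex)// ltW.
    - apply: derivable_within_continuous => v; rewrite in_itv/= => /andP[xv _].
      apply: ex_derive; apply: is_derive1_powR.
      by apply: lt_le_trans e_gt0 _; rewrite (le_trans ex).
    - by move=> t; rewrite in_itv/= => ? ?; exists t.
  have mono x1 x2 : e <= x1 -> x1 <= x2 -> x2 `^ (a - 1) <= x1 `^ (a - 1).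
    move=> ex x12; have x10 := lt_le_trans e_gt0 ex.
    rewrite -(opprB 1 a) (powRN x1) (powRN x2) lef_pV2 ?posrE ?powR_gt0//.
      by rewrite ge0_ler_powR ?nnegrE//; slra.
    by apply: lt_le_trans x12.
  rewrite /prof1; have [yw|/ltW wy] := leP y w.
    have [|t /andP[t1 t2] ->] := h _ (w + e) ey; first slra.
    rewrite (_ : w + e - (y + e) = w - y); last by ring.
    by rewrite ler_wpM2r ?subr_ge0// ler_wpM2l ?(ltW a_gt0)// mono.
  have [|t /andP[t1 t2] E] := h _ (y + e) ew; first slra.
  rewrite -lerN2 opprB E -mulrN opprB (_ : y + e - (w + e) = y - w); last by ring.
  by rewrite ler_wpM2r ?subr_ge0// ler_wpM2l ?(ltW a_gt0)// mono// (le_trans ew).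
rewrite /prof y0; case: ifPn => [z0|]; first exact: main.
rewrite -ltNge => z0.
have := main 0 (lexx _); rewrite add0r sub0r.
have := prof1_le y0; have := prof2_le0 0; have := sqr_ge0 z; snra.
Qed.

(** For [u + v >= 0] this is [powR_taylor]. Otherwise [u <= |v|], and the quadratic polynomials at
    [u] and at [0] are compared: they differ by [O(u^3)] in value and by [O(u)] in second
    derivative, and the difference in slope has the favourable sign. *)
Lemma prof_taylor : exists2 C, 0 <= C & forall u v, 0 <= u ->
  prof u + prof1 u * v + prof2 u / 2 * v ^+ 2 - C * `|v| ^+ 3 <= prof (u + v).
Proof.
have [C C0 tay] := powR_taylor.
pose L := `|a * (a - 1)| * (`|a - 2| * e `^ (a - 3)).
have L0 : 0 <= L by rewrite !mulr_ge0 ?powR_ge0.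
exists (C + L) => [|u v u0]; first exact: addr_ge0.
have eu : e <= u + e by slra.
have v30 : 0 <= `|v| ^+ 3 by rewrite exprn_ge0.
rewrite /prof u0; case: ifPn => [uv|].
  have := tay (u + e) (u + v + e) eu; rewrite (_ : u + v + e - (u + e) = v); last by ring.
  have /[swap]/[apply] : e <= u + v + e by slra.
  rewrite ler_norml => /andP[+ _]; rewrite /prof1 /prof2 !mulrA mulrAC.
  have : 0 <= L * `|v| ^+ 3 by rewrite mulr_ge0.
  by rewrite !mulrDl; slra.
rewrite -ltNge => uv.
have v0 : v < 0 by slra.
have uv' : u <= - v by slra.
(* the two Taylor polynomials at u and at 0, compared coefficientwise *)
have := tay e (u + e) (lexx _) eu; rewrite addrK (ger0_norm u0) => /ler_normlP[_ T0].
have T1 : 0 <= prof1 u - prof1 0 - prof2 0 * u.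
  have [z [ez zx E]] := powR_mvt (a - 1) (lexx e) eu.
  rewrite /prof1 /prof2 add0r -mulrBr E addrK (_ : a - 1 - 1 = a - 2); last by slra.
  rewrite (_ : _ - _ = u * (a * (1 - a)) * (e `^ (a - 2) - z `^ (a - 2))); last by ring.
  have am2 : a - 2 <= 0 by slra.
  rewrite mulr_ge0 ?subr_ge0 ?(powR_neg_le am2)// !mulr_ge0 ?(ltW a_gt0)//; slra.
have T2 : prof2 u - prof2 0 <= L * u.
  rewrite /prof2 -mulrBr add0r (le_trans (ler_norm _))// normrM /L -mulrA ler_wpM2l//.
  have am2 : a - 2 <= 0 by slra.
  apply: le_trans (powR_neg_lip am2 (lexx e) eu) _.
  by rewrite addrK (ger0_norm u0) (_ : a - 2 - 1 = a - 3)//; slra.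
have -> : `|v| = - v by rewrite ltr0_norm.
have u3 : u ^+ 3 <= (- v) ^+ 3 by rewrite lerXn2r ?nnegrE//; slra.
have {T0} T0 : (u + e) `^ a - e `^ a - prof1 0 * u - prof2 0 / 2 * u ^+ 2 <= C * (- v) ^+ 3.
  apply: le_trans (ler_wpM2l C0 u3); apply: le_trans T0; rewrite /prof1 /prof2 add0r.
  by rewrite le_eqVlt; apply/orP; left; apply/eqP; ring.
have {}T2 : (prof2 u - prof2 0) / 2 * v ^+ 2 <= L * (- v) ^+ 3.
  apply: (@le_trans _ _ (L * u / 2 * v ^+ 2)).
    by rewrite ler_wpM2r ?sqr_ge0// ler_pM2r//; slra.
  rewrite (_ : L * u / 2 * v ^+ 2 = L * (u / 2 * v ^+ 2)); last by ring.
  rewrite ler_wpM2l// (exprSr (- v) 2) sqrrN [leRHS]mulrC ler_wpM2r ?sqr_ge0//.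
  slra.
have {}T1 : (prof1 u - prof1 0 - prof2 0 * u) * v <= 0 by rewrite mulr_ge0_le0// ltW.
rewrite mulrDl; snra.
Qed.

(** At [e = 0] both sides agree; the shift adds to the right-hand side the nonnegative term
    [k a (u + e)^(a - 2) e / u]. *)
Lemma prof_generator k u : 0 < u -> 0 <= k ->
  a * (k - (1 - a) / 2) * (u + e) `^ (a - 2) <= prof2 u / 2 + k * prof1 u / u.
Proof.
move=> u0 k0; rewrite /prof1 /prof2.
have ue : 0 < u + e by rewrite addr_gt0.
have -> : (u + e) `^ (a - 1) = (u + e) * (u + e) `^ (a - 2).
  rewrite -{2}(powRr1 (ltW ue)) -powRD; last by rewrite (gt_eqF ue) implybT.
  by congr (_ `^ _); slra.
have := powR_gt0 (a - 2) ue; move: (_ `^ _) => V V0.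
have -> : k * (a * ((u + e) * V)) / u = k * a * V + k * a * V * (e / u).
  by field; rewrite gt_eqF.
have : 0 <= k * a * V * (e / u) by rewrite !mulr_ge0 ?invr_ge0 ?(ltW a_gt0) ?(ltW V0) ?(ltW e_gt0) ?(ltW u0).
slra.
Qed.

(** The product is [a] times [u / (u + e)] times [(u + e)^a], both factors nondecreasing. This is
    the monotonicity that [positive_cross_terms] asks of the derivative of the profile. *)
Lemma mul_prof1_nondecreasing u w : 0 <= u -> u <= w -> u * prof1 u <= w * prof1 w.
Proof.
move=> u0 uw; have w0 := le_trans u0 uw.
have ue : 0 < u + e by apply: ltr_wpDl.
have we : 0 < w + e by apply: ltr_wpDl.
have E x : 0 < x + e -> x * prof1 x = a * ((x / (x + e)) * (x + e) `^ a).
  move=> xe; rewrite /prof1 powRB ?(gt_eqF xe) ?implybT// powRr1 ?(ltW xe)//.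
  by field; rewrite gt_eqF.
rewrite !E// ler_wpM2l ?(ltW a_gt0)// ler_pM ?powR_ge0 ?divr_ge0 ?(ltW ue) ?(ltW we)//.
  by rewrite ler_pdivrMr// mulrAC ler_pdivlMr//; snra.
by rewrite ge0_ler_powR ?nnegrE; slra.
Qed.

End power_profile.

(** * Integration and Gaussian moments *)

Section density.
Local Open Scope ereal_scope.
Import HBNNSimple.
Context d (T : measurableType d) (R : realType).
Variables (mu nu : {measure set T -> \bar R}) (p : T -> R).
Hypotheses (mp : measurable_fun setT p) (p0 : forall x, (0 <= p x)%R).
Hypothesis nuE : forall A, measurable A -> nu A = \int[mu]_(x in A) (p x)%:E.

(** Monotone approximation by simple functions reduces the identity to indicators, where it is
    [nuE]. *)
Lemma ge0_integral_density (g : T -> \bar R) : (forall x, 0 <= g x) ->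
  measurable_fun setT g -> \int[nu]_x g x = \int[mu]_x (g x * (p x)%:E).
Proof.
move=> g0 mg; pose h := nnsfun_approx measurableT mg.
have mpE : measurable_fun setT (EFin \o p) by exact/measurable_EFinP.
have hcvg x : (EFin \o h n) x @[n --> \oo] --> g x by exact: cvg_nnsfun_approx.
have mh n : measurable_fun setT (EFin \o h n).
  by apply/measurable_EFinP; exact/measurable_funP.
have nd x : {homo (fun n => (EFin \o h n) x) : a b / (a <= b)%N >-> a <= b}.
  by move=> a b ab; rewrite lee_fin; exact/lefP/nd_nnsfun_approx.
have -> : \int[nu]_x g x = lim (\int[nu]_x (EFin \o h n) x @[n --> \oo]).
  rewrite -monotone_convergence//; last by move=> n x _; rewrite lee_fin.
  by apply: eq_integral => x _; apply/esym/cvg_lim => //; exact: hcvg.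
have -> : \int[mu]_x (g x * (p x)%:E) =
    lim (\int[mu]_x ((EFin \o h n) x * (p x)%:E) @[n --> \oo]).
  rewrite -monotone_convergence//; last 3 first.
    by move=> n; apply: emeasurable_funM.
    by move=> n x _; rewrite mule_ge0 ?lee_fin.
    by move=> x _ a b ab; rewrite lee_wpmul2r ?lee_fin//; exact: nd.
  apply: eq_integral => x _; apply/esym/cvg_lim => //.
  by apply: cvgeZr => //; exact: hcvg.
apply: congr_lim; apply/funext => n.
have indich r : measurable_fun setT (fun x => (r * \1_(h n @^-1` [set r]) x)%:E).
  by apply/measurable_EFinP; apply: measurable_funM => //; exact: measurable_indic.
transitivity (\int[nu]_x (\sum_(y \in range (h n)) (y * \1_(h n @^-1` [set y]) x)%:E)).
  by apply: eq_integral => t _; rewrite /= fimfunE -fsumEFin.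
rewrite ge0_integral_fsum//; last by move=> m y _; exact: nnfun_muleindic_ge0.
transitivity (\int[mu]_x (\sum_(y \in range (h n))
    (y * \1_(h n @^-1` [set y]) x)%:E * (p x)%:E)); last first.
  apply: eq_integral => x _.
  rewrite -ge0_mule_fsuml => [|y]; last exact: nnfun_muleindic_ge0.
  by rewrite fsumEFin // -(fimfunE _ x).
rewrite ge0_integral_fsum//; last 2 first.
  - by move=> y; apply: emeasurable_funM.
  - by move=> m y _; rewrite mule_ge0 ?lee_fin// -lee_fin EFinM nnfun_muleindic_ge0.
apply: eq_fsbigr => r rhn.
have r0 : (0 <= r)%R by move: rhn; rewrite inE => -[t _ <-].
under eq_integral do rewrite EFinM.
rewrite integralZl_indic_nnsfun// integral_indic// setIT nuE//.
under [RHS]eq_integral do rewrite EFinM -muleA.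
rewrite ge0_integralZl//.
- congr (_ * _); rewrite integral_mkcond; apply: eq_integral => x _.
  by rewrite epatch_indic muleC.
- by apply: emeasurable_funM => //; apply/measurable_EFinP; exact: measurable_indic.
- by move=> t _; rewrite mule_ge0 ?lee_fin.
Qed.

End density.

Section real_integrable.
Context d (T : measurableType d) (R : realType) (mu : {measure set T -> \bar R}).
Variables (D : set T) (mD : measurable D).
Implicit Types f g : T -> R.

Definition rint (f : T -> R) : Prop := mu.-integrable D (EFin \o f).

Lemma rintD f g : rint f -> rint g -> rint (fun x => f x + g x).
Proof. exact: integrableD. Qed.

Lemma rintB f g : rint f -> rint g -> rint (fun x => f x - g x).
Proof. exact: integrableB. Qed.

Lemma rintZl c f : rint f -> rint (fun x => c * f x).
Proof. exact: integrableZl. Qed.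

Lemma rint_norm f : rint f -> rint (fun x => `|f x|).
Proof. exact: integrable_abse. Qed.

Lemma rint_sum (J : Type) (r : seq J) (Q : pred J) (F : J -> T -> R) :
  (forall j, Q j -> rint (F j)) -> rint (fun x => \sum_(j <- r | Q j) F j x).
Proof.
move=> h; elim: r => [|j r IH].
  have -> : (fun x => \sum_(j <- [::] | Q j) F j x) = (fun=> 0).
    by apply/funext => x; rewrite big_nil.
  exact: (@integrable0 _ _ _ mu D).
have [Qj|Qj] := boolP (Q j).
  have -> : (fun x => \sum_(i <- j :: r | Q i) F i x) =
      (fun x => F j x + \sum_(i <- r | Q i) F i x).
    by apply/funext => x; rewrite big_cons Qj.
  by apply: rintD => //; exact: h.
have -> : (fun x => \sum_(i <- j :: r | Q i) F i x) = (fun x => \sum_(i <- r | Q i) F i x).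
  by apply/funext => x; rewrite big_cons (negbTE Qj).
exact: IH.
Qed.

Lemma rint_le f g : measurable_fun D f -> rint g ->
  (forall x, D x -> `|f x| <= g x) -> rint f.
Proof.
move=> mf ig fg; apply: (le_integrable mD _ _ ig); first exact/measurable_EFinP.
by move=> x Dx; rewrite lee_fin (le_trans (fg x Dx))// ler_norm.
Qed.

Lemma rint_measurable f : rint f -> measurable_fun D f.
Proof. by move=> /integrableP[/measurable_EFinP]. Qed.

Lemma Rint_sum (J : Type) (r : seq J) (Q : pred J) (F : J -> T -> R) :
  (forall j, Q j -> rint (F j)) ->
  \int[mu]_(x in D) (\sum_(j <- r | Q j) F j x) =
  \sum_(j <- r | Q j) \int[mu]_(x in D) F j x.
Proof.
move=> h; elim: r => [|j r IH].
  rewrite big_nil; under eq_Rintegral => x _ do rewrite big_nil.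
  by rewrite /Rintegral integral0.
rewrite big_cons; under eq_Rintegral => x _ do rewrite big_cons.
have [Qj|Qj] := boolP (Q j); last exact: IH.
rewrite RintegralD// ?IH//; first exact: h.
exact: rint_sum.
Qed.

Lemma EFin_Rintegral f : rint f ->
  ((\int[mu]_(x in D) f x)%:E = \int[mu]_(x in D) (f x)%:E)%E.
Proof. by move=> h; rewrite /Rintegral fineK//; exact: integrable_fin_num. Qed.

End real_integrable.

Lemma rint_cst d (T : measurableType d) (R : realType) (P : probability T R) (c : R) :
  rint P setT (fun=> c).
Proof. exact: finite_measure_integrable_cst. Qed.

Lemma Rint_cst d (T : measurableType d) (R : realType) (P : probability T R) (c : R) :
  \int[P]_w c = c.
Proof.
have E : (P : {measure set T -> \bar R}) setT = 1%E := probability_setT P.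
by rewrite /Rintegral integral_cst// E mule1.
Qed.

(** * Gaussian moments deduced from exponential moments *)

Section gaussian.
Context d {T : measurableType d} {R : realType} (P : probability T R).
Variables (V : T -> R) (s : R).
Hypotheses (s_gt0 : 0 < s) (mV : measurable_fun setT V).
Hypothesis lawV : forall A, measurable A -> P (V @^-1` A) = normal_prob 0 s A.

Lemma ge0_integral_normal (g : R -> \bar R) : (forall y, 0 <= g y)%E ->
  measurable_fun setT g ->
  (\int[P]_w g (V w) = \int[lebesgue_measure]_y (g y * (normal_pdf 0 s y)%:E))%E.
Proof.
move=> g0 mg.
have mV' : measurable_fun setT (V : T -> measurableTypeR R) := mV.
pose V' : {RV P >-> measurableTypeR R} :=
  HB.pack (V : T -> measurableTypeR R) (isMeasurableFun.Build _ _ _ _ _ mV').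
rewrite -(ge0_integral_distribution V')//.
apply: (@ge0_integral_density _ _ R lebesgue_measure (distribution P V') (normal_pdf 0 s)) => //.
- exact: measurable_normal_pdf.
- by move=> y; exact: normal_pdf_ge0.
Qed.

(** Completing the square: an exponential weight translates the Gaussian density. The exponential
    moments below are then total masses. *)
Lemma normal_pdf_tilt (m y : R) : expR (m * y) * normal_pdf 0 s y =
  expR (m ^+ 2 * s ^+ 2 / 2) * normal_pdf (m * s ^+ 2) s y.
Proof.
rewrite !normal_pdfE ?gt_eqF//= mulrCA [RHS]mulrCA; congr (_ * _).
rewrite /normal_fun -!expRD; congr expR.
by field; rewrite gt_eqF.
Qed.

Lemma normal_mgf (m : R) :
  (\int[P]_w (expR (m * V w))%:E = (expR (m ^+ 2 * s ^+ 2 / 2))%:E)%E.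
Proof.
rewrite (@ge0_integral_normal (fun y => (expR (m * y))%:E)); first last.
- apply/measurable_EFinP; apply: measurableT_comp => //.
- by move=> y; rewrite lee_fin expR_ge0.
under eq_integral do rewrite -EFinM normal_pdf_tilt EFinM.
rewrite ge0_integralZl ?lee_fin ?expR_ge0//.
- by rewrite integral_normal_pdf mule1.
- by apply/measurable_EFinP; exact: measurable_normal_pdf.
- by move=> y _; rewrite lee_fin normal_pdf_ge0.
Qed.

Lemma integrable_expR_normal (m : R) :
  P.-integrable setT (EFin \o (fun w => expR (m * V w))).
Proof.
apply/integrableP; split.
  apply/measurable_EFinP; apply: measurableT_comp => //.
  exact: measurable_funM.
under eq_integral do rewrite /= ger0_norm ?expR_ge0//.
by rewrite normal_mgf ltry.
Qed.

Lemma Rnormal_mgf (m : R) :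
  \int[P]_w expR (m * V w) = expR (m ^+ 2 * s ^+ 2 / 2).
Proof. by rewrite /Rintegral normal_mgf. Qed.

(** The cubic term of the exponential series. Exponential moments are the only Gaussian integrals
    computed; the other moments are compared with them. *)
Lemma cube_le_expR (t : R) : `|t| ^+ 3 <= 6 * (expR t + expR (- t)).
Proof.
have h (u : R) : 0 <= u -> u ^+ 3 <= 6 * expR u.
  move=> u0; have := expR_ge1Dxn 2 u0.
  rewrite (_ : 3`! = 6)%N// -[X in _ -> X <= _]mulr1 -ler_pdivrMl//.
  rewrite mulr1 mulrC; lra.
have e1 := expR_ge0 t; have e2 := expR_ge0 (- t).
have [t0|t0] := leP 0 t; first by have := h t t0; rewrite ger0_norm//; lra.
by rewrite ltr0_norm//; have := h (- t); lra.
Qed.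

Lemma norm_le_expR (t : R) : `|t| <= expR t + expR (- t).
Proof.
have e1 := expR_ge0 t; have e2 := expR_ge0 (- t).
have := expR_ge1Dx t; have := expR_ge1Dx (- t).
by rewrite ler_norml => *; apply/andP; split; lra.
Qed.

Let cosh2 (m : R) : P.-integrable setT
  (EFin \o (fun w => expR (m * V w) + expR (- (m * V w)))).
Proof.
under [X in _ \o X]eq_fun do rewrite -mulNr.
by apply: rintD => //; exact: integrable_expR_normal.
Qed.

Let Ecosh2 (m : R) : \int[P]_w (expR (m * V w) + expR (- (m * V w))) =
  2 * expR (m ^+ 2 * s ^+ 2 / 2).
Proof.
under eq_Rintegral => w _ do rewrite -mulNr.
rewrite RintegralD//; try exact: integrable_expR_normal.
by rewrite !Rnormal_mgf sqrrN; lra.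
Qed.

Lemma integrable_normal_cube : rint P setT (fun w => `|V w| ^+ 3).
Proof.
apply: (rint_le measurableT _ (rintZl measurableT 6 (cosh2 1))).
- by apply/measurable_funX/measurableT_comp.
- move=> w _ /=; rewrite mul1r ger0_norm ?exprn_ge0//; exact: cube_le_expR.
Qed.

Lemma integrable_normal_sqr : rint P setT (fun w => V w ^+ 2).
Proof.
have i1 := rintD measurableT (rint_cst P 1) integrable_normal_cube.
apply: (rint_le measurableT _ i1); first exact: measurable_funX.
move=> w _ /=; rewrite ger0_norm ?sqr_ge0//.
rewrite -real_normK ?num_real//; have := normr_ge0 (V w).
move: `|V w| => v v0; rewrite (exprS v 2).
have [v1|v1] := leP v 1.
  have v2 : v ^+ 2 <= 1 by rewrite expr_le1.
  by have := mulr_ge0 v0 (sqr_ge0 v); lra.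
by have := ler_peMl (sqr_ge0 v) (ltW v1); lra.
Qed.

Lemma integrable_normal : rint P setT V.
Proof.
apply: (rint_le measurableT _ (cosh2 1)) => //.
by move=> w _ /=; rewrite mul1r; exact: norm_le_expR.
Qed.

(** From [1 + u <= expR u], [m] times the mean is at most [expR (m^2 s^2 / 2) - 1], which is of
    order [m^2]. Small [m] of the sign of the mean force the mean to vanish. *)
Lemma normal_mean : \int[P]_w V w = 0.
Proof.
have h (m : R) : m * \int[P]_w V w <= expR (m ^+ 2 * s ^+ 2 / 2) - 1.
  rewrite -Rnormal_mgf -RintegralZl//; last exact: integrable_normal.
  have -> : 1 = \int[P]_w 1 :> R.
    by rewrite Rint_cst.
  rewrite -RintegralB//; last 2 first.
  - exact: integrable_expR_normal.
  - exact: rint_cst.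
  apply: le_Rintegral => //.
  - by apply: rintZl => //; exact: integrable_normal.
  - by apply: rintB; [|exact: integrable_expR_normal|exact: rint_cst].
  - by move=> w _; have := expR_ge1Dx (m * V w); lra.
have small (x : R) : 0 <= x -> x <= 2^-1 -> expR x - 1 <= 2 * x.
  move=> x0 x1; have e0 := expR_gt0 x.
  have : (1 - x) * expR x <= 1.
    rewrite -[leRHS](mulVf (lt0r_neq0 e0)) ler_pM2r// -expRN; exact: expR_ge1Dx.
  by nra.
set e := Rintegral _ _ _ in h *.
apply/eqP/negPn/negP => e0.
have e20 : 0 < e ^+ 2 by rewrite exprn_even_gt0.
have s20 : 0 < s ^+ 2 by rewrite exprn_gt0.
(* With [t = 1 / D] the three terms give [t <= 1], [t * s^2 < 1] and [t * e^2 * s^2 <= 1]; the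
   inequality is then tested at [m = t * e]. *)
pose D := 1 + s ^+ 2 + e ^+ 2 * s ^+ 2.
have es : 0 < e ^+ 2 * s ^+ 2 by rewrite mulr_gt0.
have D0 : 0 < D by rewrite /D; lra.
pose t := D^-1; have t0 : 0 < t by rewrite invr_gt0.
have tD : t * D = 1 by rewrite mulVf ?gt_eqF.
have t1 : t <= 1 by rewrite invf_le1// /D; lra.
have tes : t * (e ^+ 2 * s ^+ 2) <= 1.
  by rewrite -tD ler_pM2l// /D; lra.
have ts : t * s ^+ 2 < 1 by rewrite -tD ltr_pM2l// /D; lra.
have te0 : 0 <= (t * e) ^+ 2 * s ^+ 2 / 2 by rewrite divr_ge0// mulr_ge0 ?sqr_ge0.
have E1 : (t * e) ^+ 2 * s ^+ 2 / 2 = t * (t * (e ^+ 2 * s ^+ 2)) / 2 by ring.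
have le1 : (t * e) ^+ 2 * s ^+ 2 / 2 <= 2^-1.
  rewrite E1 -[leRHS]mul1r ler_pM2r// mulr_ile1//.
  - exact: ltW.
  - by rewrite mulr_ge0 ?(ltW t0) ?(ltW es).
have sm := small _ te0 le1.
have := le_trans (h (t * e)) sm.
have -> : t * e * e = t * e ^+ 2 by ring.
have -> : 2 * ((t * e) ^+ 2 * s ^+ 2 / 2) = t * e ^+ 2 * (t * s ^+ 2) by field.
by apply/negP; rewrite -ltNge -[ltRHS]mulr1 ltr_pM2l// mulr_gt0.
Qed.

(** [expR t + expR (- t) - 2] is the square of [expR (t / 2) - expR (- t / 2)], which is at least
    [|t|] in absolute value because the hyperbolic sine has slope at least 1. *)
Lemma sqr_le_cosh (t : R) : 2 + t ^+ 2 <= expR t + expR (- t).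
Proof.
have h (u : R) : 0 <= u -> 2 * u <= expR u - expR (- u).
  move=> u0; pose g (w : R) := expR w - expR (- w) - 2 * w.
  pose dg (w : R) := expR w + expR (- w) - 2.
  have [|z [z0 _]] := @mvt_sym _ g dg 0 0 u (lexx _) u0.
    move=> w _; rewrite /g /dg; apply: is_derive_eq.
    by rewrite /GRing.scale/=; ring.
  rewrite /g /dg oppr0 subrr mulr0 subr0 !subr0 => E.
  rewrite -subr_ge0 E mulr_ge0 ?addr0//.
  have := expR_gt0 z; have : expR z * expR (- z) = 1 by rewrite -expRD subrr expR0.
  move: (expR z) (expR (- z)) => x y xy x0.
  have y0 : 0 < y by rewrite -(pmulr_rgt0 _ x0) xy.
  have := sqr_ge0 (x - y); have := sqr_ge0 (x + y - 2); nra.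
have hp (y : R) : 0 <= y -> 4 * y ^+ 2 <= (expR y - expR (- y)) ^+ 2.
  move=> y0; rewrite (_ : 4 * y ^+ 2 = (2 * y) ^+ 2); last by ring.
  by rewrite lerXn2r ?nnegrE ?h ?mulr_ge0// (le_trans _ (h y y0))// mulr_ge0.
have h2 (y : R) : 4 * y ^+ 2 <= (expR y - expR (- y)) ^+ 2.
  have [/hp//|y0] := leP 0 y.
  rewrite (_ : (expR y - expR (- y)) ^+ 2 = (expR (- y) - expR y) ^+ 2); last by ring.
  by have := hp (- y); rewrite opprK sqrrN oppr_ge0; apply; exact: ltW.
have := h2 (t / 2); rewrite sqrrB -!expRM_natl -expRD subrr expR0.
rewrite (_ : 2%:R * (t / 2) = t); last by field.
rewrite (_ : 2%:R * - (t / 2) = - t); last by field.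
rewrite (_ : 4 * (t / 2) ^+ 2 = t ^+ 2); last by field.
by rewrite mulr2n; lra.
Qed.

(** [sqr_le_cosh] at [m * V] gives [m^2 E V^2 <= 2 expR (m^2 s^2 / 2) - 2]; divide by [m^2] and let
    [m] tend to 0. The parameter [x] of [key] is [m^2 s^2 / 2]. *)
Lemma normal_second_moment : \int[P]_w V w ^+ 2 <= s ^+ 2.
Proof.
have h (m : R) : m ^+ 2 * \int[P]_w V w ^+ 2 <= 2 * expR (m ^+ 2 * s ^+ 2 / 2) - 2.
  rewrite -Ecosh2 -RintegralZl//; last exact: integrable_normal_sqr.
  rewrite -[X in _ <= _ - X](Rint_cst P).
  rewrite -RintegralB//; last exact: rint_cst.
  apply: le_Rintegral => //.
  - by apply: rintZl => //; exact: integrable_normal_sqr.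
  - by apply: rintB; [|exact: cosh2|exact: rint_cst].
  - by move=> w _; have := sqr_le_cosh (m * V w); rewrite exprMn; lra.
set e := Rintegral _ _ _ in h *.
have small (x : R) : 0 <= x -> x < 1 -> (1 - x) * (expR x - 1) <= x.
  move=> x0 x1; have e0 := expR_gt0 x.
  have : (1 - x) * expR x <= 1.
    rewrite -[leRHS](mulVf (lt0r_neq0 e0)) ler_pM2r// -expRN; exact: expR_ge1Dx.
  by nra.
have s20 : 0 < s ^+ 2 by rewrite exprn_gt0.
have key (x : R) : 0 < x -> x < 1 -> (1 - x) * e <= s ^+ 2.
  move=> x0 x1; pose m := Num.sqrt (2 * x / s ^+ 2).
  have m2 : m ^+ 2 = 2 * x / s ^+ 2 by rewrite sqr_sqrtr// divr_ge0 ?(ltW s20)// mulr_ge0// ltW.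
  have := h m; rewrite m2 (_ : 2 * x / s ^+ 2 * s ^+ 2 / 2 = x); last first.
    by field; rewrite gt_eqF.
  move=> hm; have x1' : 0 < 1 - x by lra.
  have := small x (ltW x0) x1.
  move: hm; rewrite -(ler_pM2l x1') => hm sm.
  have : (1 - x) * (2 * x / s ^+ 2 * e) <= 2 * x by lra.
  have -> : (1 - x) * (2 * x / s ^+ 2 * e) = 2 * x * ((1 - x) * e / s ^+ 2).
    by field; rewrite gt_eqF.
  by rewrite -[leRHS]mulr1 ler_pM2l ?mulr_gt0// ler_pdivrMr// mul1r.
have e0 : 0 <= e by apply: Rintegral_ge0 => w _; exact: sqr_ge0.
apply/ler_addgt0Pr => z z0.
pose x := z / (1 + z + e).
have D0 : 0 < 1 + z + e by lra.
have x0 : 0 < x by rewrite divr_gt0.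
have x1 : x < 1 by rewrite ltr_pdivrMr// mul1r; lra.
have := key x x0 x1; have : x * e <= z.
  by rewrite /x mulrAC ler_pdivrMr// ler_wpM2l ?(ltW z0)//; lra.
lra.
Qed.

End gaussian.

Section gaussian_scaled.
Context d {T : measurableType d} {R : realType} (P : probability T R).

(** [cube_le_expR] at [V / s], where each of the two exponentials has mean [expR (1/2)]; hence the
    constant [6 * 2 * expR (1/2)]. *)
Lemma normal_third_moment (V : T -> R) (s : R) : 0 < s -> measurable_fun setT V ->
  (forall A, measurable A -> P (V @^-1` A) = normal_prob 0 s A) ->
  \int[P]_w `|V w| ^+ 3 <= 12 * expR (2^-1) * s ^+ 3.
Proof.
move=> s0 mV lawV.
have i m := integrable_expR_normal s0 mV lawV m.
have E m := Rnormal_mgf s0 mV lawV m.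
have ic : P.-integrable setT
    (EFin \o (fun w => expR (s^-1 * V w) + expR (- s^-1 * V w))).
  by apply: rintD => //; exact: i.
apply: (@le_trans _ _ (\int[P]_w (6 * s ^+ 3 * (expR (s^-1 * V w) + expR (- s^-1 * V w))))).
  apply: le_Rintegral => //.
  - exact: (integrable_normal_cube s0 mV lawV).
  - by apply: rintZl.
  - move=> w _; have := cube_le_expR (s^-1 * V w).
    rewrite normrM exprMn (gtr0_norm (x := s^-1)) ?invr_gt0// exprVn mulrC.
    by rewrite ler_pdivrMr ?exprn_gt0// mulNr; lra.
rewrite RintegralZl// RintegralD// !E sqrrN.
rewrite (_ : s^-1 ^+ 2 * s ^+ 2 / 2 = 2^-1); last by field; rewrite gt_eqF.
lra.
Qed.

(** Chernoff's bound with the optimal parameter [m = x / s^2], for both signs of [V] at once. *)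
Lemma normal_tail (V : T -> R) (s x : R) : 0 < s -> measurable_fun setT V ->
  (forall A, measurable A -> P (V @^-1` A) = normal_prob 0 s A) ->
  0 <= x -> (P [set w | x <= `|V w| ]%R <= (2 * expR (- (x ^+ 2 / (2 * s ^+ 2))))%:E)%E.
Proof.
move=> s0 mV lawV x0.
pose m := x / s ^+ 2.
have m0 : 0 <= m by rewrite divr_ge0// sqr_ge0.
have mE : measurable_fun setT (fun w => expR (m * V w) + expR (- m * V w)).
  by apply: measurable_funD; apply: measurableT_comp => //; exact: measurable_funM.
have mA : measurable [set w | x <= `|V w| ].
  have mn : measurable_fun setT (fun w => `|V w|) by exact: measurableT_comp.
  rewrite (_ : [set w | _] = setT `&` (fun w => `|V w|) @^-1` `[x, +oo[).
    exact: mn.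
  by rewrite setTI; apply/seteqP; split => w /=; rewrite in_itv/= andbT.
have h : ((expR (m * x))%:E * P [set w | x <= `|V w| ]%R <=
    \int[P]_w (expR (m * V w) + expR (- m * V w))%:E)%E.
  rewrite -integral_cst// integral_mkcond.
  apply: ge0_le_integral => //.
  - by move=> w _; rewrite patchE; case: ifP => //; rewrite lee_fin expR_ge0.
  - exact/(measurable_restrictT _ mA)/measurable_cst.
  - exact/measurable_EFinP.
  - move=> w _; rewrite patchE; case: ifPn => [|_]; last by rewrite lee_fin addr_ge0 ?expR_ge0.
    rewrite inE/= lee_fin => xV.
    have [V0|V0] := leP 0 (V w).
      rewrite (@le_trans _ _ (expR (m * V w)))// ?lerDl ?expR_ge0//.
      by rewrite ler_expR ler_wpM2l// -(ger0_norm V0).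
    rewrite (@le_trans _ _ (expR (- m * V w)))// ?lerDr ?expR_ge0//.
    by rewrite ler_expR mulNr -mulrN ler_wpM2l// -(ltr0_norm V0).
have mX c : measurable_fun setT (fun w => (expR (c * V w))%:E).
  by apply/measurable_EFinP; apply: measurableT_comp => //; exact: measurable_funM.
have E2 : (\int[P]_w (expR (m * V w) + expR (- m * V w))%:E =
    \int[P]_w (expR (m * V w))%:E + \int[P]_w (expR (- m * V w))%:E)%E.
  by rewrite -ge0_integralD// => w _; rewrite lee_fin expR_ge0.
rewrite {}E2 in h.
move: h; rewrite !(normal_mgf s0 mV lawV) sqrrN -EFinD.
have -> : m ^+ 2 * s ^+ 2 / 2 = x ^+ 2 / (2 * s ^+ 2) by rewrite /m; field; rewrite gt_eqF.
have -> : m * x = x ^+ 2 / (2 * s ^+ 2) + x ^+ 2 / (2 * s ^+ 2) by rewrite /m; field; rewrite gt_eqF.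
set z := x ^+ 2 / (2 * s ^+ 2).
rewrite muleC -lee_pdivlMr ?expR_gt0// => /le_trans; apply.
by rewrite lee_fin expRD expRN le_eqVlt; apply/orP; left; apply/eqP; field; rewrite gt_eqF// expR_gt0.
Qed.

(** The density is at most [1 / s], and the event confines [V] to an interval of length [2 r]
    whatever the shift [c]. *)
Lemma normal_small_ball (V : T -> R) (s c r : R) : 0 < s ->
  (forall A, measurable A -> P (V @^-1` A) = normal_prob 0 s A) ->
  0 <= r -> (P [set w | `|c + V w| <= r ]%R <= (2 * r / s)%:E)%E.
Proof.
move=> s0 lawV r0.
have -> : [set w | `|c + V w| <= r ]%R = V @^-1` `[- c - r, - c + r].
  apply/seteqP; split => w /=; rewrite in_itv/= ler_norml => /andP[? ?]; apply/andP; split; lra.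
rewrite lawV// /normal_prob.
apply: (@le_trans _ _ (\int[lebesgue_measure]_(x in `[(- c - r)%R, (- c + r)%R]) (s^-1)%:E)%E).
  apply: ge0_le_integral => //=.
  - by move=> y _; rewrite lee_fin normal_pdf_ge0.
  - by apply/measurable_funTS/measurable_EFinP; exact: measurable_normal_pdf.
  - move=> y _; rewrite lee_fin (le_trans (normal_pdf_ub _ _ _)) ?gt_eqF//.
    rewrite /normal_peak lef_pV2 ?posrE ?sqrtr_gt0 ?pmulrn_lgt0 ?mulr_gt0 ?exprn_gt0 ?pi_gt0//.
    rewrite -[leLHS](gtr0_norm s0) -sqrtr_sqr ler_wsqrtr// -mulrnAr.
    by rewrite ler_peMr ?sqr_ge0// mulr2n; have := pi_ge2 R; lra.
rewrite integral_cst//= lebesgue_measure_itv/= lte_fin.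
case: ifPn => [_|_]; last by rewrite mule0 lee_fin divr_ge0 ?mulr_ge0 ?(ltW s0).
by rewrite -EFinD -EFinM lee_fin; lra.
Qed.

End gaussian_scaled.

(** * Independence *)

Section independence.
Context d {T : measurableType d} {R : realType} (P : probability T R).
Context {I : finType} (Y : I -> T -> R) (q : I).
Hypotheses (mY : forall p, measurable_fun setT (Y p))
  (indY : mutually_independent P Y).

(** The rectangles unconstrained in direction [q]: a pi-system generating the sigma-algebra of all
    coordinates except [q]. Measurability with respect to it is the form in which independence of
    [Y q] is used. *)
Definition others : set (set T) :=
  [set S | exists A : I -> set R, [/\ forall p, measurable (A p), A q = setT &
    S = \bigcap_(p in [set: I]) (Y p @^-1` A p)]].

Notation TO := (g_sigma_algebraType others).

Lemma measurable_cylinder (A : I -> set R) : (forall p, measurable (A p)) ->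
  measurable (\bigcap_(p in [set: I]) (Y p @^-1` A p)).
Proof.
move=> mA; apply: fin_bigcap_measurable; first exact: finite_finset.
by move=> p _; rewrite -[X in measurable X]setTI; exact: mY.
Qed.

Lemma others_measurable : others `<=` measurable.
Proof. by move=> _ [A [mA _ ->]]; exact: measurable_cylinder. Qed.

Lemma sigma_others_measurable S : <<s others >> S -> measurable S.
Proof. by apply: smallest_sub => //; [exact: sigma_algebra_measurable|exact: others_measurable]. Qed.

Lemma measurable_coord_others p : p != q -> measurable_fun setT (Y p : TO -> R).
Proof.
move=> pq _ A mA; rewrite setTI; apply: sub_sigma_algebra.
exists (fun i => if i == p then A else setT); split.
- by move=> i; case: ifP.
- by rewrite eq_sym (negbTE pq).
- apply/seteqP; split => [w Aw i _ /=|w /(_ p Logic.I) /=]; last by rewrite eqxx.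
  by case: eqP => [->|].
Qed.

Lemma measurable_of_others d' (T' : measurableType d') (U : T -> T') :
  measurable_fun setT (U : TO -> T') -> measurable_fun setT U.
Proof.
by move=> mU _ A mA; apply: sigma_others_measurable; exact: (mU measurableT A mA).
Qed.

(** As functions of [S] both sides are finite measures that agree on the pi-system [others], hence
    on the sigma-algebra it generates. *)
Lemma indep_others S E : <<s others >> S -> measurable E ->
  (P (S `&` Y q @^-1` E) = P S * P (Y q @^-1` E))%E.
Proof.
move=> sS mE.
have mYE : measurable (Y q @^-1` E) by rewrite -[X in measurable X]setTI; exact: mY.
pose r : {nonneg R} := NngNum (fine_ge0 (measure_ge0 P (Y q @^-1` E))).
have rE : (r%:num%:E = P (Y q @^-1` E))%E by rewrite /= fineK// fin_num_measure.
rewrite muleC -rE.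
apply: (@g_sigma_algebra_measure_unique _ R T others others_measurable (fun=> setT) _ _
  (mrestr P mYE) (mscale r P)) => //.
- move=> _; exists (fun=> setT); split => //.
  by apply/seteqP; split => // w _ i _.
- by rewrite bigcup_const.
- move=> _ _ [A [mA Aq ->]] [B [mB Bq ->]].
  exists (fun i => A i `&` B i); split.
  + by move=> i; exact: measurableI.
  + by rewrite Aq Bq setTI.
  + apply/seteqP; split => [w [Aw Bw] i _|w ABw]; first by split; [exact: Aw|exact: Bw].
    by split => i _; have [] := ABw i Logic.I.
- move=> _ [A [mA Aq ->]].
  have E1 : P (Y q @^-1` setT) = 1%E by rewrite preimage_setT; exact: probability_setT.
  transitivity (P (Y q @^-1` E) * P (\bigcap_(p in [set: I]) (Y p @^-1` A p)))%E; last first.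
    by rewrite -rE.
  transitivity (P ((\bigcap_(p in [set: I]) (Y p @^-1` A p)) `&` Y q @^-1` E)); first by [].
  pose A' i := if i == q then E else A i.
  have mA' i : measurable (A' i) by rewrite /A'; case: ifP.
  rewrite (_ : _ `&` _ = \bigcap_(p in [set: I]) (Y p @^-1` A' p)); last first.
    apply/seteqP; split => [w [Aw Ew] i _|w Aw].
      by rewrite /A' /=; case: eqP => [->//|_]; exact: Aw.
    split; last by have := Aw q Logic.I; rewrite /A' /= eqxx.
    move=> i _; have := Aw i Logic.I; rewrite /A' /=; case: eqP => // ->.
    by rewrite Aq.
  rewrite !indY// (bigD1 q)//= [in RHS](bigD1 q)//= Aq E1 mul1e.
  rewrite /A' eqxx; congr (_ * _)%E; apply: eq_bigr => i iq.
  by rewrite (negbTE iq).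
- move=> _; apply: (@le_lt_trans _ _ 1%E); last exact: ltry.
  apply: (@probability_le1 _ _ _ P (setT `&` Y q @^-1` E)).
  exact: measurableI.
Qed.

(** By [indep_others] the joint law of [U] and [Y q] agrees with the product of their laws on
    rectangles, so it is that product and Tonelli's theorem applies. *)
Lemma indep_tonelli (U : T -> R) (phi : R * R -> \bar R) :
  measurable_fun setT (U : TO -> R) -> (forall z, 0 <= phi z)%E ->
  measurable_fun setT phi ->
  (\int[P]_w phi (U w, Y q w) = \int[P]_w \int[P]_w' phi (U w, Y q w'))%E.
Proof.
move=> mU phi0 mphi.
have mU' := measurable_of_others mU.
pose X1 : {RV P >-> R} := HB.pack U (isMeasurableFun.Build _ _ _ _ _ mU').
pose X2 : {RV P >-> R} := HB.pack (Y q) (isMeasurableFun.Build _ _ _ _ _ (mY q)).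
have mX : measurable_fun setT (fun w => (U w, Y q w)).
  exact: (measurable_fun_pair mU' (mY q)).
pose X : {RV P >-> (R * R)%type} := HB.pack (fun w => (U w, Y q w))
  (isMeasurableFun.Build _ _ _ _ _ mX).
have prodE A : measurable A -> (distribution P X1 \x distribution P X2)%E A = distribution P X A.
  apply: product_measure_unique => A1 A2 mA1 mA2.
  rewrite /distribution /pushforward/=.
  have := @indep_others (U @^-1` A1) A2 _ mA2.
  by apply; rewrite -[_ @^-1` _]setTI; exact: mU.
transitivity (\int[distribution P X]_z phi z)%E.
  by rewrite ge0_integral_distribution.
rewrite (eq_measure_integral (distribution P X1 \x distribution P X2)%E); last first.
  by move=> A mA _; apply/esym; exact: prodE.
rewrite fubini_tonelli1// ge0_integral_distribution//.
- apply: eq_integral => w _ /=; rewrite /fubini_F ge0_integral_distribution//.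
  exact: measurableT_comp.
- exact: measurable_fun_fubini_tonelli_F.
- by move=> y; apply: integral_ge0.
Qed.

Lemma indep_tonelli_measurable (U : T -> R) (phi : R * R -> \bar R) :
  measurable_fun setT (U : TO -> R) -> (forall z, 0 <= phi z)%E ->
  measurable_fun setT phi ->
  measurable_fun setT (fun w => \int[P]_w' phi (U w, Y q w'))%E.
Proof.
move=> mU phi0 mphi; have mU' := measurable_of_others mU.
pose X2 : {RV P >-> R} := HB.pack (Y q) (isMeasurableFun.Build _ _ _ _ _ (mY q)).
have -> : (fun w => \int[P]_w' phi (U w, Y q w'))%E =
    (fubini_F (distribution P X2) phi) \o U.
  apply/funext => w /=; rewrite /fubini_F ge0_integral_distribution//.
  exact: measurableT_comp.
by apply: measurableT_comp => //; exact: measurable_fun_fubini_tonelli_F.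
Qed.

Lemma indep_mul_ge0 (U : T -> R) (psi : R -> R) :
  measurable_fun setT (U : TO -> R) -> measurable_fun setT psi ->
  (forall w, 0 <= U w) -> (forall y, 0 <= psi y) ->
  (\int[P]_w (U w * psi (Y q w))%:E =
   \int[P]_w (U w)%:E * \int[P]_w (psi (Y q w))%:E)%E.
Proof.
move=> mU mpsi U0 psi0.
have mU' := measurable_of_others mU.
have mpY : measurable_fun setT (fun w => psi (Y q w)) by exact: measurableT_comp.
pose phi (z : R * R) := (`|z.1| * psi z.2)%:E.
have := @indep_tonelli U phi mU.
have phi0 z : (0 <= phi z)%E by rewrite lee_fin mulr_ge0.
have mphi : measurable_fun setT phi.
  apply/measurable_EFinP/measurable_funM.
    by apply: measurableT_comp => //; exact: measurableT_comp.
  exact: measurableT_comp.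
move=> /(_ phi0 mphi); rewrite /phi/=.
under eq_integral do rewrite ger0_norm//.
move=> ->; rewrite -ge0_integralZr//; first last.
- by apply: integral_ge0 => w _; rewrite lee_fin.
- by move=> w _; rewrite lee_fin.
- exact/measurable_EFinP.
apply: eq_integral => w _; rewrite (ger0_norm (U0 w)).
under eq_integral do rewrite EFinM.
rewrite ge0_integralZl//.
- exact/measurable_EFinP.
- by move=> y _; rewrite lee_fin.
- by rewrite lee_fin.
Qed.

Let rint_mul_ge0 (U : T -> R) (psi : R -> R) :
  measurable_fun setT (U : TO -> R) -> measurable_fun setT psi ->
  (forall w, 0 <= U w) -> (forall y, 0 <= psi y) ->
  rint P setT U -> rint P setT (psi \o Y q) ->
  rint P setT (fun w => U w * psi (Y q w)) /\
  \int[P]_w (U w * psi (Y q w)) = (\int[P]_w U w) * \int[P]_w psi (Y q w).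
Proof.
move=> mU mpsi U0 psi0 iU iV.
have mU' := measurable_of_others mU.
have E := indep_mul_ge0 mU mpsi U0 psi0.
rewrite -(EFin_Rintegral measurableT iU) -(EFin_Rintegral measurableT iV) in E.
split; last by rewrite /Rintegral E.
apply/integrableP; split.
  apply/measurable_EFinP/measurable_funM => //; exact: measurableT_comp.
under eq_integral do rewrite /= ger0_norm ?mulr_ge0//.
by rewrite E ltry.
Qed.

(** Both factors are split into positive and negative parts, and the nonnegative case is applied to
    the four products. *)
Lemma indep_mul (U : T -> R) (psi : R -> R) :
  measurable_fun setT (U : TO -> R) -> measurable_fun setT psi ->
  rint P setT U -> rint P setT (psi \o Y q) ->
  rint P setT (fun w => U w * psi (Y q w)) /\
  \int[P]_w (U w * psi (Y q w)) = (\int[P]_w U w) * \int[P]_w psi (Y q w).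
Proof.
move=> mU mpsi iU iV.
have mU' := measurable_of_others mU.
have mV : measurable_fun setT (psi \o Y q) by exact: measurableT_comp.
pose up (x : R) := Num.max x 0; pose un (x : R) := Num.max (- x) 0.
have upE x : x = up x - un x.
  rewrite /up /un; have [x0|/ltW x0] := leP 0 x.
    by rewrite max_r ?subr0 ?oppr_le0.
  by rewrite max_l ?oppr_ge0// sub0r opprK.
have up0 x : 0 <= up x by rewrite le_max lexx orbT.
have un0 x : 0 <= un x by rewrite le_max lexx orbT.
have upn x : up x <= `|x| by rewrite /up ge_max normr_ge0 ler_norm.
have unn x : un x <= `|x| by rewrite /un ge_max normr_ge0 -normrN ler_norm.
have mup : measurable_fun setT up by apply: measurable_maxr => //; exact: measurable_cst.
have mun : measurable_fun setT un.
  exact: (measurableT_comp mup (@oppr_measurable R setT)).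
have iP (V : T -> R) : measurable_fun setT V -> rint P setT V ->
    forall g : R -> R, measurable_fun setT g -> (forall x, 0 <= g x) ->
    (forall x, g x <= `|x|) -> rint P setT (g \o V).
  move=> mV' iV' g mg g0 gn.
  apply: (@rint_le _ _ _ P setT measurableT (g \o V) (fun x => `|V x|)).
  - exact: measurableT_comp.
  - exact: rint_norm.
  - by move=> w _ /=; rewrite ger0_norm.
have iUp := iP _ mU' iU; have iVp := iP _ mV iV.
have prod (g k : R -> R) : measurable_fun setT g -> measurable_fun setT k ->
    (forall x, 0 <= g x) -> (forall x, 0 <= k x) ->
    (forall x, g x <= `|x|) -> (forall x, k x <= `|x|) ->
    rint P setT (fun w => g (U w) * k (psi (Y q w))) /\
    \int[P]_w (g (U w) * k (psi (Y q w))) =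
      (\int[P]_w g (U w)) * \int[P]_w k (psi (Y q w)).
  move=> mg mk g0 k0 gn kn.
  apply: (@rint_mul_ge0 (g \o U) (k \o psi)) => //.
  - exact: measurableT_comp.
  - exact: measurableT_comp.
  - by move=> w /=; exact: g0.
  - by move=> w /=; exact: k0.
  - exact: iUp.
  - exact: iVp.
have [i1 E1] := prod up up mup mup up0 up0 upn upn.
have [i2 E2] := prod up un mup mun up0 un0 upn unn.
have [i3 E3] := prod un up mun mup un0 up0 unn upn.
have [i4 E4] := prod un un mun mun un0 un0 unn unn.
have j1 := rintB measurableT i1 i2; have j2 := rintB measurableT i3 i4.
have UVE w : U w * psi (Y q w) =
    (up (U w) * up (psi (Y q w)) - up (U w) * un (psi (Y q w))) -
    (un (U w) * up (psi (Y q w)) - un (U w) * un (psi (Y q w))).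
  by rewrite {1}(upE (U w)) {1}(upE (psi _)); ring.
have UVf : (fun w => U w * psi (Y q w)) = (fun w =>
    (up (U w) * up (psi (Y q w)) - up (U w) * un (psi (Y q w))) -
    (un (U w) * up (psi (Y q w)) - un (U w) * un (psi (Y q w)))).
  by apply/funext => w; exact: UVE.
rewrite UVf; split; first exact: (rintB measurableT j1 j2).
rewrite (RintegralB measurableT j1 j2) (RintegralB measurableT i1 i2).
rewrite (RintegralB measurableT i3 i4) E1 E2 E3 E4.
have -> : \int[P]_w U w = \int[P]_w up (U w) - \int[P]_w un (U w).
  rewrite -RintegralB//; [|exact: iUp|exact: iUp].
  by apply: eq_Rintegral => w _; exact: upE.
have -> : \int[P]_w psi (Y q w) = \int[P]_w up (psi (Y q w)) - \int[P]_w un (psi (Y q w)).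
  rewrite -RintegralB//; [|exact: iVp|exact: iVp].
  by apply: eq_Rintegral => w _; exact: upE.
ring.
Qed.

End independence.

(** * The implicit Euler scheme *)

Section lipschitz_measurable.
Context d {T : measurableType d} {R : realType} {N : nat}.

Lemma measurable_sumr (J : Type) (r : seq J) (Q : pred J) (f : J -> T -> R) :
  (forall j, Q j -> measurable_fun setT (f j)) ->
  measurable_fun setT (fun w => \sum_(j <- r | Q j) f j w).
Proof.
move=> mf; elim: r => [|j r IH].
  have -> : (fun w => \sum_(j <- [::] | Q j) f j w) = cst 0.
    by apply/funext => w; rewrite big_nil.
  exact: measurable_cst.
have -> : (fun w => \sum_(i <- j :: r | Q i) f i w) =
    (fun w => (if Q j then f j w else 0) + \sum_(i <- r | Q i) f i w).
  by apply/funext => w; rewrite big_cons; case: ifP => // _; rewrite add0r.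
apply: measurable_funD => //; case: (boolP (Q j)) => [/mf//|_]; exact: measurable_cst.
Qed.

(* A C-Lipschitz g is the infimum over rational q of g q + C |. - q|. *)
Lemma lipschitz_measurable (g : 'rV[R]_N -> R) (C : R) (z : T -> 'rV[R]_N) :
  0 <= C -> (forall x y, `|g x - g y| <= C * nrm (x - y)) ->
  (forall i, measurable_fun setT (fun w => z w ord0 i)) ->
  measurable_fun setT (fun w => g (z w)).
Proof.
move=> C0 lip mz; apply: (measurability _ (RGenInftyO.measurableE R)) => _ [_ [c ->] <-].
rewrite setTI.
pose Q (q : 'rV[rat]_N) : 'rV[R]_N := map_mx ratr q.
pose Sq (q : 'rV[rat]_N) := [set w | C * \sum_i `|z w ord0 i - Q q ord0 i| < c - g (Q q)].
have -> : (fun w => g (z w)) @^-1` `]-oo, c[ = \bigcup_q Sq q.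
  apply/seteqP; split => w /=; rewrite in_itv/=.
    move=> gc; pose e := (c - g (z w)) / (2 * C * N%:R + 1).
    have D0 : 0 < 2 * C * N%:R + 1 by rewrite ltr_wpDl// !mulr_ge0.
    have e0 : 0 < e by rewrite divr_gt0// subr_gt0.
    have /choice[q qE] : forall i : 'I_N, exists q : rat, `|z w ord0 i - ratr q| <= e.
      move=> i; have /rat_in_itvoo[q] : z w ord0 i - e < z w ord0 i + e by lra.
      rewrite in_itv/= => /andP[q1 q2]; exists q.
      by rewrite ler_norml; apply/andP; split; lra.
    exists (\row_i q i) => //; rewrite /Sq/=.
    have le1 : \sum_i `|z w ord0 i - Q (\row_i q i) ord0 i| <= N%:R * e.
      apply: (@le_trans _ _ (\sum_(i < N) e)); last by rewrite sumr_const card_ord mulr_natl.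
      by apply: ler_sum => i _; rewrite !mxE.
    have le2 := ler_wpM2l C0 le1.
    have := lip (Q (\row_i q i)) (z w); rewrite ler_norml => /andP[_].
    rewrite nrmB.
    have h3 : C * nrm (z w - Q (\row_i q i)) <= C * (N%:R * e).
      rewrite ler_wpM2l// (le_trans (nrm_le_sum _))//.
      by apply: le_trans le1; apply: ler_sum => i _; rewrite !mxE.
    have h4 : 2 * (C * (N%:R * e)) < c - g (z w).
      rewrite (_ : 2 * _ = (2 * C * N%:R) * e); last by ring.
      rewrite /e mulrCA -[ltRHS]mulr1 ltr_pM2l ?subr_gt0//.
      by rewrite ltr_pdivrMr// mul1r ltrDl.
    lra.
  move=> [q _]; rewrite /Sq/= => h.
  have := lip (z w) (Q q); rewrite ler_norml => /andP[_].
  have : C * nrm (z w - Q q) <= C * \sum_i `|z w ord0 i - Q q ord0 i|.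
    rewrite ler_wpM2l// (le_trans (nrm_le_sum _))//.
    by apply: ler_sum => i _; rewrite !mxE.
  lra.
have mSq q : measurable (Sq q).
  have mh : measurable_fun setT (fun w => C * \sum_i `|z w ord0 i - Q q ord0 i|).
    apply: measurable_funM => //; apply: measurable_sumr => i _.
    apply: measurableT_comp => //; apply: measurable_funB => //.
  rewrite (_ : Sq q = setT `&` (fun w => C * \sum_i `|z w ord0 i - Q q ord0 i|) @^-1`
    `]-oo, c - g (Q q)[); first exact: mh.
  by rewrite setTI; apply/seteqP; split => w /=; rewrite in_itv.
have -> : \bigcup_q Sq q = \bigcup_n (if unpickle n is Some q then Sq q else set0).
  apply/seteqP; split => w.
    by move=> [q _ qw]; exists (pickle q) => //; rewrite pickleK.
  by move=> [n _]; case: (unpickle n) => // q qw; exists q.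
by apply: bigcupT_measurable => n; case: (unpickle n).
Qed.

End lipschitz_measurable.

Section scheme_pathwise.
Context {R : realType} {N : nat} {I : finType}.
Variables (al : I -> 'rV[R]_N) (kk : I -> R) (h : R) (J : 'rV[R]_N -> 'rV[R]_N).
Hypothesis kk_gt0 : forall p, 0 < kk p.
Hypothesis h_gt0 : 0 < h.
Hypothesis JW : forall z, chamber al (J z).
Hypothesis JE : forall z, J z = z + h *: rdrift al kk (J z).

(** Pair [z - z'] with [J z - J z']: the drift contributes with a favourable sign by dissipativity,
    and Cauchy-Schwarz concludes. The resulting Lipschitz bound is also what makes the scheme
    measurable. *)
Lemma resolvent_nonexpansive z z' : nrm (J z - J z') <= nrm (z - z').
Proof.
set y := J z; set y' := J z'.
have zE : z - z' = (y - y') - h *: (rdrift al kk y - rdrift al kk y').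
  by rewrite scalerBr {1}/y {1}/y' (JE z) (JE z') -/y -/y' opprB opprD !addrA;
    apply/rowP => i; rewrite !mxE; ring.
have le : dotv (y - y') (y - y') <= dotv (y - y') (z - z').
  rewrite zE [leRHS]dotvBr dotvZr lerBrDl gerDr.
  by rewrite pmulr_rle0//; apply: rdrift_dissipative => //; exact: JW.
have := le_trans le (dotv_le _ _); rewrite -sqr_nrm expr2.
have := nrm_ge0 (y - y'); rewrite le_eqVlt => /predU1P[<-|n0]; first by rewrite nrm_ge0.
by rewrite ler_pM2l.
Qed.

(** Expand the square of [z = y - h *: rdrift al kk y]: the cross term is [2 h \sum_p kk p] by
    [dot_rdrift_self], and the square of the drift is dropped. *)
Lemma resolvent_sqr_le z :
  dotv (J z) (J z) <= dotv z z + 2 * h * \sum_p kk p.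
Proof.
have Wy := JW z; have Ey := JE z; move: (J z) Wy Ey => y Wy Ey.
have -> : z = y - h *: rdrift al kk y by rewrite {1}Ey addrK.
rewrite !(dotvBl, dotvBr, dotvZl, dotvZr) (dotvC (rdrift al kk y) y).
rewrite dot_rdrift_self//.
have := mulr_ge0 (mulr_ge0 (ltW h_gt0) (ltW h_gt0)) (dotv_ge0 (rdrift al kk y)); lra.
Qed.

(** The noise is added before the resolvent, so every iterate of positive index lies in the open
    chamber even when [x] is on a wall. *)
Fixpoint scheme (x : 'rV[R]_N) (D : nat -> 'rV[R]_N) (n : nat) : 'rV[R]_N :=
  if n is m.+1 then J (scheme x D m + D m) else x.

Lemma scheme_ge0 x D n : (forall p, 0 <= dotv (al p) x) ->
  forall p, 0 <= dotv (al p) (scheme x D n).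
Proof. by move=> x0 p; case: n => [|n]/=; [exact: x0|rewrite ltW// JW]. Qed.

Lemma coord_resolvent_lip i z z' :
  `|J z ord0 i - J z' ord0 i| <= 1 * nrm (z - z').
Proof.
rewrite mul1r (le_trans _ (resolvent_nonexpansive z z'))//.
by have := coord_le_nrm (J z - J z') i; rewrite !mxE.
Qed.

End scheme_pathwise.

Lemma cube_sum_le {R : realType} (N : nat) (t : 'I_N -> R) : (forall i, 0 <= t i) ->
  (\sum_i t i) ^+ 3 <= N%:R ^+ 3 * \sum_i t i ^+ 3.
Proof.
move=> t0; case: N t t0 => [|N] t t0; first by rewrite !big_ord0 expr0n mulr0.
have [i0 _ tmax] := @Order.TotalTheory.arg_maxP _ _ 'I_N.+1 ord0 xpredT t isT.
apply: (@le_trans _ _ ((N.+1%:R * t i0) ^+ 3)).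
  rewrite lerXn2r ?nnegrE ?sumr_ge0 ?mulr_ge0//.
  apply: (@le_trans _ _ (\sum_(i < N.+1) t i0)); first by apply: ler_sum => i _; exact: tmax.
  by rewrite sumr_const card_ord mulr_natl.
rewrite exprMn ler_wpM2l ?exprn_ge0// (bigD1 i0)//= lerDl.
by apply: sumr_ge0 => i _; rewrite exprn_ge0.
Qed.

(* The mixed second-order terms of the generator applied to \sum_p f(<al p, y>),
   with g in the role of f'. *)
Definition positive_cross_terms {R : realType} {N : nat} {I : finType}
    (al : I -> 'rV[R]_N) (kk : I -> R) : Prop :=
  forall g : R -> R, (forall u, 0 < u -> 0 <= g u) ->
  (forall u w, 0 < u -> u <= w -> u * g u <= w * g w) ->
  forall y, chamber al y ->
  0 <= \sum_p \sum_(q | q != p)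
         kk q * dotv (al p) (al q) * g (dotv (al p) y) / dotv (al q) y.

(** The linear arithmetic that closes [occupation_step], with letters in place of the integrals. *)
Lemma occupation_arith {R : realFieldType} (A B X2 X3 X4 X5 X6 h2 hc C K : R) :
  h2 * B <= X2 -> C * X3 <= C * (K * X6) -> A + X2 - C * X3 + hc * X4 <= X5 ->
  A + h2 * B + hc * X4 - C * K * X6 <= X5.
Proof. by rewrite -mulrA; lra. Qed.

(** * Moments and expected occupation of the Euler scheme *)

Section scheme_probability.
Context d {T : measurableType d} {R : realType} (P : probability T R).
Context {N : nat} {I : finType}.
Variables (al : I -> 'rV[R]_N) (kk : I -> R) (h : R) (J : 'rV[R]_N -> 'rV[R]_N).
Hypothesis kk_gt0 : forall p, 0 < kk p.
Hypothesis h_gt0 : 0 < h.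
Hypothesis JW : forall z, chamber al (J z).
Hypothesis JE : forall z, J z = z + h *: rdrift al kk (J z).
Variables (x : 'rV[R]_N) (n : nat) (D : nat -> T -> 'rV[R]_N).
Hypothesis x_ge0 : forall p, 0 <= dotv (al p) x.
Hypothesis mD : forall j i, measurable_fun setT (fun w => D j w ord0 i).
Let inc (ij : 'I_N * 'I_n) (w : T) : R := D ij.2 w ord0 ij.1.
Hypothesis indD : mutually_independent P inc.
Hypothesis lawD : forall (i : 'I_N) (j : 'I_n) (A : set R), measurable A ->
  P ((fun w => D j w ord0 i) @^-1` A) = normal_prob 0 (Num.sqrt h) A.

Let Z (m : nat) (w : T) := scheme J x (D^~ w) m.

Let minc q : measurable_fun setT (inc q).
Proof. exact: mD. Qed.

Let s_gt0 : 0 < Num.sqrt h. Proof. by rewrite sqrtr_gt0. Qed.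

Let sqr_s : Num.sqrt h ^+ 2 = h. Proof. by rewrite sqr_sqrtr// ltW. Qed.

(** For each coordinate [i], [U] is a function of all increments other than the one indexed by
    [(i, j)]. Later increments and the other coordinates of step [j] are allowed; no filtration is
    involved. *)
Definition adapted_at (j : 'I_n) (U : T -> R) : Prop := forall i : 'I_N,
  measurable_fun setT (U : g_sigma_algebraType (others inc (i, j)) -> R).

Lemma adapted_scale (j : 'I_n) c U : adapted_at j U -> adapted_at j (fun w => c * U w).
Proof. by move=> aU i; apply: measurable_funM; [exact: measurable_cst|exact: aU]. Qed.

Lemma scheme_adapted (j : 'I_n) m l : (m <= j)%N ->
  adapted_at j (fun w => Z m w ord0 l).
Proof.
move=> mj i; elim: m mj l => [|m IH] mj l; first exact: measurable_cst.
apply: (@lipschitz_measurable _ (g_sigma_algebraType (others inc (i, j))) R N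
  (fun z => J z ord0 l) 1 (fun w => Z m w + D m w)) => //.
  by move=> z z'; exact: (coord_resolvent_lip kk_gt0 h_gt0 JW JE).
move=> i'; have mn : (m < n)%N := leq_trans mj (ltnW (ltn_ord j)).
rewrite (_ : (fun w => _) = (fun w => Z m w ord0 i' + inc (i', Ordinal mn) w)); last first.
  by apply/funext => w; rewrite mxE.
apply: measurable_funD; first exact: (IH (ltnW mj)).
have pq : (i', Ordinal mn) != (i, j).
  by apply/eqP => -[_ /(congr1 (@nat_of_ord n))/= E]; move: mj; rewrite E ltnn.
exact: (measurable_coord_others pq).
Qed.

Lemma scheme_measurable m l : measurable_fun setT (fun w => Z m w ord0 l).
Proof.
elim: m l => [|m IH] l; first exact: measurable_cst.
apply: (@lipschitz_measurable _ T R N (fun z => J z ord0 l) 1 (fun w => Z m w + D m w)) => //.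
  by move=> z z'; exact: (coord_resolvent_lip kk_gt0 h_gt0 JW JE).
move=> i; rewrite (_ : (fun w => _) = (fun w => Z m w ord0 i + D m w ord0 i)); last first.
  by apply/funext => w; rewrite mxE.
exact: measurable_funD.
Qed.

Lemma dotv_scheme_measurable m v : measurable_fun setT (fun w => dotv v (Z m w)).
Proof.
apply: measurable_sumr => i _; apply: measurable_funM => //; exact: scheme_measurable.
Qed.

Lemma dotv_scheme_adapted (j : 'I_n) v : adapted_at j (fun w => dotv v (Z j w)).
Proof.
move=> i; apply: (@measurable_sumr _ (g_sigma_algebraType (others inc (i, j)))) => l _.
by apply: measurable_funM => //; exact: scheme_adapted.
Qed.

Section increment_moments.
Variable j : 'I_n.
Notation Dj i := (fun w => D j w ord0 i).

Lemma increment_integrable i : rint P setT (Dj i).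
Proof. exact: (integrable_normal s_gt0 (mD j i) (lawD i j)). Qed.

Lemma increment_sqr_integrable i : rint P setT (fun w => D j w ord0 i ^+ 2).
Proof. exact: (integrable_normal_sqr s_gt0 (mD j i) (lawD i j)). Qed.

Lemma increment_second_moment i : \int[P]_w (D j w ord0 i ^+ 2) <= h.
Proof. by rewrite -[leRHS]sqr_s; exact: (normal_second_moment s_gt0 (mD j i) (lawD i j)). Qed.

Lemma adapted_mul_mean U i : adapted_at j U -> rint P setT U ->
  rint P setT (fun w => U w * D j w ord0 i) /\
  \int[P]_w (U w * D j w ord0 i) = 0.
Proof.
move=> aU iU.
have [i1 ->] := @indep_mul _ T R P _ inc (i, j) minc indD U id (aU i)
  (@measurable_id _ _ _) iU (increment_integrable i).
split; first exact: i1.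
by rewrite (normal_mean s_gt0 (mD j i) (lawD i j)) mulr0.
Qed.

Lemma adapted_mul_sqr U i : adapted_at j U -> rint P setT U ->
  rint P setT (fun w => U w * D j w ord0 i ^+ 2) /\
  \int[P]_w (U w * D j w ord0 i ^+ 2) =
    (\int[P]_w U w) * \int[P]_w (D j w ord0 i ^+ 2).
Proof.
move=> aU iU.
apply: (@indep_mul _ T R P _ inc (i, j) minc indD U (fun y => y ^+ 2)) => //.
exact: increment_sqr_integrable.
Qed.

(** The product [U * D j i] is still measurable with respect to the increments other than [(l, j)],
    so the centred factor [D j l] can be split off. *)
Lemma adapted_mul_cross U i l : i != l -> adapted_at j U -> rint P setT U ->
  rint P setT (fun w => U w * D j w ord0 i * D j w ord0 l) /\
  \int[P]_w (U w * D j w ord0 i * D j w ord0 l) = 0.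
Proof.
move=> il aU iU; have [i1 _] := adapted_mul_mean i aU iU.
have mU : measurable_fun setT (fun w : g_sigma_algebraType (others inc (l, j)) =>
    U w * D j w ord0 i).
  apply: measurable_funM; first exact: aU.
  have pq : (i, j) != (l, j) by apply: contra_neq il => -[].
  exact: (measurable_coord_others pq).
have [i2 ->] := @indep_mul _ T R P _ inc (l, j) minc indD _ id mU
  (@measurable_id _ _ _) i1 (increment_integrable l).
split; first exact: i2.
by rewrite (normal_mean s_gt0 (mD j l) (lawD l j)) mulr0.
Qed.

Lemma adapted_mul_dotv U v : adapted_at j U -> rint P setT U ->
  rint P setT (fun w => U w * dotv v (D j w)) /\
  \int[P]_w (U w * dotv v (D j w)) = 0.
Proof.
move=> aU iU.
have -> : (fun w => U w * dotv v (D j w)) =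
    (fun w => \sum_i v ord0 i * (U w * D j w ord0 i)).
  by apply/funext => w; rewrite mulr_sumr; apply: eq_bigr => i _; ring.
have h1 i : rint P setT (fun w => v ord0 i * (U w * D j w ord0 i)).
  by apply: rintZl => //; exact: (adapted_mul_mean i aU iU).1.
split; first exact: rint_sum.
rewrite Rint_sum// big1// => i _.
have [i1 E1] := adapted_mul_mean i aU iU.
by rewrite RintegralZl// E1 mulr0.
Qed.

Lemma adapted_mul_dotv_sqr U v : adapted_at j U -> rint P setT U ->
  rint P setT (fun w => U w * dotv v (D j w) ^+ 2) /\
  \int[P]_w (U w * dotv v (D j w) ^+ 2) =
    \sum_i v ord0 i ^+ 2 * ((\int[P]_w U w) * \int[P]_w (D j w ord0 i ^+ 2)).
Proof.
move=> aU iU.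
have -> : (fun w => U w * dotv v (D j w) ^+ 2) =
    (fun w => \sum_i \sum_l (v ord0 i * v ord0 l) * (U w * D j w ord0 i * D j w ord0 l)).
  apply/funext => w; rewrite expr2 {1}/dotv mulr_suml mulr_sumr; apply: eq_bigr => i _.
  by rewrite /dotv !mulr_sumr; apply: eq_bigr => l _; ring.
have h1 i l : rint P setT (fun w => U w * D j w ord0 i * D j w ord0 l).
  have [<-|il] := eqVneq i l; last exact: (adapted_mul_cross il aU iU).1.
  have [i1 _] := adapted_mul_sqr i aU iU.
  by under [X in rint _ _ X]eq_fun do rewrite -mulrA -expr2.
have h2 i l : rint P setT (fun w => (v ord0 i * v ord0 l) * (U w * D j w ord0 i * D j w ord0 l)).
  by apply: rintZl => //; exact: h1.
have h3 i : rint P setT (fun w => \sum_l (v ord0 i * v ord0 l) * (U w * D j w ord0 i * D j w ord0 l)).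
  exact: rint_sum.
split; first exact: rint_sum.
rewrite Rint_sum//; apply: eq_bigr => i _; rewrite Rint_sum// (bigD1 i)//= big1 => [|l li].
  have [_ E] := adapted_mul_sqr i aU iU.
  rewrite addr0 expr2 (@RintegralZl _ T R P setT
    (fun w => U w * D j w ord0 i * D j w ord0 i) (v ord0 i * v ord0 i) measurableT (h1 i i)).
  congr (_ * _); apply: etrans E.
  by apply: eq_Rintegral => w _; rewrite -mulrA -expr2.
rewrite (@RintegralZl _ T R P setT
  (fun w => U w * D j w ord0 i * D j w ord0 l) (v ord0 i * v ord0 l) measurableT (h1 i l)).
by rewrite eq_sym in li; have [_ ->] := adapted_mul_cross li aU iU; rewrite mulr0.
Qed.

(** Of the power [N^4], three factors come from [cube_sum_le] and one from summing the third moments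
    of the [N] coordinates. *)
Lemma increment_cube v : rint P setT (fun w => `|dotv v (D j w)| ^+ 3) /\
  \int[P]_w (`|dotv v (D j w)| ^+ 3) <=
    nrm v ^+ 3 * N%:R ^+ 4 * (12 * expR (2^-1)) * (h * Num.sqrt h).
Proof.
have i3 i : rint P setT (fun w => `|D j w ord0 i| ^+ 3).
  exact: (integrable_normal_cube s_gt0 (mD j i) (lawD i j)).
have is3 : rint P setT (fun w => nrm v ^+ 3 * N%:R ^+ 3 * \sum_i `|D j w ord0 i| ^+ 3).
  by apply: rintZl => //; apply: rint_sum.
have le w : `|dotv v (D j w)| ^+ 3 <= nrm v ^+ 3 * N%:R ^+ 3 * \sum_i `|D j w ord0 i| ^+ 3.
  rewrite -mulrA (le_trans _ (ler_wpM2l _ (cube_sum_le _)))//; last first.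
    by rewrite exprn_ge0// nrm_ge0.
  rewrite -exprMn lerXn2r ?nnegrE ?mulr_ge0 ?nrm_ge0 ?sumr_ge0//.
  by rewrite (le_trans (dotv_le_nrm _ _))// ler_wpM2l ?nrm_ge0// nrm_le_sum.
have mv : measurable_fun setT (fun w => `|dotv v (D j w)| ^+ 3).
  apply: measurable_funX; apply: measurableT_comp => //.
  by apply: measurable_sumr => i _; apply: measurable_funM.
have iv : rint P setT (fun w => `|dotv v (D j w)| ^+ 3).
  by apply: (rint_le measurableT mv is3) => w _; rewrite ger0_norm ?exprn_ge0.
split => //; apply: (le_trans (le_Rintegral measurableT iv is3 (fun w _ => le w))).
rewrite RintegralZl//; last exact: rint_sum.
rewrite Rint_sum// (_ : nrm v ^+ 3 * N%:R ^+ 4 * _ * _ =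
  nrm v ^+ 3 * N%:R ^+ 3 * (N%:R * (12 * expR (2^-1) * (h * Num.sqrt h)))); last by ring.
rewrite ler_wpM2l ?mulr_ge0 ?exprn_ge0 ?nrm_ge0//.
apply: (@le_trans _ _ (\sum_(i < N) 12 * expR 2^-1 * (h * Num.sqrt h))).
  apply: ler_sum => i _; rewrite -{1}sqr_s -exprSr.
  exact: (normal_third_moment s_gt0 (mD j i) (lawD i j)).
by rewrite sumr_const card_ord -[leLHS]mulr_natl.
Qed.

End increment_moments.

(** By [resolvent_sqr_le] a step adds the squared increment, of mean at most [N h], the constant
    [2 h \sum_p kk p], and a cross term of mean zero. *)
Lemma scheme_second_moment m : (m <= n)%N ->
  rint P setT (fun w => dotv (Z m w) (Z m w)) /\
  \int[P]_w dotv (Z m w) (Z m w) <=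
    dotv x x + m%:R * h * (N%:R + 2 * \sum_p kk p).
Proof.
elim: m => [_|m IH mn].
  split; first exact: (rint_cst P (dotv x x)).
  by rewrite [leLHS](Rint_cst P (dotv x x)) !mul0r addr0.
have {IH} [iZ EZ] := IH (ltnW mn); pose j := Ordinal mn.
have aZ i : adapted_at j (fun w => Z m w ord0 i) by exact: scheme_adapted.
have iZi i : rint P setT (fun w => Z m w ord0 i).
  apply: (rint_le measurableT (scheme_measurable m i) (rintD measurableT (rint_cst P 1) iZ)).
  move=> w _; have := coord_le_nrm (Z m w) i; have := sqr_nrm (Z m w).
  have := nrm_ge0 (Z m w); nra.
have c1 i := adapted_mul_mean i (aZ i) (iZi i).
have c2 i := increment_sqr_integrable j i.
pose G w := dotv (Z m w) (Z m w) + 2 * (\sum_i Z m w ord0 i * D m w ord0 i)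
  + \sum_i D m w ord0 i ^+ 2 + 2 * h * \sum_p kk p.
have i1 : rint P setT (fun w => \sum_i Z m w ord0 i * D m w ord0 i).
  by apply: rint_sum => // i _; exact: (c1 i).1.
have i2 : rint P setT (fun w => \sum_i D m w ord0 i ^+ 2).
  by apply: rint_sum => // i _; exact: c2.
have i12 := rintD measurableT iZ (rintZl measurableT 2 i1).
have i123 := rintD measurableT i12 i2.
have iG : rint P setT G := rintD measurableT i123 (rint_cst P _).
have le w : dotv (Z m.+1 w) (Z m.+1 w) <= G w.
  rewrite /Z/= -/(Z m w) (le_trans (resolvent_sqr_le h_gt0 JW JE _))//.
  rewrite /G lerD2r dotvDl !dotvDr (dotvC (D m w)).
  have -> : dotv (D m w) (D m w) = \sum_i D m w ord0 i ^+ 2.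
    by apply: eq_bigr => i _; rewrite expr2.
  by rewrite -/(dotv (Z m w) (D m w)); lra.
have iZ' : rint P setT (fun w => dotv (Z m.+1 w) (Z m.+1 w)).
  apply: (rint_le measurableT _ iG); last first.
    by move=> w _; rewrite ger0_norm ?dotv_ge0.
  by apply: measurable_sumr => i _; apply: measurable_funM; exact: scheme_measurable.
split=> //; apply: (le_trans (le_Rintegral measurableT iZ' iG (fun w _ => le w))).
rewrite (RintegralD measurableT i123 (rint_cst P _)) Rint_cst.
rewrite (RintegralD measurableT i12 i2) (RintegralD measurableT iZ (rintZl measurableT 2 i1)).
have E1 : \int[P]_w (\sum_i Z m w ord0 i * D m w ord0 i) = 0.
  rewrite Rint_sum//; last by move=> i _; exact: (c1 i).1.
  by rewrite big1// => i _; exact: (c1 i).2.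
rewrite (RintegralZl _ measurableT i1) E1 mulr0 addr0.
have -> : \int[P]_w (\sum_i D m w ord0 i ^+ 2) = \sum_i \int[P]_w (D m w ord0 i ^+ 2).
  by rewrite Rint_sum.
have : \sum_i \int[P]_w (D m w ord0 i ^+ 2) <= N%:R * h.
  apply: (@le_trans _ _ (\sum_(i < N) h)).
    by apply: ler_sum => i _; exact: (increment_second_moment j).
  by rewrite sumr_const card_ord mulr_natl.
by rewrite -natr1; move: EZ; nra.
Qed.

Section occupation.
Variables (a k' e C : R).
Hypotheses (a_gt0 : 0 < a) (a_lt1 : a < 1) (e_gt0 : 0 < e) (e_le1 : e <= 1).
Hypotheses (ak' : (1 - a) / 2 < k') (k'_le : forall p, k' <= kk p).
Hypothesis al_ge1 : forall p, 1 <= dotv (al p) (al p).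
Hypothesis cross : positive_cross_terms al kk.
Hypothesis C_ge0 : 0 <= C.
Hypothesis taylor : forall u v, 0 <= u ->
  prof a e u + prof1 a e u * v + prof2 a e u / 2 * v ^+ 2 - C * `|v| ^+ 3
  <= prof a e (u + v).

(** On the closed chamber [F] is the test function, [L] is its Laplacian (each root enters through
    its square length), and [V] is the potential whose occupation is estimated. *)
Let F (y : 'rV[R]_N) := \sum_p (dotv (al p) y + e) `^ a.
Let L (y : 'rV[R]_N) := \sum_p dotv (al p) (al p) * prof2 a e (dotv (al p) y).
Let V (y : 'rV[R]_N) := \sum_p (dotv (al p) y + e) `^ (a - 2).
Let c0 := a * (k' - (1 - a) / 2).

Let c0_gt0 : 0 < c0. Proof. by rewrite mulr_gt0 ?subr_gt0. Qed.

(** In the drift term the pairs of distinct roots contribute nonnegatively by [cross], which leaves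
    one Bessel generator per root. Each is nonnegative by [prof_generator], so the factor
    [dotv (al p) (al p) >= 1] may be dropped. *)
Lemma generator_ge y : chamber al y ->
  c0 * V y <= L y / 2 + \sum_p prof1 a e (dotv (al p) y) * dotv (al p) (rdrift al kk y).
Proof.
move=> Wy.
pose G p := dotv (al p) (al p) * (kk p * prof1 a e (dotv (al p) y) / dotv (al p) y).
have : \sum_p G p <= \sum_p prof1 a e (dotv (al p) y) * dotv (al p) (rdrift al kk y).
  have := @cross (prof1 a e) (fun u _ => prof1_ge0 e a_gt0 u) _ y Wy.
  have mono u w : 0 < u -> u <= w -> u * prof1 a e u <= w * prof1 a e w.
    by move=> u0 uw; apply: mul_prof1_nondecreasing => //; exact: ltW.
  move=> /(_ mono) h1.
  rewrite -subr_ge0 -sumrB; apply: le_trans h1 _.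
  rewrite le_eqVlt; apply/orP; left; apply/eqP; apply: eq_bigr => p _.
  have E0 : prof1 a e (dotv (al p) y) * (kk p * dotv (al p) (al p) / dotv (al p) y) = G p.
    by rewrite /G; ring.
  rewrite dot_rdrift [in RHS](bigD1 p)//= mulrDr E0 [X in _ = X - _]addrC addrK.
  by rewrite mulr_sumr; apply: eq_bigr => q _; rewrite (dotvC (al q) (al p)); ring.
move=> le; apply: le_trans (lerD (lexx (L y / 2)) le).
rewrite /L /V mulr_suml -big_split mulr_sumr; apply: ler_sum => p _ /=.
rewrite /G -mulrA -mulrDr.
have kp : 0 <= kk p by exact: ltW.
have := prof_generator a_gt0 a_lt1 e_gt0 (Wy p) kp.
set X := (_ `^ _); set Q := _ / 2 + _ => h1.
have X0 : 0 <= X by exact: powR_ge0.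
have h2 : c0 * X <= Q.
  apply: le_trans h1; rewrite ler_wpM2r// ler_wpM2l ?(ltW a_gt0)//.
  by rewrite lerD2r.
have Q0 : 0 <= Q by apply: le_trans h2; rewrite mulr_ge0// ltW.
by rewrite (le_trans h2)// ler_peMl.
Qed.

Lemma profE u : 0 <= u -> prof a e u = (u + e) `^ a.
Proof. by rewrite /prof => ->. Qed.

(** A step is treated in two halves: a Taylor expansion at the old point [y] along the noise, and a
    supporting line at the new point [z] along the drift. The point [y + D'] in between may leave
    the chamber, which is why the profile lives on the whole line. Second derivatives then appear at
    [y], whereas the generator bound at [z] needs [L z / 2]; hence the telescoping quantity is
    [F + h / 2 * L] rather than [F]. *)
Lemma occupation_step_pathwise y D' : (forall p, 0 <= dotv (al p) y) ->
  F y + \sum_p prof1 a e (dotv (al p) y) * dotv (al p) D'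
      + \sum_p prof2 a e (dotv (al p) y) / 2 * dotv (al p) D' ^+ 2
      - C * \sum_p `|dotv (al p) D'| ^+ 3 + h * c0 * V (J (y + D'))
  <= F (J (y + D')) + h / 2 * L (J (y + D')).
Proof.
move=> y0; set z := J (y + D').
have Wz : chamber al z by exact: JW.
have h1 : F y + \sum_p prof1 a e (dotv (al p) y) * dotv (al p) D'
      + \sum_p prof2 a e (dotv (al p) y) / 2 * dotv (al p) D' ^+ 2
      - C * \sum_p `|dotv (al p) D'| ^+ 3 <= \sum_p prof a e (dotv (al p) (y + D')).
  rewrite /F mulr_sumr -!big_split -sumrB; apply: ler_sum => p _ /=.
  by rewrite dotvDr -profE//; exact: taylor.
have h2 : \sum_p prof a e (dotv (al p) (y + D')) +
    h * \sum_p prof1 a e (dotv (al p) z) * dotv (al p) (rdrift al kk z) <= F z.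
  rewrite /F mulr_sumr -big_split; apply: ler_sum => p _ /=.
  have := prof_concave a_gt0 a_lt1 e_gt0 (dotv (al p) (y + D')) (ltW (Wz p)).
  rewrite -profE ?(ltW (Wz p))//.
  have -> : dotv (al p) (y + D') = dotv (al p) z - h * dotv (al p) (rdrift al kk z).
    by rewrite -dotvZr -dotvBr {1}/z JE -/z addrK.
  lra.
have := generator_ge Wz => /(ler_wpM2l (ltW h_gt0)); rewrite mulrDr; lra.
Qed.

Let u_ge0 m p w : 0 <= dotv (al p) (Z m w).
Proof. exact: scheme_ge0. Qed.

Let mpw (c : R) m p : measurable_fun setT (fun w => (dotv (al p) (Z m w) + e) `^ c).
Proof.
have mu : measurable_fun setT (fun w => dotv (al p) (Z m w) + e).
  by apply: measurable_funD => //; exact: dotv_scheme_measurable.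
exact: (measurableT_comp (measurable_powR c) mu).
Qed.

Let apw (c : R) (j : 'I_n) p : adapted_at j (fun w => (dotv (al p) (Z j w) + e) `^ c).
Proof.
move=> i; have mu : measurable_fun setT
    (fun w : g_sigma_algebraType (others inc (i, j)) => dotv (al p) (Z j w) + e).
  by apply: measurable_funD => //; exact: dotv_scheme_adapted.
exact: (measurableT_comp (measurable_powR c) mu).
Qed.

Let neg_bound (c : R) m p w : c <= 0 -> (dotv (al p) (Z m w) + e) `^ c <= e `^ c.
Proof. by move=> c0'; apply: powR_neg_le => //; rewrite lerDr. Qed.

Let ipw_neg (c : R) m p : c <= 0 ->
  rint P setT (fun w => (dotv (al p) (Z m w) + e) `^ c).
Proof.
move=> c0'; apply: (rint_le measurableT (mpw c m p) (rint_cst P (e `^ c))) => w _.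
by rewrite ger0_norm ?powR_ge0// neg_bound.
Qed.

Let F_ge0 y : 0 <= F y. Proof. by apply: sumr_ge0 => p _; exact: powR_ge0. Qed.

Let F_le m w : F (Z m w) <= \sum_p (2 + nrm (al p)) * (1 + dotv (Z m w) (Z m w)).
Proof.
apply: ler_sum => p _.
have := prof_le a_gt0 a_lt1 e_gt0 e_le1 (u_ge0 m p w); rewrite profE// => /le_trans; apply.
have := dotv_le (al p) (Z m w); have := sqr_nrm (Z m w).
have := nrm_ge0 (al p); have := nrm_ge0 (Z m w); have := dotv_ge0 (Z m w).
move: (nrm (al p)) (nrm (Z m w)) (dotv (al p) (Z m w)) (dotv (Z m w) (Z m w)).
move=> A B U W W0 B0 A0 BW UAB.
have : A * B <= A * (1 + W) by rewrite ler_wpM2l// -BW; nra.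
by rewrite mulrDl; lra.
Qed.

Let iF m : (m <= n)%N -> rint P setT (fun w => F (Z m w)).
Proof.
move=> mn; have [i1 _] := scheme_second_moment mn.
have i2 : rint P setT (fun w => \sum_p (2 + nrm (al p)) * (1 + dotv (Z m w) (Z m w))).
  apply: rint_sum => // p _; apply: rintZl => //; apply: rintD => //; exact: rint_cst.
apply: (rint_le measurableT _ i2); last by move=> w _; rewrite ger0_norm.
by apply: measurable_sumr => p _; exact: mpw.
Qed.

Let am2 : a - 2 <= 0. Proof. by move: a_lt1; lra. Qed.
Let am1 : a - 1 <= 0. Proof. by move: a_lt1; lra. Qed.

Let i2 m p : rint P setT (fun w => prof2 a e (dotv (al p) (Z m w))).
Proof. by apply: rintZl => //; exact: ipw_neg. Qed.

Let iL m : rint P setT (fun w => L (Z m w)).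
Proof. by apply: rint_sum => // p _; apply: rintZl. Qed.

Lemma occupation_integrable m : rint P setT (fun w => V (Z m w)).
Proof. by apply: rint_sum => // p _; exact: ipw_neg. Qed.

Let iPsi m : (m <= n)%N -> rint P setT (fun w => F (Z m w) + h / 2 * L (Z m w)).
Proof. by move=> mn; apply: rintD => //; [exact: iF|exact: rintZl]. Qed.

Let K3 := \sum_p nrm (al p) ^+ 3 * N%:R ^+ 4 * (12 * expR (2^-1)).

Lemma occupation_step m : (m < n)%N ->
  \int[P]_w (F (Z m w) + h / 2 * L (Z m w)) + h * c0 * \int[P]_w V (Z m.+1 w)
    - C * K3 * (h * Num.sqrt h)
  <= \int[P]_w (F (Z m.+1 w) + h / 2 * L (Z m.+1 w)).
Proof.
move=> mn; pose j := Ordinal mn.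
have a1 p : adapted_at j (fun w => prof1 a e (dotv (al p) (Z m w))).
  exact: (adapted_scale a (@apw (a - 1) j p)).
have a2 p : adapted_at j (fun w => prof2 a e (dotv (al p) (Z m w)) / 2).
  have := adapted_scale 2^-1 (adapted_scale (a * (a - 1)) (@apw (a - 2) j p)).
  by under [X in adapted_at _ X]eq_fun do rewrite mulrC.
have i1 p : rint P setT (fun w => prof1 a e (dotv (al p) (Z m w))).
  by apply: rintZl => //; exact: ipw_neg.
have i2' p : rint P setT (fun w => prof2 a e (dotv (al p) (Z m w)) / 2).
  by under [X in rint _ _ X]eq_fun do rewrite mulrC; apply: rintZl.
have j1 p := adapted_mul_dotv (al p) (a1 p) (i1 p).
have j2 p := adapted_mul_dotv_sqr (al p) (a2 p) (i2' p).
have j3 p := increment_cube j (al p).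
pose S1 w := \sum_p prof1 a e (dotv (al p) (Z m w)) * dotv (al p) (D m w).
pose S2 w := \sum_p prof2 a e (dotv (al p) (Z m w)) / 2 * dotv (al p) (D m w) ^+ 2.
pose S3 w := \sum_p `|dotv (al p) (D m w)| ^+ 3.
have iS1 : rint P setT S1 by apply: rint_sum => // p _; exact: (j1 p).1.
have iS2 : rint P setT S2 by apply: rint_sum => // p _; exact: (j2 p).1.
have iS3 : rint P setT S3 by apply: rint_sum => // p _; exact: (j3 p).1.
have ES1 : \int[P]_w S1 w = 0.
  rewrite /S1 Rint_sum//; last by move=> p _; exact: (j1 p).1.
  by rewrite big1// => p _; exact: (j1 p).2.
(* The means of [prof2] are nonpositive, so the upper bound [h] on the second moments of the
   increments gives a lower bound here. *)
have ES2 : h / 2 * \int[P]_w L (Z m w) <= \int[P]_w S2 w.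
  rewrite [leRHS](Rint_sum measurableT _ (fun p _ => (j2 p).1)).
  have iLp p : rint P setT (fun w => dotv (al p) (al p) * prof2 a e (dotv (al p) (Z m w))).
    exact: rintZl.
  rewrite (Rint_sum measurableT _ (fun p _ => iLp p)).
  rewrite mulr_sumr; apply: ler_sum => p _; rewrite (j2 p).2 (RintegralZl _ measurableT (i2 m p)).
  have -> : \int[P]_w (prof2 a e (dotv (al p) (Z m w)) / 2) =
      2^-1 * \int[P]_w prof2 a e (dotv (al p) (Z m w)).
    rewrite -(RintegralZl _ measurableT (i2 m p)).
    by apply: eq_Rintegral => w _; rewrite mulrC.
  set Q := \int[P]_w prof2 _ _ _.
  have Q0 : Q <= 0.
    rewrite -oppr_ge0 /Q -[leRHS]mulN1r -(RintegralZl _ measurableT (i2 m p)).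
    apply: Rintegral_ge0 => w _.
    by rewrite mulN1r oppr_ge0 prof2_le0.
  rewrite {1}/dotv mulr_suml mulr_sumr; apply: ler_sum => i _.
  rewrite -expr2 (_ : h / 2 * (al p ord0 i ^+ 2 * Q) = al p ord0 i ^+ 2 * (2^-1 * Q * h)); last by ring.
  rewrite ler_wpM2l ?sqr_ge0// ler_wnM2l ?pmulr_rle0//.
  exact: (increment_second_moment j).
have ES3 : \int[P]_w S3 w <= K3 * (h * Num.sqrt h).
  rewrite /S3 Rint_sum//; last by move=> p _; exact: (j3 p).1.
  by rewrite /K3 mulr_suml; apply: ler_sum => p _; exact: (j3 p).2.
have q1 := rintD measurableT (iF (ltnW mn)) iS1.
have q2 := rintD measurableT q1 iS2.
have q3 := rintB measurableT q2 (rintZl measurableT C iS3).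
have q4 := rintD measurableT q3 (rintZl measurableT (h * c0) (occupation_integrable m.+1)).
have := le_Rintegral measurableT q4 (iPsi mn)
  (fun w _ => occupation_step_pathwise (D m w) (fun p => u_ge0 m p w)).
rewrite (RintegralD measurableT q3 (rintZl measurableT (h * c0) (occupation_integrable m.+1))).
rewrite (RintegralB measurableT q2 (rintZl measurableT C iS3)).
rewrite (RintegralD measurableT q1 iS2) (RintegralD measurableT (iF (ltnW mn)) iS1).
rewrite (RintegralZl _ measurableT iS3) (RintegralZl _ measurableT (occupation_integrable m.+1)) ES1 addr0.
rewrite (RintegralD measurableT (iF (ltnW mn)) (rintZl measurableT (h / 2) (iL m))).
rewrite (RintegralZl _ measurableT (iL m)).
by move=> E1; apply: (occupation_arith ES2 (ler_wpM2l C_ge0 ES3) E1).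
Qed.

Lemma occupation_sum m : (m <= n)%N ->
  \int[P]_w (F (Z 0 w) + h / 2 * L (Z 0 w))
    + h * c0 * \sum_(i < m) \int[P]_w V (Z i.+1 w)
    - C * K3 * (h * Num.sqrt h) * m%:R
  <= \int[P]_w (F (Z m w) + h / 2 * L (Z m w)).
Proof.
elim: m => [_|m IH mn]; first by rewrite big_ord0 !mulr0 addr0 subr0.
have := IH (ltnW mn); have := occupation_step mn.
rewrite big_ord_recr /= -[m.+1%:R]natr1 !mulrDr mulr1.
move: (\int[P]_w _) (\int[P]_w _) (\int[P]_w _) (\int[P]_w _) (\sum_(i < m) _) => A1 A2 A3 A4 A5.
move: (h * c0) (C * K3 * _) => X Y E1 E2; apply: le_trans E1.
by rewrite -subr_ge0; rewrite -subr_ge0 in E2; apply: le_trans E2 _; rewrite le_eqVlt; apply/orP; left; apply/eqP; ring.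
Qed.

(** The three terms bound the final value of [F], the initial value of [- h / 2 * L], and the Taylor
    remainders. Only the last two depend on [e], explicitly or through [C], and they vanish as [h]
    tends to 0 with [n * h] fixed. *)
Lemma occupation_bound :
  h * c0 * \sum_(i < n) \int[P]_w V (Z i.+1 w) <=
    (\sum_p (2 + nrm (al p))) * (1 + dotv x x + n%:R * h * (N%:R + 2 * \sum_p kk p))
    + h / 2 * (\sum_p dotv (al p) (al p)) * (a * (1 - a) * e `^ (a - 2))
    + C * K3 * (n%:R * h * Num.sqrt h).
Proof.
have := occupation_sum (leqnn n).
have -> : \int[P]_w (F (Z 0 w) + h / 2 * L (Z 0 w)) = F x + h / 2 * L x.
  exact: (Rint_cst P (F x + h / 2 * L x)).
have L0 y : L y <= 0.
  by apply: sumr_le0 => p _; rewrite mulr_ge0_le0 ?dotv_ge0// prof2_le0.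
have : \int[P]_w (F (Z n w) + h / 2 * L (Z n w)) <=
    (\sum_p (2 + nrm (al p))) * (1 + dotv x x + n%:R * h * (N%:R + 2 * \sum_p kk p)).
  have [s1 s2] := scheme_second_moment (leqnn n).
  have is1 := rintD measurableT (rint_cst P 1) s1.
  apply: (@le_trans _ _ (\int[P]_w ((\sum_p (2 + nrm (al p))) * (1 + dotv (Z n w) (Z n w))))).
    apply: le_Rintegral => //; [exact: iPsi|exact: rintZl|move=> w _].
    rewrite mulr_suml; apply: le_trans (F_le n w).
    by rewrite gerDl pmulr_rle0// divr_gt0.
  rewrite (RintegralZl _ measurableT is1) ler_wpM2l//.
    by apply: sumr_ge0 => p _; rewrite addr_ge0// nrm_ge0.
  by rewrite (RintegralD measurableT (rint_cst P 1) s1) Rint_cst -addrA lerD2l.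
have : - (h / 2 * L x) <= h / 2 * (\sum_p dotv (al p) (al p)) * (a * (1 - a) * e `^ (a - 2)).
  rewrite -mulrN -mulrA ler_pM2l ?divr_gt0// /L -sumrN mulr_suml; apply: ler_sum => p _.
  rewrite -mulrN ler_wpM2l ?dotv_ge0// lerNl.
  have := prof2_ge a_gt0 a_lt1 e_gt0 (x_ge0 p); rewrite {1}/prof2 add0r; lra.
have := F_ge0 x; rewrite -/(Z n _).
have -> : C * K3 * (h * Num.sqrt h) * n%:R = C * K3 * (n%:R * h * Num.sqrt h) by ring.
lra.
Qed.

End occupation.

End scheme_probability.

(** * Brownian paths *)

Section almost_sure_tools.
Context d {T : measurableType d} {R : realType} (P : probability T R).

Lemma markov_ge (X : T -> R) (c : R) : measurable_fun setT X ->
  (forall w, 0 <= X w) -> 0 <= c ->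
  (c%:E * P [set w | c <= X w]%R <= \int[P]_w (X w)%:E)%E.
Proof.
move=> mX X0 c0.
have mA : measurable [set w | c <= X w].
  rewrite (_ : [set w | _] = setT `&` X @^-1` `[c, +oo[); first exact: mX.
  by rewrite setTI; apply/seteqP; split => w /=; rewrite in_itv/= andbT.
rewrite -integral_cst// integral_mkcond; apply: ge0_le_integral => //.
- by move=> w _; rewrite patchE; case: ifP => //; rewrite lee_fin.
- exact/(measurable_restrictT _ mA)/measurable_cst.
- exact/measurable_EFinP.
- move=> w _; rewrite patchE; case: ifPn => [|_]; last by rewrite lee_fin.
  by rewrite inE/= lee_fin.
Qed.

Lemma borel_cantelli_geom (F : nat -> set T) (C q : R) :
  (forall m, measurable (F m)) -> 0 <= C -> 0 <= q -> q < 1 ->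
  (forall m, (P (F m) <= (C * q ^+ m)%:E)%E) ->
  {ae P, forall w, exists m0, forall m, (m0 <= m)%N -> ~ F m w}.
Proof.
move=> mF C0 q0 q1 PF.
have sum_fin : (\sum_(n <oo) P (F n) < +oo)%E.
  apply: (@le_lt_trans _ _ (C / (1 - q))%:E); last exact: ltry.
  apply: lime_le; first by apply: is_cvg_nneseries.
  apply: nearW => n; apply: (@le_trans _ _ (\sum_(0 <= i < n) (C * q ^+ i)%:E)%E).
    by apply: lee_sum => i _; exact: PF.
  rewrite sumEFin lee_fin -mulr_sumr ler_wpM2l//.
  have q1' : 0 < 1 - q by rewrite subr_gt0.
  rewrite -[leRHS]mul1r ler_pdivlMr//.
  elim: n => [|n IH]; first by rewrite big_geq// mul0r.
  have -> : (\sum_(0 <= i < n.+1) q ^+ i) * (1 - q) = 1 - q ^+ n.+1.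
    elim: n {IH} => [|n IH]; first by rewrite big_nat1 expr0 expr1 mul1r.
    by rewrite big_nat_recr//= mulrDl IH (exprS q n.+1); ring.
  by rewrite gerBl exprn_ge0.
have l0 := lim_sup_set_cvg0 mF sum_fin.
exists (lim_sup_set F); split => //.
  apply: bigcap_measurable; first by exists 0%N.
  by move=> k _; apply: bigcup_measurable.
move=> w /= nQ n _; apply: contrapT => nF; apply: nQ; exists n => m nm Fm.
by apply: nF; exists m.
Qed.

(** By Fatou's lemma the lower limit of [X] is integrable, hence almost surely finite, and one more
    than its value is undershot infinitely often. *)
Lemma fatou_frequently (X : nat -> T -> R) (K : R) :
  (forall m, measurable_fun setT (X m)) -> (forall m w, 0 <= X m w) ->
  (forall m, (\int[P]_w (X m w)%:E <= K%:E)%E) ->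
  {ae P, forall w, exists c : R, forall m0, exists2 m, (m0 <= m)%N & X m w <= c}.
Proof.
move=> mX X0 XK.
pose f n w := (X n w)%:E.
have mf n : measurable_fun setT (f n) by exact/measurable_EFinP.
have f0 n w : setT w -> (0 <= f n w)%E by rewrite lee_fin.
have le1 : (\int[P]_w limn_einf (f^~ w) <= K%:E)%E.
  apply: (le_trans (fatou P measurableT mf f0)).
  rewrite limn_einf_lim; apply: lime_le; first exact: is_cvg_einfs.
  apply: nearW => n; rewrite /einfs; apply: ereal_inf_le.
  by exists (\int[P]_w f n w)%E; [exists n => //=|exact: XK].
have einf0 w : (0 <= limn_einf (f^~ w))%E.
  rewrite limn_einf_lim; apply: lime_ge; first exact: is_cvg_einfs.
  by apply: nearW => n; apply: le_ereal_inf_tmp => _ [m _ <-]; exact: f0.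
have int : P.-integrable setT (fun w => limn_einf (f^~ w)).
  apply/integrableP; split.
    apply: (emeasurable_fun_cvg (fun n w => einfs (f^~ w) n)).
      by move=> n; exact: measurable_fun_einfs.
    by move=> w _; rewrite limn_einf_lim; exact: is_cvg_einfs.
  under eq_integral do rewrite gee0_abs//.
  exact: le_lt_trans le1 (ltry _).
have := integrable_ae measurableT int; apply: filterS => w /(_ Logic.I) fin.
exists (fine (limn_einf (f^~ w)) + 1) => m0; apply: contrapT => nex.
have : ((fine (limn_einf (f^~ w)) + 1)%:E <= limn_einf (f^~ w))%E.
  rewrite [leRHS]limn_einf_lim; apply: lime_ge; first exact: is_cvg_einfs.
  exists m0 => // n /= m0n; apply: le_ereal_inf_tmp => _ [m /= nm <-].
  rewrite lee_fin leNgt; apply/negP => /ltW h; apply: nex; exists m => //.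
  exact: leq_trans m0n nm.
move: fin (einf0 w); case: (limn_einf _) => [r _ _|//|//] /=.
by rewrite lee_fin leNgt ltrDl ltr01.
Qed.

End almost_sure_tools.

(** * Modulus of continuity from dyadic increments *)

Section dyadic_chaining.
Context {R : realType}.

Definition cts_nonneg (f : R -> R) : Prop :=
  forall t, 0 <= t -> forall e, 0 < e ->
  exists2 dl, 0 < dl & forall s, 0 <= s -> `|s - t| < dl -> `|f s - f t| < e.

Lemma geom_sum_le (rho : R) n : 0 <= rho -> rho < 1 ->
  \sum_(i < n) rho ^+ i <= (1 - rho)^-1.
Proof.
move=> r0 r1; have r1' : 0 < 1 - rho by rewrite subr_gt0.
rewrite -[leRHS]mul1r ler_pdivlMr//.
suff -> : (\sum_(i < n) rho ^+ i) * (1 - rho) = 1 - rho ^+ n by rewrite gerBl exprn_ge0.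
elim: n => [|n IH]; first by rewrite big_ord0 mul0r expr0 subrr.
by rewrite big_ord_recr/= mulrDl IH (exprS rho n); ring.
Qed.

Definition grid (m j : nat) : R := j%:R / 2 ^+ m.

Lemma grid_ge0 m j : 0 <= grid m j.
Proof. by rewrite divr_ge0// exprn_ge0. Qed.

Lemma grid_double m l j : grid (m + l) (j * 2 ^ l) = grid m j.
Proof.
by rewrite /grid natrM natrX exprD; field; rewrite !expf_neq0.
Qed.

Lemma grid_le m j k : (j <= k)%N -> grid m j <= grid m k.
Proof. by move=> jk; rewrite /grid ler_pM2r ?invr_gt0 ?exprn_gt0// ler_nat. Qed.

Variables (f : R -> R) (rho : R) (M m0 : nat).
Hypotheses (rho_ge0 : 0 <= rho) (rho_lt1 : rho < 1).
Hypothesis incr : forall m, (m0 <= m)%N -> forall j, (j < M * 2 ^ m)%N ->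
  `|f (grid m j.+1) - f (grid m j)| <= rho ^+ m.

(** A point [k] of the finer grid either belongs to the next coarser one or is one increment past a
    point of it, according to its parity. Each refinement thus costs one increment of its own
    level. *)
Lemma dyadic_chain m l j k : (m0 <= m)%N -> (j < M * 2 ^ m)%N ->
  (j * 2 ^ l <= k <= j.+1 * 2 ^ l)%N ->
  `|f (grid (m + l) k) - f (grid m j)| <= rho ^+ m * \sum_(i < l.+1) rho ^+ i.
Proof.
move=> m0m jM; elim: l k => [|l IH] k /andP[k1 k2].
  rewrite addn0 big_ord_recr big_ord0/= add0r expr0 mulr1.
  rewrite expn0 !muln1 in k1 k2; move: k1; rewrite leq_eqVlt => /predU1P[<-|k1].
    by rewrite subrr normr0 exprn_ge0.
  have -> : k = j.+1 by apply/eqP; rewrite eqn_leq k2 k1.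
  exact: incr.
have kE := odd_double_half k.
have k1' : (2 * (j * 2 ^ l) <= k)%N by rewrite mulnCA -expnS.
have k2' : (k <= 2 * (j.+1 * 2 ^ l))%N by rewrite mulnCA -expnS.
have k'1 : (j * 2 ^ l <= k./2)%N by move: k1' kE; lia.
have k'2 : (k./2 <= j.+1 * 2 ^ l)%N by move: k2' kE; lia.
have gE : grid (m + l.+1) (k./2).*2 = grid (m + l) k./2.
  by have := grid_double (m + l) 1 k./2; rewrite addn1 addnS expn1 muln2.
have := IH k./2; rewrite k'1 k'2 => /(_ isT) {}IH.
rewrite big_ord_recr/= mulrDr -exprD.
have st : `|f (grid (m + l.+1) k) - f (grid (m + l) k./2)| <= rho ^+ (m + l.+1).
  rewrite -gE -[in X in f (grid _ X) - _]kE.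
  case: (odd k) kE => kE; last by rewrite add0n subrr normr0 exprn_ge0.
  apply: incr; first exact: leq_trans m0m (leq_addr _ _).
  have : ((k./2).*2 < j.+1 * 2 ^ l.+1)%N by move: k2; rewrite -kE; lia.
  move=> /leq_trans; apply; rewrite expnD mulnA leq_mul2r; apply/orP; right.
  exact: jM.
have := ler_normD (f (grid (m + l.+1) k) - f (grid (m + l) k./2))
  (f (grid (m + l) k./2) - f (grid m j)).
rewrite addrA subrK => /le_trans; apply.
by rewrite addrC lerD.
Qed.

Lemma dyadic_chain_le m l j k : (m0 <= m)%N -> (j < M * 2 ^ m)%N ->
  (j * 2 ^ l <= k <= j.+1 * 2 ^ l)%N ->
  `|f (grid (m + l) k) - f (grid m j)| <= rho ^+ m / (1 - rho).
Proof.
move=> m0m jM jk; apply: le_trans (dyadic_chain m0m jM jk) _.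
by rewrite ler_wpM2l ?exprn_ge0// geom_sum_le.
Qed.

Lemma grid_approx (t dl : R) m : 0 <= t -> 0 < dl ->
  exists l k, grid (m + l) k <= t /\ t < grid (m + l) k.+1 /\ t - grid (m + l) k < dl.
Proof.
move=> t0 dl0.
pose l := (Num.truncn (dl^-1)).+1.
have dll : 2 ^- (m + l) < dl.
  rewrite -[ltRHS]invrK ltf_pV2 ?posrE ?exprn_gt0 ?invr_gt0//.
  apply: (@lt_le_trans _ _ l%:R); first exact: truncnS_gt.
  rewrite -natrX ler_nat (leq_trans (ltnW (ltn_expl l (ltnSn 1))))//.
  by rewrite leq_exp2l// leq_addl.
have p0 : 0 < (2 : R) ^+ (m + l) by rewrite exprn_gt0.
exists l, (Num.truncn (t * 2 ^+ (m + l))).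
have tt0 : 0 <= t * 2 ^+ (m + l) by rewrite mulr_ge0// ltW.
have /andP[h1 h2] := truncn_itv tt0.
have g1 : grid (m + l) (Num.truncn (t * 2 ^+ (m + l))) <= t by rewrite /grid ler_pdivrMr.
have g2 : t < grid (m + l) (Num.truncn (t * 2 ^+ (m + l))).+1 by rewrite /grid ltr_pdivlMr.
split=> //; split=> //; apply: lt_trans dll; move: g2; rewrite /grid -natr1 mulrDl mul1r; lra.
Qed.

Lemma grid_lt_nat m j k : grid m j < grid m k -> (j < k)%N.
Proof. by rewrite /grid ltr_pM2r ?invr_gt0 ?exprn_gt0// ltr_nat. Qed.

Lemma dyadic_modulus : cts_nonneg f -> forall m j t, (m0 <= m)%N -> (j < M * 2 ^ m)%N ->
  grid m j <= t <= grid m j.+1 -> `|f t - f (grid m j)| <= rho ^+ m / (1 - rho).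
Proof.
move=> cf m j t m0m jM /andP[jt tj].
move: tj; rewrite le_eqVlt => /predU1P[->|tj].
  have := @dyadic_chain_le m 0 j j.+1 m0m jM; rewrite addn0 !expn0 !muln1.
  by rewrite leqnSn leqnn => /(_ isT).
have t0 : 0 <= t := le_trans (grid_ge0 m j) jt.
apply/ler_addgt0Pr => e e0; have [dl dl0 cdl] := cf t t0 e e0.
have [l [k [k1 [k2 k3]]]] := grid_approx m t0 dl0.
have jk : (j * 2 ^ l <= k <= j.+1 * 2 ^ l)%N.
  apply/andP; split.
    rewrite -ltnS; apply: (@grid_lt_nat (m + l)); rewrite grid_double.
    exact: le_lt_trans k2.
  apply: ltnW; apply: (@grid_lt_nat (m + l)); rewrite grid_double.
  exact: le_lt_trans tj.
have h1 := dyadic_chain_le m0m jM jk.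
have h2 : `|f (grid (m + l) k) - f t| < e.
  apply: cdl; first exact: grid_ge0.
  by rewrite distrC ger0_norm ?subr_ge0.
have := ler_normD (f t - f (grid (m + l) k)) (f (grid (m + l) k) - f (grid m j)).
rewrite addrA subrK => /le_trans; apply; rewrite addrC lerD//.
by rewrite distrC ltW.
Qed.

End dyadic_chaining.
Lemma cts_nonneg_uniform {R : realType} (f : R -> R) (M e : R) : cts_nonneg f -> 0 < e ->
  exists2 dl, 0 < dl & forall s t, 0 <= s <= M -> 0 <= t <= M -> `|s - t| < dl -> `|f s - f t| < e.
Proof.
move=> cf e0.
pose Q (dl t : R) := 0 <= t -> forall s, 0 <= s -> `|s - t| < dl -> `|f s - f t| < e.
have := @segment_compact R 0 M; rewrite compact_near_coveringP => /(_ R (0^'+) Q _).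
have loc t : `[0, M]%classic t -> \forall t' \near t & dl \near 0^'+, Q dl t'.
  rewrite /= in_itv/= => /andP[t0 _].
  have [dl dl0 cdl] := cf t t0 (e / 2) ltac:(lra).
  exists ([set t' | `|t' - t| < dl / 2], [set y : R | y < dl / 2]) => /=.
    split; last by apply: nbhs_right_lt; lra.
    by apply/nbhs_ballP; exists (dl / 2) => /=; [lra|move=> y; rewrite /ball/= distrC].
  move=> [t' y] /= [tt' ydl] t'0 s s0 sy.
  have st : `|s - t| < dl.
    by have := ler_normD (s - t') (t' - t); rewrite addrA subrK; lra.
  have t't : `|t' - t| < dl by lra.
  have := cdl s s0 st; have := cdl t' t'0 t't.
  have := ler_normB (f s - f t) (f t' - f t).
  by rewrite opprB addrA subrK; lra.
move=> /(_ loc) H.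
near (0 : R)^'+ => dl.
exists dl; first by near: dl; exact: nbhs_right_gt.
move=> s t /andP[s0 sM] /andP[t0 tM] st.
have : forall t, `[0, M]%classic t -> Q dl t by near: dl.
by move=> /(_ t); rewrite /= in_itv/= t0 tM => /(_ isT) /(_ t0 s s0 st).
Unshelve. all: by end_near.
Qed.

(** * Almost sure bounds on the number of rare Brownian increments *)

Section counting_events.
Context d {T : measurableType d} {R : realType} (P : probability T R).

Lemma expected_count (J : finType) (A : J -> set T) : (forall j, measurable (A j)) ->
  (\int[P]_w (\sum_j (\1_(A j) w : R))%:E = \sum_j P (A j))%E.
Proof.
move=> mA; under eq_integral do rewrite -sumEFin.
rewrite ge0_integral_sum//.
  by apply: eq_bigr => j _; rewrite integral_indic// setIT.
by move=> j; apply/measurable_EFinP; exact: measurable_indic.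
Qed.

(** The expected number of events at level [m] is at most [C q^m] times [c m]; Markov's inequality
    and the Borel-Cantelli lemma follow. *)
Lemma eventually_few (J : nat -> finType) (A : forall m, J m -> set T) (b c : nat -> R) (C q : R) :
  (forall m j, measurable (A m j)) -> 0 <= C -> 0 <= q -> q < 1 -> (forall m, 0 < c m) ->
  (forall m j, P (A m j) <= (b m)%:E)%E -> (forall m, #|J m|%:R * b m <= C * q ^+ m * c m) ->
  {ae P, forall w, exists m0, forall m, (m0 <= m)%N -> \sum_j \1_(A m j) w < c m}.
Proof.
move=> mA C0 q0 q1 c0 Pb bC.
pose X m w : R := \sum_j \1_(A m j) w.
have mX m : measurable_fun setT (X m).
  by apply: measurable_sum => j; exact: measurable_indic.
have X0 m w : 0 <= X m w by apply: sumr_ge0.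
have mF m : measurable [set w | c m <= X m w].
  rewrite (_ : [set w | _] = setT `&` X m @^-1` `[c m, +oo[); first exact: mX.
  by rewrite setTI; apply/seteqP; split => w /=; rewrite in_itv/= andbT.
have PF m : (P [set w | c m <= X m w]%R <= (C * q ^+ m)%:E)%E.
  have := markov_ge P (mX m) (X0 m) (ltW (c0 m)).
  rewrite expected_count// => /le_trans h.
  have {}h : (((c m)%:E * P [set w | c m <= X m w]%R <= ((c m) * (C * q ^+ m))%:E)%E).
    apply: h; apply: (@le_trans _ _ (\sum_(j : J m) (b m)%:E)%E); first exact: lee_sum.
    rewrite sumEFin lee_fin sumr_const -mulr_natl [c m * _]mulrC; exact: bC.
  by move: h; rewrite EFinM lee_pmul2l// lte_fin.
have := borel_cantelli_geom mF C0 q0 q1 PF; apply: filterS => w [m0 h].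
by exists m0 => m /h /=; rewrite -/(X m w) ltNge => /negP.
Qed.

End counting_events.

(** The inequality [expR (y / p.+1) >= y / p.+1], raised to a power. It turns the Gaussian tails
    into geometric decay of any prescribed rate. *)
Lemma expR_neg_le_pow {R : realType} (y : R) p : 0 < y ->
  expR (- y) <= (p.+1%:R / y) ^+ p.+1.
Proof.
move=> y0; have p0 : 0 < p.+1%:R :> R by rewrite ltr0n.
have e1 : y / p.+1%:R <= expR (y / p.+1%:R).
  by apply: le_trans (expR_ge1Dx _); rewrite lerDr.
have -> : - y = p.+1%:R * (- (y / p.+1%:R)) by field; rewrite gt_eqF.
rewrite expRM_natl lerXn2r ?nnegrE ?expR_ge0 ?divr_ge0 ?(ltW y0) ?(ltW p0)//.
by rewrite expRN -[leRHS]invrK lef_pV2 ?posrE ?expR_gt0 ?invr_gt0 ?divr_gt0// invfM invrK mulrC.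
Qed.

Section brownian_grid.
Context d {T : measurableType d} {R : realType} (P : probability T R) {N : nat}.
Variable B : R -> T -> 'rV[R]_N.
Hypothesis bm : brownian_motion P B.

Lemma bm_increment_measurable s t i :
  measurable_fun setT (fun w => B t w ord0 i - B s w ord0 i).
Proof. by have [mB _] := bm; apply: measurable_funB; exact: mB. Qed.

Lemma bm_grid_increments (h : R) n : 0 < h ->
  let D (j : nat) w := B (j.+1%:R * h) w - B (j%:R * h) w in
  mutually_independent P (fun (ij : 'I_N * 'I_n) w => D ij.2 w ord0 ij.1) /\
  (forall (i : 'I_N) (j : 'I_n) (A : set R), measurable A ->
    P ((fun w => D j w ord0 i) @^-1` A) = normal_prob 0 (Num.sqrt h) A).
Proof.
move=> h0 D; have [_ [_ inc]] := bm.
have t0 : 0 <= 0%:R * h by rewrite mul0r.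
have tS j : j%:R * h < j.+1%:R * h by rewrite ltr_pM2r// ltr_nat.
have [ind law] := inc (fun j => j%:R * h) t0 tS n.
have DE (i : 'I_N) (j : nat) :
    (fun w => D j w ord0 i) = (fun w => B (j.+1%:R * h) w ord0 i - B (j%:R * h) w ord0 i).
  by apply/funext => w; rewrite /D !mxE.
split.
  suff -> : (fun (ij : 'I_N * 'I_n) w => D ij.2 w ord0 ij.1) = (fun (ij : 'I_N * 'I_n) w =>
    B (ij.2.+1%:R * h) w ord0 ij.1 - B (ij.2%:R * h) w ord0 ij.1) by exact: ind.
  by apply/funext => ij; exact: DE.
move=> i j A mA; rewrite (DE i j); have := law i j A mA.
by rewrite -mulrBl -[j.+1%:R]natr1 addrAC subrr add0r mul1r.
Qed.

Lemma bm_increment (s t : R) : 0 <= s -> s < t ->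
  mutually_independent P (fun (ij : 'I_N * 'I_1) w => B t w ord0 ij.1 - B s w ord0 ij.1) /\
  (forall (i : 'I_N) (A : set R), measurable A ->
    P ((fun w => B t w ord0 i - B s w ord0 i) @^-1` A) = normal_prob 0 (Num.sqrt (t - s)) A).
Proof.
move=> s0 st; have [_ [_ inc]] := bm.
have t0 : 0 <= s + 0%:R * (t - s) by rewrite mul0r addr0.
have tS j : s + j%:R * (t - s) < s + j.+1%:R * (t - s).
  by rewrite ltrD2l ltr_pM2r ?subr_gt0// ltr_nat.
have [ind law] := inc (fun j => s + j%:R * (t - s)) t0 tS 1.
have e0 : s + 0%:R * (t - s) = s by rewrite mul0r addr0.
have e1 : s + 1%:R * (t - s) = t by rewrite mul1r addrC subrK.
split.
  suff -> : (fun (ij : 'I_N * 'I_1) w => B t w ord0 ij.1 - B s w ord0 ij.1) =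
     (fun (ij : 'I_N * 'I_1) w =>
    B (s + ij.2.+1%:R * (t - s)) w ord0 ij.1 - B (s + ij.2%:R * (t - s)) w ord0 ij.1) by exact: ind.
  by apply/funext => -[i j]; rewrite /= (ord1 j) /= e0 e1.
by move=> i A mA; have := law i ord0 A mA; rewrite /= e0 e1.
Qed.

(** Condition on all coordinates but [i0]: the increment of coordinate [i0] alone, with its nonzero
    coefficient, gives the estimate of [normal_small_ball] for every value of the others. *)
Lemma bm_linear_small_ball (v : 'rV[R]_N) i0 (s t r : R) : 0 <= s -> s < t -> 0 <= r ->
  v ord0 i0 != 0 ->
  (P [set w | `|dotv v (B t w - B s w)| <= r]%R <=
     (2 * (r / `|v ord0 i0|) / Num.sqrt (t - s))%:E)%E.
Proof.
move=> s0 st r0 v0; have [ind law] := bm_increment s0 st.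
pose Y (ij : 'I_N * 'I_1) w := B t w ord0 ij.1 - B s w ord0 ij.1.
pose q : 'I_N * 'I_1 := (i0, ord0).
have mY ij : measurable_fun setT (Y ij) by exact: bm_increment_measurable.
pose U w := \sum_(i < N | i != i0) v ord0 i * Y (i, ord0) w.
have mU : measurable_fun setT (U : g_sigma_algebraType (others Y q) -> R).
  rewrite (_ : U = fun w => \sum_(i < N) (if i != i0 then v ord0 i * Y (i, ord0) w else 0)).
    apply: measurable_sum => i; case: (boolP (i != i0)) => ii0; last exact: measurable_cst.
    apply: measurable_funM; first exact: measurable_cst.
    by apply: (measurable_coord_others (p := (i, ord0))); apply: contraNneq ii0 => -[->].
  by apply/funext => w; rewrite /U big_mkcond.
pose phi (z : R * R) : \bar R := (\1_[set z : R * R | `|z.1 + v ord0 i0 * z.2| <= r] z)%:E.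
have mphiA : measurable [set z : R * R | `|z.1 + v ord0 i0 * z.2| <= r].
  have mf : measurable_fun setT (fun z : R * R => `|z.1 + v ord0 i0 * z.2|).
    apply: measurableT_comp => //; apply: measurable_funD => //.
    by apply: measurable_funM => //; exact: measurable_cst.
  rewrite (_ : [set z | _] = setT `&` (fun z : R * R => `|z.1 + v ord0 i0 * z.2|) @^-1` `]-oo, r]).
    exact: mf.
  by rewrite setTI; apply/seteqP; split => z /=; rewrite in_itv.
have mphi : measurable_fun setT phi by apply/measurable_EFinP; exact: measurable_indic.
have phi0 z : (0 <= phi z)%E by rewrite lee_fin.
have dE w : dotv v (B t w - B s w) = U w + v ord0 i0 * Y q w.
  rewrite /dotv (bigD1 i0)//= addrC; congr (_ + _); last by rewrite !mxE.
  by apply: eq_bigr => i _; rewrite !mxE.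
have mU' := measurable_of_others mY mU.
have mE (A : set T) : measurable A -> (P A = \int[P]_w (\1_A w)%:E)%E.
  by move=> mA; rewrite integral_indic// setIT.
have sec (u : R) : measurable [set w' | `|u + v ord0 i0 * Y q w'| <= r].
  rewrite (_ : [set w' | _] = setT `&` (fun w' => `|u + v ord0 i0 * Y q w'|) @^-1` `]-oo, r]).
    apply: measurableT_comp => //; apply: measurable_funD => //.
    by apply: measurable_funM => //; exact: measurable_cst.
  by rewrite setTI; apply/seteqP; split => z /=; rewrite in_itv.
rewrite mE; last first.
  rewrite (_ : [set w | _] = setT `&` (fun w => `|U w + v ord0 i0 * Y q w|) @^-1` `]-oo, r]).
    apply: measurableT_comp => //; apply: measurable_funD => //.
    by apply: measurable_funM => //; exact: measurable_cst.
  have -> : (fun w => `|U w + v ord0 i0 * Y q w|) = (fun w => `|dotv v (B t w - B s w)|).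
    by apply/funext => w; rewrite dE.
  by rewrite setTI; apply/seteqP; split => z; rewrite /preimage/= in_itv/=.
under eq_integral => w _.
  have -> : (\1_[set w0 | `|dotv v (B t w0 - B s w0)| <= r] w)%:E = phi (U w, Y q w).
    by rewrite /phi /indic; congr ((nat_of_bool _)%:R%:E); apply/idP/idP; rewrite !inE/= dE.
  over.
rewrite (indep_tonelli mY ind mU phi0 mphi).
apply: (@le_trans _ _ (\int[P]_w (2 * (r / `|v ord0 i0|) / Num.sqrt (t - s))%:E)%E); last first.
  have E : (P : {measure set T -> \bar R}) setT = 1%E := probability_setT P.
  by rewrite integral_cst// E mule1.
apply: ge0_le_integral => //.
- by move=> w _; apply: integral_ge0.
- exact: (indep_tonelli_measurable P mY mU phi0 mphi).
- move=> w _; rewrite /phi.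
  have -> : (\int[P]_w' (\1_[set z : R * R | `|z.1 + v ord0 i0 * z.2| <= r] (U w, Y q w'))%:E)%E =
     P [set w' | `|U w / v ord0 i0 + Y q w'| <= r / `|v ord0 i0| ]%R.
    rewrite [RHS](_ : _ = P [set w' | `|U w + v ord0 i0 * Y q w'| <= r]%R); last first.
      congr (P _); apply/seteqP; split => w' /=; rewrite ler_pdivlMr ?normr_gt0// -normrM;
        by rewrite mulrDl divfK// [Y q w' * _]mulrC.
    by rewrite mE.
  apply: normal_small_ball; first by rewrite sqrtr_gt0 subr_gt0.
    by move=> A mA; exact: law.
  by rewrite divr_ge0.
Qed.

End brownian_grid.

Lemma pow_unbounded {R : realType} (l A : R) : 1 < l -> exists p, A <= l ^+ p.+1.
Proof.
move=> l1; have l0 : 0 < l - 1 by rewrite subr_gt0.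
have bern n : 1 + n%:R * (l - 1) <= l ^+ n.
  elim: n => [|n IH]; first by rewrite mul0r addr0 expr0.
  rewrite exprS; apply: (@le_trans _ _ (l * (1 + n%:R * (l - 1)))); last first.
    by rewrite ler_pM2l// (lt_trans ltr01).
  have -> : l * (1 + n%:R * (l - 1)) = 1 + n.+1%:R * (l - 1) + n%:R * (l - 1) ^+ 2.
    by rewrite -[n.+1%:R]natr1; ring.
  by rewrite lerDl mulr_ge0// sqr_ge0.
exists (Num.truncn (A / (l - 1))).
apply: le_trans (bern _); set n := (Num.truncn _).+1.
have : A / (l - 1) < n%:R by exact: truncnS_gt.
by rewrite ltr_pdivrMr// => h; lra.
Qed.

Section brownian_paths.
Context d {T : measurableType d} {R : realType} (P : probability T R) {N : nat}.
Variable B : R -> T -> 'rV[R]_N.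
Hypothesis bm : brownian_motion P B.

(** An increment over [2^-m] exceeds [rho^m] with probability at most [2 expR (- (2 rho^2)^m / 2)].
    Since [2 rho^2 > 1], this decays faster than any geometric sequence, in particular faster than
    the number of intervals grows. *)
Lemma bm_modulus_ae (rho : R) (M : nat) : 0 < rho -> 1 / 2 < rho ^+ 2 ->
  {ae P, forall w, exists m0, forall m, (m0 <= m)%N -> forall j, (j < M * 2 ^ m)%N ->
    forall i : 'I_N,
    `|B (grid m j.+1) w ord0 i - B (grid m j) w ord0 i| <= rho ^+ m}.
Proof.
move=> r0 r2.
(* The ratio 4 leaves a summable [2^-m] after multiplication by the [M * 2^m] intervals. *)
have [p hp] := @pow_unbounded _ (2 * rho ^+ 2) 4 ltac:(lra).
pose J m : finType := ('I_N * 'I_(M * 2 ^ m))%type.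
pose A m (ij : J m) := [set w | rho ^+ m <=
  `|B (grid m ij.2.+1) w ord0 ij.1 - B (grid m ij.2) w ord0 ij.1| ].
pose y m : R := (2 * rho ^+ 2) ^+ m / 2.
pose K : R := (p.+1%:R * 2) ^+ p.+1.
have K0 : 0 <= K by rewrite exprn_ge0// mulr_ge0.
have l0 : 0 < 2 * rho ^+ 2 by lra.
have yK m : expR (- y m) <= K * 4 ^- m.
  apply: le_trans (expR_neg_le_pow p _) _; first by rewrite divr_gt0// exprn_gt0.
  have -> : p.+1%:R / y m = p.+1%:R * 2 * (2 * rho ^+ 2) ^- m.
    by rewrite /y; field; rewrite expf_neq0// gt_eqF.
  have -> : (p.+1%:R * 2 * (2 * rho ^+ 2) ^- m) ^+ p.+1 = K * ((2 * rho ^+ 2) ^+ p.+1) ^- m.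
    by rewrite exprMn -!exprVn -!exprM mulnC.
  rewrite ler_wpM2l// lef_pV2 ?posrE ?exprn_gt0//.
  by rewrite lerXn2r ?nnegrE ?exprn_ge0// ltW.
pose C : R := (N * M)%:R * (2 * K).
have := @eventually_few _ _ _ P J A (fun m => 2 * expR (- y m)) (fun=> 1) C 2^-1.
case => //.
- move=> m ij; rewrite (_ : A m ij = setT `&` (fun w => `|B (grid m ij.2.+1) w ord0 ij.1 -
    B (grid m ij.2) w ord0 ij.1|) @^-1` `[rho ^+ m, +oo[).
    by apply: measurableT_comp => //; exact: (bm_increment_measurable bm).
  by rewrite setTI; apply/seteqP; split => w /=; rewrite in_itv/= andbT.
- by rewrite mulr_ge0// mulr_ge0.
- lra.
- move=> m [i j]; rewrite /A/=.
  have gg : grid m j < grid m j.+1 :> R.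
    by rewrite /grid ltr_pM2r ?invr_gt0 ?exprn_gt0// ltr_nat.
  have [_ law] := bm_increment bm (grid_ge0 m j) gg.
  have dg : grid m j.+1 - grid m j = 2 ^- m :> R.
    by rewrite /grid -[j.+1%:R]natr1; ring.
  have p2 : 0 < (2 : R) ^- m by rewrite invr_gt0 exprn_gt0.
  have s0 : 0 < Num.sqrt (grid m j.+1 - grid m j : R) by rewrite sqrtr_gt0 dg.
  apply: le_trans (normal_tail s0 (bm_increment_measurable bm _ _ i) (law i) _) _.
    by rewrite exprn_ge0// ltW.
  rewrite lee_fin sqr_sqrtr dg ?(ltW p2)// le_eqVlt; apply/orP; left; apply/eqP.
  congr (2 * expR (- _)); rewrite /y exprMn -exprM mulnC exprM.
  by field; rewrite expf_neq0.
- move=> m; rewrite card_prod !card_ord mulr1 /C.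
  rewrite natrM natrM natrX natrM.
  have -> : N%:R * M%:R * (2 * K) * 2^-1 ^+ m = N%:R * (M%:R * 2 ^+ m) * (2 * (K * 4 ^- m)) :> R.
    have -> : (4 : R) ^- m = 2 ^- m * 2 ^- m.
      by rewrite -invfM -exprMn; congr (_ ^- _); ring.
    by rewrite exprVn; field; rewrite expf_neq0.
  by rewrite ler_wpM2l ?mulr_ge0 ?exprn_ge0// ler_wpM2l.
- move=> Z [mZ Z0 sZ]; exists Z; split => // w nw; apply: sZ => /= -[m0 hm0]; apply: nw.
  exists m0 => m m0m j jM i; rewrite leNgt; apply/negP => jr.
  have := hm0 m m0m; apply/negP; rewrite -leNgt.
  rewrite (bigD1 (i, Ordinal jM))//= indicE mem_set/= ?lerDl ?sumr_ge0//.
  by rewrite /A/= ltW.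
Qed.

(** At level [6m] a lag of [dl * 4^m] cells lasts [dl * 16^-m], so the increment has scale at least
    [4^-m], while the threshold is of order [(3/4)^(6m)]. The probability is therefore of order
    [(4 * (3/4)^6)^m = (729/1024)^m]. As [729/1024 <= 4/5 * 9/10], an exceptional proportion
    [(9/10)^m] leaves the summable factor [(4/5)^m]. *)
Lemma bm_close_pairs_ae (v : 'rV[R]_N) i0 (M dl : nat) (C : R) :
  v ord0 i0 != 0 -> (0 < dl)%N -> 0 <= C ->
  {ae P, forall w, exists m0, forall m, (m0 <= m)%N ->
    \sum_(j < M * 2 ^ (6 * m))
      \1_[set w | `|dotv v (B (grid (6 * m) (j + dl * 4 ^ m)) w - B (grid (6 * m) j) w)|
                  <= C * (3 / 4) ^+ (6 * m)] w < 2 ^+ (6 * m) * (9 / 10) ^+ m :> R}.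
Proof.
move=> v0 dl0 C0.
have V0 : 0 < `|v ord0 i0| by rewrite normr_gt0.
pose K := 2 * C / `|v ord0 i0|.
have K0 : 0 <= K by rewrite divr_ge0// mulr_ge0.
apply: (@eventually_few _ _ _ P (fun m => 'I_(M * 2 ^ (6 * m)) : finType)
  (fun m j => [set w | `|dotv v (B (grid (6 * m) (j + dl * 4 ^ m)) w - B (grid (6 * m) j) w)|
                  <= C * (3 / 4) ^+ (6 * m)])
  (fun m => K * (729 / 1024) ^+ m) (fun m => 2 ^+ (6 * m) * (9 / 10) ^+ m)
  (M%:R * K) (4 / 5)); [|by rewrite mulr_ge0|lra|lra| | |].
- move=> m j; set f := (X in measurable X).
  rewrite (_ : f = setT `&` (fun w => `|dotv v (B (grid (6 * m) (j + dl * 4 ^ m)) w -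
    B (grid (6 * m) j) w)|) @^-1` `]-oo, C * (3 / 4) ^+ (6 * m)]).
    apply: measurableT_comp => //.
    rewrite (_ : (fun _ => _) = fun w => \sum_i v ord0 i * (B (grid (6 * m) (j + dl * 4 ^ m)) w ord0 i -
    B (grid (6 * m) j) w ord0 i)).
      apply: measurable_sum => i; apply: measurable_funM; first exact: measurable_cst.
      exact: (bm_increment_measurable bm).
    by apply/funext => w; apply: eq_bigr => i _; rewrite !mxE.
  by rewrite setTI /f; apply/seteqP; split => w; rewrite /preimage/= in_itv/=.
- by move=> m; rewrite mulr_gt0// exprn_gt0//; lra.
- move=> m j.
  have jj : (j < j + dl * 4 ^ m)%N by rewrite -[X in (X < _)%N]addn0 ltn_add2l muln_gt0 dl0 expn_gt0.
  have gg : grid (6 * m) j < grid (6 * m) (j + dl * 4 ^ m) :> R.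
    by rewrite /grid ltr_pM2r ?invr_gt0 ?exprn_gt0// ltr_nat.
  have r0 : 0 <= C * (3 / 4) ^+ (6 * m) by rewrite mulr_ge0// exprn_ge0//; lra.
  apply: le_trans (bm_linear_small_ball bm (grid_ge0 _ _) gg r0 v0) _.
  have q0 : 0 < (2 : R) ^- (2 * m) by rewrite invr_gt0 exprn_gt0.
  have sq : 2 ^- (2 * m) <= Num.sqrt (grid (6 * m) (j + dl * 4 ^ m) - grid (6 * m) j : R).
    rewrite -[leLHS]gtr0_norm// -sqrtr_sqr ler_wsqrtr//.
    have -> : grid (6 * m) (j + dl * 4 ^ m) - grid (6 * m) j = dl%:R * (2 ^- (2 * m)) ^+ 2 :> R.
      rewrite /grid natrD natrM natrX -mulrBl addrAC subrr add0r -mulrA; congr (_ * _).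
      have -> : (4 : R) ^+ m = (2 ^+ m) ^+ 2 by rewrite -exprM mulnC exprM; congr (_ ^+ _); ring.
      rewrite [(6 * m)%N]mulnC [(2 * m)%N]mulnC !exprM; field.
      by rewrite !expf_neq0.
    by rewrite ler_peMl ?sqr_ge0// ler1n.
  rewrite lee_fin.
  apply: (@le_trans _ _ (2 * (C * (3 / 4) ^+ (6 * m) / `|v ord0 i0|) / 2 ^- (2 * m))).
    rewrite ler_wpM2l ?mulr_ge0 ?divr_ge0// lef_pV2 ?posrE//; exact: lt_le_trans sq.
  rewrite le_eqVlt; apply/orP; left; apply/eqP.
  have -> : (729 / 1024 : R) ^+ m = (3 / 4) ^+ (6 * m) * 2 ^+ (2 * m).
    by rewrite !exprM -exprMn; congr (_ ^+ _); field.
  by rewrite /K invrK; ring.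
- move=> m; rewrite card_ord natrM natrX.
  have -> : M%:R * K * (4 / 5) ^+ m * (2 ^+ (6 * m) * (9 / 10) ^+ m) =
    M%:R * 2 ^+ (6 * m) * (K * (18 / 25) ^+ m) :> R.
    have -> : (18 / 25 : R) ^+ m = (4 / 5) ^+ m * (9 / 10) ^+ m.
      by rewrite -exprMn; congr (_ ^+ _); field.
    by ring.
  rewrite ler_wpM2l ?mulr_ge0 ?exprn_ge0// ler_wpM2l// lerXn2r ?nnegrE; lra.
Qed.

End brownian_paths.

(** * Occupation estimate *)

Section resolvent.
Context {R : realType} {N : nat} {I : finType}.
Variables (al : I -> 'rV[R]_N) (kk : I -> R).

(** The default [z] is not reached for [h > 0] and a nonempty chamber, by [resolventP]. *)
Definition resolvent (h : R) (z : 'rV[R]_N) : 'rV[R]_N :=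
  xget z [set y | chamber al y /\ y = z + h *: rdrift al kk y].

Lemma resolventP (h : R) v z : (forall p, 0 < kk p) -> chamber al v -> 0 < h ->
  chamber al (resolvent h z) /\
  resolvent h z = z + h *: rdrift al kk (resolvent h z).
Proof.
move=> kk0 Wv h0; rewrite /resolvent; case: xgetP => [y _ //|nex].
by have [y Py] := resolvent_ex kk0 z h0 Wv; case: (nex y).
Qed.

(* The implicit Euler scheme with step 2^-n driven by the path b. *)
Definition euler (x : 'rV[R]_N) (b : R -> 'rV[R]_N) (n j : nat) : 'rV[R]_N :=
  scheme (resolvent (2 ^- n)) x (fun j => b (grid n j.+1) - b (grid n j)) j.

End resolvent.

Section occupation_almost_surely.
Context d {T : measurableType d} {R : realType} (P : probability T R) {N : nat} {I : finType}.
Variables (al : I -> 'rV[R]_N) (kk : I -> R) (v x : 'rV[R]_N) (B : R -> T -> 'rV[R]_N).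
Variables (a k' : R) (M : nat).
Hypothesis kk_gt0 : forall p, 0 < kk p.
Hypothesis Wv : chamber al v.
Hypothesis bm : brownian_motion P B.
Hypothesis x_ge0 : forall p, 0 <= dotv (al p) x.
Hypotheses (a_gt0 : 0 < a) (a_lt1 : a < 1).
Hypotheses (ak' : (1 - a) / 2 < k') (k'_le : forall p, k' <= kk p).
Hypothesis al_ge1 : forall p, 1 <= dotv (al p) (al p).
Hypothesis cross : positive_cross_terms al kk.

Definition potential (e : R) (y : 'rV[R]_N) := \sum_p (dotv (al p) y + e) `^ (a - 2).

Let Y w n j := euler al kk x (B^~ w) n j.
Let S (e : R) n w := 2 ^- n * \sum_(i < M * 2 ^ n) potential e (Y w n i.+1).

(** The constant [K] is fixed before [e]. For each [e] the level [n] is then taken so large that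
    both error terms of [occupation_bound] are at most 1, which accounts for the 2 in [A0 + 2]. *)
Lemma occupation_mean : exists K, forall e, 0 < e -> e <= 1 -> forall n0,
  exists2 n, (n0 <= n)%N & measurable_fun setT (S e n) /\
    (\int[P]_w (S e n w)%:E <= K%:E)%E.
Proof.
pose c0 := a * (k' - (1 - a) / 2).
have c00 : 0 < c0 by rewrite mulr_gt0 ?subr_gt0.
pose A0 := (\sum_p (2 + nrm (al p))) * (1 + dotv x x + M%:R * (N%:R + 2 * \sum_p kk p)).
pose K3 := \sum_p nrm (al p) ^+ 3 * N%:R ^+ 4 * (12 * expR (2^-1)) : R.
exists ((A0 + 2) / c0) => e e0 e1 n0.
have [C C0 tay] := prof_taylor a_gt0 a_lt1 e0.
pose A1 := (\sum_p dotv (al p) (al p)) * (a * (1 - a) * e `^ (a - 2)).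
have A10 : 0 <= A1.
  apply: mulr_ge0; first by apply: sumr_ge0 => p _; exact: dotv_ge0.
  apply: mulr_ge0; last exact: powR_ge0.
  by apply: mulr_ge0; [exact: ltW|rewrite subr_ge0 ltW].
have K30 : 0 <= K3.
  apply: sumr_ge0 => p _; apply: mulr_ge0; last by rewrite mulr_ge0// expR_ge0.
  by apply: mulr_ge0; rewrite ?exprn_ge0 ?nrm_ge0.
pose A2 := C * K3 * M%:R.
have A20 : 0 <= A2 by rewrite !mulr_ge0.
(* [A2] enters squared because it multiplies the square root of the mesh, whereas [A1] multiplies
   the mesh itself. *)
have [q hq] := @pow_unbounded R 2 (A1 + A2 ^+ 2 + 1) ltac:(lra).
pose n := (n0 + q.+1)%N; exists n; first exact: leq_addr.
have p0 : 0 < (2 : R) ^- n by rewrite invr_gt0 exprn_gt0.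
have hn : (A1 + A2 ^+ 2 + 1) * 2 ^- n <= 1.
  rewrite ler_pdivrMr ?exprn_gt0// mul1r; apply: le_trans hq _.
  by rewrite ler_weXn2l// ?leq_addl//; lra.
have JP z := resolventP z kk_gt0 Wv p0.
have [ind law] := bm_grid_increments bm (M * 2 ^ n) p0.
pose D (j : nat) w := B (j.+1%:R * 2 ^- n) w - B (j%:R * 2 ^- n) w.
have mD j i : measurable_fun setT (fun w => D j w ord0 i).
  rewrite (_ : (fun _ => _) = (fun w => B (j.+1%:R * 2 ^- n) w ord0 i - B (j%:R * 2 ^- n) w ord0 i)).
    exact: (bm_increment_measurable bm).
  by apply/funext => w; rewrite /D !mxE.
have iV m : rint P setT (fun w => potential e (Y w n m)).
  exact: (occupation_integrable P kk_gt0 p0 (fun z => (JP z).1) (fun z => (JP z).2)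
    x_ge0 mD a_lt1 e0).
have iS : rint P setT (fun w => \sum_(i < M * 2 ^ n) potential e (Y w n i.+1)).
  by apply: rint_sum => // i _; exact: iV.
have ob : 2 ^- n * c0 * \sum_(i < M * 2 ^ n) \int[P]_w potential e (Y w n i.+1) <=
    A0 + 2 ^- n / 2 * A1 + A2 * Num.sqrt (2 ^- n).
  have := occupation_bound kk_gt0 p0 (fun z => (JP z).1) (fun z => (JP z).2) x_ge0 mD ind law
    a_gt0 a_lt1 e0 e1 ak' k'_le al_ge1 cross C0 tay.
  have -> : (M * 2 ^ n)%:R * 2 ^- n = M%:R :> R by rewrite natrM natrX mulfK// expf_neq0.
  rewrite -/A0 -/c0 -/K3 => /le_trans; apply.
  by rewrite le_eqVlt; apply/orP; left; apply/eqP; rewrite /A1 /A2; ring.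
have s0 : 0 <= A2 * Num.sqrt (2 ^- n) by rewrite mulr_ge0// sqrtr_ge0.
have s1 : A2 * Num.sqrt (2 ^- n) <= 1.
  rewrite -(@expr_le1 _ 2)// exprMn sqr_sqrtr ?(ltW p0)//; apply: le_trans hn.
  by rewrite ler_wpM2r ?(ltW p0)//; lra.
have s2 : 2 ^- n / 2 * A1 <= 1.
  have : A1 * 2 ^- n <= (A1 + A2 ^+ 2 + 1) * 2 ^- n.
    rewrite ler_wpM2r ?(ltW p0)//; have := sqr_ge0 A2; lra.
  lra.
have iS' : rint P setT (S e n) by exact: rintZl.
split; first exact: (rint_measurable iS').
rewrite -EFin_Rintegral// lee_fin ler_pdivlMr//.
rewrite (RintegralZl _ measurableT iS) (Rint_sum measurableT _ (fun (i : 'I_(M * 2 ^ n)) _ => iV i.+1)).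
by rewrite mulrAC; lra.
Qed.

Lemma potential_ge0 e y : 0 <= potential e y.
Proof. by apply: sumr_ge0 => p _; exact: powR_ge0. Qed.

(** The bound of means is used along a diagonal sequence, with [e = 1 / (m + 1)] and level [n m].
    The potential decreases in [e], so this one sequence serves every [e] outside a single null
    set. *)
Lemma occupation_ae : {ae P, forall w, exists K, forall e, 0 < e -> e <= 1 ->
  forall n0, exists2 n, (n0 <= n)%N & S e n w <= K}.
Proof.
have [K HK] := occupation_mean.
have H m : exists n, (m <= n)%N /\ (measurable_fun setT (S m.+1%:R^-1 n) /\
    (\int[P]_w (S m.+1%:R^-1 n w)%:E <= K%:E)%E).
  have [||n mn h] := HK m.+1%:R^-1 _ _ m; first by rewrite invr_gt0.
    by rewrite invf_le1// ler1n.
  by exists n.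
pose n m := projT1 (cid (H m)).
have nP m := projT2 (cid (H m)); rewrite -/(n _) in nP.
have S0 e m w : 0 <= S e m w.
  apply: mulr_ge0; first by rewrite invr_ge0 exprn_ge0.
  by apply: sumr_ge0 => i _; exact: potential_ge0.
have := @fatou_frequently _ _ _ P (fun m => S m.+1%:R^-1 (n m)) K
  (fun m => (nP m).2.1) (fun m w => S0 _ _ w) (fun m => (nP m).2.2).
apply: filterS => w [c hc]; exists c => e e0 e1 n0.
have [m mm Sm] := hc (maxn n0 (Num.truncn e^-1)).
have [n0m tm] : (n0 <= m)%N /\ (Num.truncn e^-1 <= m)%N by move: mm; rewrite geq_max => /andP[].
exists (n m); first by apply: leq_trans n0m _; exact: (nP m).1.
apply: le_trans Sm; rewrite ler_wpM2l ?invr_ge0 ?exprn_ge0//.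
apply: ler_sum => i _; apply: ler_sum => p _.
have u0 : 0 <= dotv (al p) (Y w (n m) i.+1).
  have p0 : 0 < (2 : R) ^- (n m) by rewrite invr_gt0 exprn_gt0.
  have JP z := resolventP z kk_gt0 Wv p0.
  by apply: (scheme_ge0 (fun z => (JP z).1)); exact: x_ge0.
have m0 : 0 < m.+1%:R^-1 :> R by rewrite invr_gt0.
have me : m.+1%:R^-1 <= e.
  rewrite -[leRHS]invrK lef_pV2 ?posrE ?invr_gt0//.
  by apply: le_trans (ltW (truncnS_gt _)) _; rewrite ler_nat.
apply: powR_neg_le; [by rewrite ltr_wpDl|by move: a_lt1; lra|by rewrite lerD2l].
Qed.

End occupation_almost_surely.

(** * Times spent on the boundary *)

Section translates.
Local Open Scope nat_scope.

Lemma sum_shift (f : nat -> nat) n s Q : (forall j, n <= j -> f j = 0) -> s <= Q ->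
  \sum_(t < n + Q) (s <= t) * f (t - s) = \sum_(j < n) f j.
Proof.
move=> fn sQ; rewrite -!(big_mkord xpredT (fun t => (s <= t) * f (t - s))) -(big_mkord xpredT).
rewrite (@big_cat_nat _ _ _ s)//=; last by rewrite (leq_trans sQ)// leq_addl.
rewrite big_nat big1 ?add0n; last by move=> t /andP[_ ts]; rewrite leqNgt ts.
rewrite -{1}[s]add0n big_addn -addnBA// (@big_cat_nat _ _ _ n)//=; last exact: leq_addr.
rewrite [X in _ + X]big_nat [X in _ + X]big1 ?addn0; last first.
  by move=> t /andP[nt _]; rewrite addnK fn// muln0.
by apply: eq_bigr => t _; rewrite leq_addl mul1n addnK.
Qed.

(* If g translates of a set cover a point, then g <= 1 + g (g - 1), and g (g - 1) counts pairs. *)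
Lemma translates_count (chi : nat -> bool) n p q K :
  (forall j, n <= j -> chi j = false) ->
  (forall dl, 0 < dl <= q -> \sum_(j < n) chi j * chi (j + dl * p) <= K) ->
  q.+1 * \sum_(j < n) chi j <= n + q * p + q.+1 ^ 2 * K.
Proof.
move=> chin pairs.
pose psi (i : 'I_q.+1) t : nat := (i * p <= t) * chi (t - i * p).
have iq (i : 'I_q.+1) : i * p <= q * p by rewrite leq_mul2r -ltnS ltn_ord orbT.
have E1 i : \sum_(t < n + q * p) psi i t = \sum_(j < n) chi j.
  by apply: (@sum_shift (fun j => nat_of_bool (chi j))) => // j /chin ->.
have E2 (i i' : 'I_q.+1) : i < i' -> \sum_(t < n + q * p) psi i t * psi i' t <= K.
  move=> ii'; pose dl := i' - i.
  have ltiq : 0 < dl <= q by rewrite subn_gt0 ii' (leq_trans (leq_subr _ _))// -ltnS.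
  apply: leq_trans (pairs dl ltiq).
  rewrite -(@sum_shift (fun j => chi j * chi (j + dl * p)) n (i' * p) (q * p))//; last first.
    by move=> j /chin ->.
  apply: leq_sum => t _; rewrite /psi; case: (leqP (i' * p) t) => tp; last by rewrite mul0n muln0.
  have -> : t - i' * p + dl * p = t - i * p.
    have : i * p <= i' * p by rewrite leq_mul2r ltnW ?orbT.
    rewrite mulnBl; lia.
  have -> : i * p <= t by apply: leq_trans tp; rewrite leq_mul2r ltnW ?orbT.
  by rewrite !mul1n mulnC.
have -> : q.+1 * \sum_(j < n) chi j = \sum_(t < n + q * p) \sum_i psi i t.
  rewrite [RHS]exchange_big/= [RHS](eq_bigr (fun=> \sum_(j < n) chi j)); last by move=> i _; exact: E1.
  by rewrite sum_nat_const card_ord.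
apply: (@leq_trans (\sum_(t < n + q * p) (1 + \sum_(i : 'I_q.+1) \sum_(i' : 'I_q.+1 | i' != i) psi i t * psi i' t))).
  apply: leq_sum => t _.
  have psi01 i : psi i t * psi i t = psi i t by rewrite /psi mulnb mulnb andbb.
  have : (\sum_i psi i t) * (\sum_i psi i t) = \sum_i psi i t +
      \sum_(i : 'I_q.+1) \sum_(i' : 'I_q.+1 | i' != i) psi i t * psi i' t.
    rewrite big_distrl -big_split/=; apply: eq_bigr => i _.
    by rewrite big_distrr/= (bigD1 i)//= psi01.
  move: (\sum_i psi i t) (\sum_(i : _) _) => g G; nia.
rewrite big_split/= sum_nat_const card_ord muln1 leq_add2l exchange_big/=.
rewrite expnS expn1 -mulnA.
apply: (@leq_trans (\sum_(i < q.+1) (q.+1 * K))); last by rewrite sum_nat_const card_ord.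
apply: leq_sum => i _; rewrite exchange_big/=.
apply: (@leq_trans (\sum_(i' < q.+1 | i' != i) K)); last first.
  by rewrite sum_nat_const leq_mul2r (leq_trans (max_card _)) ?card_ord ?orbT.
apply: leq_sum => i'; rewrite neq_ltn => /orP[|] ii'; last exact: E2.
by rewrite (eq_bigr (fun t : 'I__ => psi i' t * psi i t)) ?E2// => t _; rewrite mulnC.
Qed.

End translates.

(** A difference over [L] steps is a sum of [L] differences over one step, and each of the resulting
    [L] sums telescopes. *)
Lemma telescope_shift {R : realType} (V : nat -> R) (n L : nat) (K : R) :
  (forall j, 0 <= V j) -> (forall j, (j <= n + L)%N -> V j <= K) ->
  \sum_(j < n) (V (j + L)%N - V j) <= L%:R * K.
Proof.
move=> V0; elim: L K => [|L IH] K VK.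
  by rewrite mul0r; apply: sumr_le0 => j _; rewrite addn0 subrr.
rewrite (eq_bigr (fun j : 'I_n => (V (j + L)%N - V j) + (V (j.+1 + L)%N - V (j + L)%N))); last first.
  by move=> j _; rewrite addnS addSn; ring.
rewrite big_split/= -[L.+1%:R]natr1 mulrDl mul1r lerD//.
  by apply: IH => j jn; apply: VK; rewrite addnS leqW.
have -> : \sum_(i < n) (V (i.+1 + L)%N - V (i + L)%N) = V (n + L)%N - V L.
  elim: n {IH VK} => [|n IH]; first by rewrite big_ord0 add0n subrr.
  by rewrite big_ord_recr/= IH; ring.
by rewrite lerBlDr (le_trans (VK _ _)) ?lerDl// leq_add2l.
Qed.

Lemma geometric_small {R : realType} (K r e : R) : 0 <= r -> r < 1 -> 0 <= K -> 0 < e ->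
  exists m0, forall m, (m0 <= m)%N -> K * r ^+ m <= e.
Proof.
move=> r0 r1 K0 e0; move: r0; rewrite le_eqVlt => /predU1P[<-|r0].
  by exists 1%N => -[//|m] _; rewrite expr0n mulr0 ltW.
have [p hp] := @pow_unbounded R r^-1 (K / e) ltac:(by rewrite invf_gt1).
exists p.+1 => m pm; move: hp; rewrite ler_pdivrMr// exprVn => hp.
apply: (@le_trans _ _ (K * r ^+ p.+1)).
  by rewrite ler_wpM2l// ler_wiXn2l// ltW.
by move: hp; rewrite mulrC ler_pdivlMr// exprn_gt0.
Qed.

(* If u = c + W + A vanishes on a non-null set of times, translates by multiples of
   4^m cells produce, at level 6m, many pairs of cells both meeting {u = 0}.  Over each
   of them either W has an increment that is small compared with 4^-m, which is rare,
   or the variation V of A is large, which is rare because V is bounded. *)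
Section nonsticking.
Context {R : realType}.
Variables (M : nat) (u W A V : R -> R) (c C : R).
Hypothesis uE : forall t, 0 <= t -> u t = c + W t + A t.
Hypothesis AV : forall s t, 0 <= s -> s <= t -> `|A t - A s| <= V t - V s.
Hypothesis V_ge0 : forall t, 0 <= t -> 0 <= V t.
Hypothesis modulus : exists m0, forall m, (m0 <= m)%N -> forall j, (j < M.+1 * 2 ^ (6 * m))%N ->
  forall s, grid (6 * m) j <= s <= grid (6 * m) j.+1 ->
  `|W s - W (grid (6 * m) j)| <= C * (3 / 4) ^+ (6 * m).
Hypothesis few_pairs : forall dl, (0 < dl)%N -> exists m0, forall m, (m0 <= m)%N ->
  \sum_(j < M * 2 ^ (6 * m)) (`|W (grid (6 * m) (j + dl * 4 ^ m)) - W (grid (6 * m) j)|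
     <= (2 * C + 1) * (3 / 4) ^+ (6 * m))%R%:R < 2 ^+ (6 * m) * (9 / 10) ^+ m :> R.
Let Z := [set t : R | 0 <= t < M%:R /\ u t = 0].
Hypothesis mZ : measurable Z.

Let V_mono s t : 0 <= s -> s <= t -> V s <= V t.
Proof. by move=> s0 st; rewrite -subr_ge0; apply: le_trans (AV s0 st). Qed.

Let hit k j := `[< exists2 s, grid k j <= s <= grid k j.+1 & u s = 0 >] && (j < M * 2 ^ k)%N.

Let cover k : fine (lebesgue_measure Z) <= (\sum_(j < M * 2 ^ k) hit k j)%N%:R * 2 ^- k.
Proof.
pose I (j : nat) : set R := if hit k j then `[grid k j, grid k j.+1] else set0.
have mI j : measurable (I j) by rewrite /I; case: ifP.
have muI j : lebesgue_measure (I j) = ((hit k j)%:R * 2 ^- k)%:E.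
  rewrite /I; case: ifP => _; last by rewrite measure0 mul0r.
  rewrite lebesgue_measure_itv/= lte_fin.
  have -> : grid k j < grid k j.+1 :> R by rewrite /grid ltr_pM2r ?invr_gt0 ?exprn_gt0// ltr_nat.
  by rewrite -EFinB /grid -mulrBl -[j.+1%:R]natr1 addrAC subrr add0r.
have sub : Z `<=` \big[setU/set0]_(j < M * 2 ^ k) I j.
  move=> t [/andP[t0 tM] ut].
  have p0 : 0 < (2 : R) ^+ k by rewrite exprn_gt0.
  pose j := Num.truncn (t * 2 ^+ k).
  have /andP[h1 h2] := truncn_itv (mulr_ge0 t0 (ltW p0)).
  have jM : (j < M * 2 ^ k)%N.
    by rewrite -(ltr_nat R) (le_lt_trans h1)// natrM natrX ltr_pM2r.
  have g1 : grid k j <= t by rewrite /grid ler_pdivrMr.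
  have g2 : t < grid k j.+1 by rewrite /grid ltr_pdivlMr.
  rewrite -bigcup_mkord; exists j => //.
  rewrite /I; have -> : hit k j.
    by rewrite /hit jM andbT; apply/asboolP; exists t => //; rewrite g1 ltW.
  by rewrite /= in_itv/= g1 ltW.
have le1 : (lebesgue_measure Z <= ((\sum_(j < M * 2 ^ k) hit k j)%N%:R * 2 ^- k)%:E)%E.
  apply: (@le_trans _ _ (lebesgue_measure (\big[setU/set0]_(j < M * 2 ^ k) I j))).
    by rewrite le_measure// ?inE//; apply: bigsetU_measurable => j _; exact: mI.
  apply: (le_trans (Boole_inequality _ _)); first by move=> j _; exact: mI.
  rewrite natr_sum mulr_suml -sumEFin; apply: lee_sum => j _.
  by rewrite le_eqVlt; apply/orP; left; apply/eqP; exact: muI.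
by rewrite -lee_fin fineK// ge0_fin_numE// (le_lt_trans le1)// ltry.
Qed.

Let pair_bound q : exists m0, forall m, (m0 <= m)%N -> forall dl, (0 < dl <= q)%N ->
  (\sum_(j < M * 2 ^ (6 * m)) hit (6 * m) j * hit (6 * m) (j + dl * 4 ^ m))%N%:R <=
  2 ^+ (6 * m) * ((9 / 10) ^+ m * (1 + q.+1%:R * V M.+1%:R)) :> R.
Proof.
have [m0 mod0] := modulus.
have : exists m1, forall m, (m1 <= m)%N -> forall dl, (0 < dl <= q)%N ->
    \sum_(j < M * 2 ^ (6 * m)) (`|W (grid (6 * m) (j + dl * 4 ^ m)) - W (grid (6 * m) j)|
     <= (2 * C + 1) * (3 / 4) ^+ (6 * m))%R%:R < 2 ^+ (6 * m) * (9 / 10) ^+ m :> R.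
  elim: (q) => [|q' [m1 IH]]; first by exists 0%N => m _ dl /andP[/lt0n_neq0 + dl0]; case: dl dl0.
  have [m2 H2] := @few_pairs q'.+1 isT; exists (maxn m1 m2) => m.
  rewrite geq_max => /andP[mm1 mm2] dl /andP[dl0]; rewrite leq_eqVlt => /predU1P[->|dlq].
    exact: H2.
  by apply: IH => //; rewrite dl0.
move=> [m1 fp].
exists (maxn (maxn m0 m1) q.+1) => m; rewrite !geq_max => /andP[/andP[mm0 mm1] mq] dl dlq.
set k := (6 * m)%N.
have p0 : 0 < (2 : R) ^+ k by rewrite exprn_gt0.
have r0 : 0 < (3 / 4 : R) ^+ k by rewrite exprn_gt0//; lra.
(* The successor makes the span from [grid k j] to [grid k (j + L)] contain the whole of the second
   cell. *)
pose L := (dl * 4 ^ m).+1.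
have Lq : (L <= q.+1 * 4 ^ m)%N.
  rewrite /L mulSn; apply: (@leq_trans (q * 4 ^ m).+1).
    by rewrite ltnS leq_mul2r; move: dlq => /andP[_ ->]; rewrite orbT.
  by rewrite -add1n leq_add2r expn_gt0.
have Lk : (L <= 2 ^ k)%N.
  apply: (leq_trans Lq); rewrite /k expnM (_ : (2 ^ 6 = 16 * 4)%N)// expnMn leq_mul2r.
  apply/orP; right; apply: (leq_trans mq); apply: (leq_trans (ltnW (ltn_expl m (ltnSn 1)))).
  by rewrite leq_exp2r ?(leq_trans _ mq).
have V0 : 0 <= V M.+1%:R by exact: V_ge0.
have gM j : (j <= M.+1 * 2 ^ k)%N -> grid k j <= M.+1%:R :> R.
  by move=> jM; rewrite /grid ler_pdivrMr// -natrX -natrM ler_nat.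
pose far j : R := (V (grid k (j + L)) - V (grid k j)) / (3 / 4) ^+ k.
have far0 j : 0 <= far j.
  apply: divr_ge0; last exact: ltW.
  by rewrite subr_ge0; apply: V_mono; rewrite ?grid_ge0// grid_le// leq_addr.
(* Between two zeros of [u] the increments of [W] and [A] cancel. Replacing the zeros by grid points
   costs [C (3/4)^k] twice, and the variation of [A] is at most [(3/4)^k] unless [far j >= 1]. *)
pose close j : bool := `|W (grid k (j + dl * 4 ^ m)) - W (grid k j)| <= (2 * C + 1) * (3 / 4) ^+ k.
have pair_le j : (j < M * 2 ^ k)%N ->
    (hit k j * hit k (j + dl * 4 ^ m))%N%:R <= (close j)%:R + far j.
  move=> jM; case: (boolP (hit k j && hit k (j + dl * 4 ^ m))); last first.
    by rewrite mulnb => /negbTE ->; rewrite addr_ge0.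
  move=> hh; have := hh; rewrite mulnb => ->.
  move: hh => /andP[/andP[/asboolP[s /andP[s1 s2] us] _] /andP[/asboolP[s' /andP[s'1 s'2] us'] jM']].
  set j' := (j + dl * 4 ^ m)%N in s'1 s'2 jM' *.
  have jj' : (j.+1 <= j')%N by rewrite -addn1 leq_add2l muln_gt0 expn_gt0 andbT; case/andP: dlq.
  have MM i : (i < M * 2 ^ k)%N -> (i < M.+1 * 2 ^ k)%N.
    by move=> /leq_trans; apply; rewrite leq_mul2r leqnSn orbT.
  have s0 : 0 <= s := le_trans (grid_ge0 k j) s1.
  have ss' : s <= s' by apply: (le_trans s2); apply: le_trans s'1; exact: grid_le.
  have m1' := mod0 m mm0 j (MM _ jM) s; rewrite s1 s2 in m1'; have {}m1' := m1' isT.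
  have m2' := mod0 m mm0 j' (MM _ jM') s'; rewrite s'1 s'2 in m2'; have {}m2' := m2' isT.
  have av := AV s0 ss'.
  have va : V s' <= V (grid k (j + L)).
    by apply: V_mono; [exact: le_trans ss'|apply: (le_trans s'2); rewrite grid_le// /L addnS].
  have vb : V (grid k j) <= V s by apply: V_mono; rewrite ?grid_ge0.
  have e1 := uE s0; have e2 := uE (le_trans s0 ss'); rewrite us in e1; rewrite us' in e2.
  have [h|h] := lerP (V (grid k (j + L)) - V (grid k j)) ((3 / 4) ^+ k).
    have -> : close j.
      rewrite /close -/j'.
      have -> : W (grid k j') - W (grid k j) =
        (W s - W (grid k j)) - (W s' - W (grid k j')) - (A s' - A s) by lra.
      apply: (le_trans (ler_normB _ _)); apply: (le_trans (lerD (ler_normB _ _) (lexx _))).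
      rewrite -/k in m1' m2'; lra.
    by rewrite lerDl.
  rewrite -[leLHS]add0r lerD//.
  by rewrite /far ler_pdivlMr// mul1r ltW.
rewrite natr_sum; apply: (@le_trans _ _ (\sum_(j < M * 2 ^ k) ((close j)%:R + far j))).
  by apply: ler_sum => j _; exact: pair_le.
rewrite big_split/= mulrDr mulr1 mulrDr lerD//; first by apply: ltW; exact: fp.
have tel : \sum_(j < M * 2 ^ k) (V (grid k (j + L)) - V (grid k j)) <= L%:R * V M.+1%:R.
  apply: (@telescope_shift _ (fun j => V (grid k j))) => [j|j jn].
    by apply: V_ge0; exact: grid_ge0.
  apply: V_mono; first exact: grid_ge0.
  by apply: gM; apply: (leq_trans jn); rewrite mulSn addnC leq_add2r.
rewrite /far -mulr_suml ler_pdivrMr//; apply: (le_trans tel).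
have -> : 2 ^+ k * ((9 / 10) ^+ m * (q.+1%:R * V M.+1%:R)) * (3 / 4) ^+ k =
  q.+1%:R * (2 ^+ k * (9 / 10) ^+ m * (3 / 4) ^+ k) * V M.+1%:R by ring.
rewrite ler_wpM2r//.
apply: (@le_trans _ _ (q.+1 * 4 ^ m)%:R); first by rewrite ler_nat.
rewrite natrM ler_wpM2l// natrX.
(* The total variation counted with multiplicity is of order [4^m]. Divided by the threshold
   [(3/4)^(6m)], it must stay below [2^(6m) (9/10)^m]. *)
have e6 : 4 <= (2 : R) ^+ 6 * (9 / 10) * (3 / 4) ^+ 6.
  rewrite [2 ^+ 6](_ : _ = 64); last by ring.
  by rewrite !exprS expr0; lra.
have -> : 2 ^+ k * (9 / 10) ^+ m * (3 / 4) ^+ k = ((2 : R) ^+ 6 * (9 / 10) * (3 / 4) ^+ 6) ^+ m.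
  by rewrite /k [2 ^+ _]exprM [(3 / 4) ^+ _]exprM -2!exprMn.
by rewrite lerXn2r ?nnegrE//; apply: le_trans e6.
Qed.

Lemma nonsticking : lebesgue_measure Z = 0%E.
Proof.
have fZ : lebesgue_measure Z = (fine (lebesgue_measure Z))%:E.
  rewrite fineK// ge0_fin_numE//.
  apply: (@le_lt_trans _ _ (lebesgue_measure `[0, M%:R : R]%classic)).
    rewrite le_measure// ?inE// => t [/andP[t0 tM] _].
    by rewrite /= in_itv/= t0 ltW.
  by rewrite lebesgue_measure_itv/=; case: ifP; rewrite ?ltry// -EFinB ltry.
have z0 : 0 <= fine (lebesgue_measure Z) by rewrite fine_ge0.
rewrite fZ; set z := fine _ in z0 fZ *.
(* The [q + 1] translates fit in a window only slightly longer than [M] and overlap negligibly. The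
   surplus 1 absorbs, at a fine level, the extra length of the window and the overlaps, both small
   by a factor [(9/10)^m]. *)
suff key q : q.+1%:R * z <= M%:R + 1.
  apply/eqP; rewrite eqe eq_le z0 andbT leNgt; apply/negP => zp.
  have := key (Num.truncn ((M%:R + 1) / z)); apply/negP; rewrite -ltNge.
  by rewrite -ltr_pdivrMr// truncnS_gt.
have [m0 pb] := pair_bound q.
have V0 : 0 <= V M.+1%:R by exact: V_ge0.
pose K : R := q%:R + q.+1%:R ^+ 2 * (1 + q.+1%:R * V M.+1%:R).
have K0 : 0 <= K by rewrite addr_ge0// mulr_ge0 ?sqr_ge0// addr_ge0// mulr_ge0.
have [m1 small] := @geometric_small R K (9 / 10) 1 ltac:(lra) ltac:(lra) K0 ltac:(lra).
pose m := maxn m0 m1; pose k := (6 * m)%N.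
have p0 : 0 < (2 : R) ^+ k by rewrite exprn_gt0.
pose bd : R := 2 ^+ k * ((9 / 10) ^+ m * (1 + q.+1%:R * V M.+1%:R)).
have r0 : 0 <= (9 / 10 : R) ^+ m by rewrite exprn_ge0//; lra.
have bd0 : 0 <= bd by rewrite !mulr_ge0 ?(ltW p0)// addr_ge0// mulr_ge0.
have := @translates_count (hit k) (M * 2 ^ k) (4 ^ m) q (Num.truncn bd).
have h1 j : (M * 2 ^ k <= j)%N -> hit k j = false by move=> h; rewrite /hit ltnNge h andbF.
have h2 dl : (0 < dl <= q)%N ->
  (\sum_(j < M * 2 ^ k) hit k j * hit k (j + dl * 4 ^ m) <= Num.truncn bd)%N.
  by move=> dq; rewrite truncn_ge_nat//; apply: pb dq; exact: leq_maxl.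
move=> /(_ h1 h2); rewrite -(ler_nat R) natrM natrD natrD (natrM _ M) (natrM _ q) (natrM _ (q.+1 ^ 2)) !natrX => h3.
have h4 := cover k; rewrite -/z in h4.
have h5 : (Num.truncn bd)%:R <= bd by rewrite truncn_le.
have h6 : (4 : R) ^+ m <= 2 ^+ k * (9 / 10) ^+ m.
  have e6 : (2 : R) ^+ 6 = 64 by ring.
  by rewrite /k exprM -exprMn e6 lerXn2r ?nnegrE//; lra.
set S : R := (\sum_(j < M * 2 ^ k) hit k j)%N%:R in h3 h4.
rewrite -(ler_pM2r p0).
have h7 : q.+1%:R * z * 2 ^+ k <= q.+1%:R * S.
  by rewrite -mulrA ler_wpM2l// -ler_pdivlMr.
apply: (le_trans h7); apply: (le_trans h3).
have h8 : q%:R * 4 ^+ m <= q%:R * (2 ^+ k * (9 / 10) ^+ m) :> R by rewrite ler_wpM2l.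
have h9 : q.+1%:R ^+ 2 * (Num.truncn bd)%:R <= q.+1%:R ^+ 2 * bd by rewrite ler_wpM2l// sqr_ge0.
have := small m (leq_maxr _ _) => /(ler_wpM2l (ltW p0)).
have -> : 2 ^+ k * (K * (9 / 10) ^+ m) = q%:R * (2 ^+ k * (9 / 10) ^+ m) + q.+1%:R ^+ 2 * bd.
  by rewrite /K /bd; ring.
move: h8 h9; move: (2 ^+ k) (q%:R * _) (q%:R * _) (_ * _%:R) (_ * bd) => a b1 b2 b3 b4.
lra.
Qed.

End nonsticking.

(** * Pathwise convergence and counting *)

Lemma le_Rintegral_ae {d} {T : measurableType d} {R : realType} (mu : {measure set T -> \bar R})
    (D N : set T) (f g : T -> R) : measurable D -> measurable N -> mu N = 0%E ->
  rint mu D f -> rint mu D g -> (forall x, D x -> ~ N x -> f x <= g x) ->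
  \int[mu]_(x in D) f x <= \int[mu]_(x in D) g x.
Proof.
move=> mD mN N0 rf rg fg.
have E (h : T -> R) : rint mu D h -> \int[mu]_(x in D) h x = \int[mu]_(x in D `\` N) h x.
  by move=> rh; rewrite /Rintegral (negligible_integral mN mD rh N0).
have mDN : measurable (D `\` N) by exact: measurableD.
rewrite (E _ rf) (E _ rg); apply: le_Rintegral => //.
- by apply: integrableS rf => //; exact: subDsetl.
- by apply: integrableS rg => //; exact: subDsetl.
- by move=> x [Dx Nx]; exact: fg.
Qed.

Lemma cts_nonneg_measurable {R : realType} (f : R -> R) : cts_nonneg f ->
  measurable_fun setT (fun t : R => f (Num.max t 0)).
Proof.
move=> cf; apply: continuous_measurable_fun => t.
apply/cvgrPdist_lt => e e0.
have t0 : 0 <= Num.max t 0 by rewrite le_max lexx orbT.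
have [dl dl0 cdl] := cf _ t0 e e0.
apply/nbhs_ballP; exists dl => //= s; rewrite /ball/= => ts.
rewrite distrC; apply: cdl; first by rewrite le_max lexx orbT.
apply: le_lt_trans ts; rewrite distrC.
have max_le (x y : R) : Num.max x 0 - Num.max y 0 <= `|x - y|.
  rewrite lerBlDr ge_max addr_ge0 ?le_max ?lexx ?orbT// andbT.
  have : y <= Num.max y 0 by rewrite le_max lexx.
  have := ler_norm (x - y); lra.
rewrite ler_norml max_le andbT lerNl opprB distrC; exact: max_le.
Qed.

(** Implicit form of the increment of a square: the difference is paired with the new point [p],
    where the scheme evaluates its drift. *)
Lemma dotv_sqr_step {R : realType} {N : nat} (p q : 'rV[R]_N) :
  dotv p p <= dotv q q + 2 * dotv p (p - q).
Proof. by have := dotv_ge0 (p - q); rewrite !(dotvBl, dotvBr) (dotvC q p); lra. Qed.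

(** * Comparison of a path with its Euler scheme *)

Section bessel_path.
Context {R : realType} {N : nat} {I : finType}.
Variables (al : I -> 'rV[R]_N) (kk : I -> R) (v x : 'rV[R]_N) (b X : R -> 'rV[R]_N) (M : nat).
Hypothesis kk_gt0 : forall p, 0 < kk p.
Hypothesis Wv : chamber al v.
Hypothesis b0 : b 0 = 0.
Hypothesis x_ge0 : forall p, 0 <= dotv (al p) x.
Hypothesis X_ge0 : forall t, 0 <= t -> forall p, 0 <= dotv (al p) (X t).
Local Notation leb := (@lebesgue_measure R).
Local Notation drift := (rdrift al kk).
Hypothesis drift_int : forall t, 0 <= t -> forall i,
  leb.-integrable `[0, t] (fun s => (drift (X s) ord0 i)%:E).
Hypothesis XE : forall t, 0 <= t -> X t = x + b t +
  \row_i Rintegral leb `[0, t] (fun s => drift (X s) ord0 i).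

Let dr u s := dotv u (drift (X s)).

Let rint_dr0 u t : 0 <= t -> rint leb `[0, t] (dr u).
Proof.
move=> t0; have mD : measurable (`[0, t]%classic : set R) by exact: measurable_itv.
apply: (@rint_sum _ _ _ leb _ mD _ _ _ (fun i s => u ord0 i * drift (X s) ord0 i)) => i _.
exact: (@rintZl _ _ _ leb _ mD (u ord0 i) (fun s => drift (X s) ord0 i) (drift_int t0 i)).
Qed.

Let rint_dr u s t : 0 <= s -> s <= t -> rint leb `]s, t] (dr u).
Proof.
move=> s0 st; apply: integrableS (rint_dr0 u (le_trans s0 st)) => // r.
by rewrite /= !in_itv/= => /andP[sr ->]; rewrite (le_trans s0 (ltW sr)).
Qed.

Lemma drift_increment u s t : 0 <= s -> s <= t ->
  dotv u ((X t - b t) - (X s - b s)) = \int[leb]_(r in `]s, t]) dr u r.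
Proof.
move=> s0 st.
have E r : 0 <= r -> dotv u (X r - b r) = dotv u x + \int[leb]_(q in `[0, r]) dr u q.
  move=> r0; rewrite (XE r0) addrAC addrK dotvDr; congr (_ + _).
  have mD : measurable (`[0, r]%classic : set R) by exact: measurable_itv.
  rewrite (@Rint_sum _ _ _ leb _ mD _ _ _ (fun i s => u ord0 i * drift (X s) ord0 i)); last first.
    move=> i _.
    exact: (@rintZl _ _ _ leb _ mD (u ord0 i) (fun s => drift (X s) ord0 i) (drift_int r0 i)).
  apply: eq_bigr => i _; rewrite mxE; apply/esym.
  exact: (@RintegralZl _ _ _ leb _ (fun s => drift (X s) ord0 i) (u ord0 i) mD (drift_int r0 i)).
rewrite dotvBr (E _ s0) (E _ (le_trans s0 st)) opprD addrACA subrr add0r.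
by apply: Rintegral_itvB; rewrite ?bnd_simp//; exact: rint_dr0 (le_trans s0 st).
Qed.

(** Here [A] is the integrated drift in the direction [al q], and [V] its total variation, finite
    since the drift along [X] is integrable. *)
Lemma path_nonsticking (q : I) (C : R) :
  (forall i, cts_nonneg (fun t => X t ord0 i)) ->
  (exists m0, forall m, (m0 <= m)%N -> forall j, (j < M.+1 * 2 ^ (6 * m))%N ->
    forall s, grid (6 * m) j <= s <= grid (6 * m) j.+1 ->
    `|dotv (al q) (b s) - dotv (al q) (b (grid (6 * m) j))| <= C * (3 / 4) ^+ (6 * m)) ->
  (forall dl, (0 < dl)%N -> exists m0, forall m, (m0 <= m)%N ->
    \sum_(j < M * 2 ^ (6 * m)) (`|dotv (al q) (b (grid (6 * m) (j + dl * 4 ^ m))) -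
        dotv (al q) (b (grid (6 * m) j))| <= (2 * C + 1) * (3 / 4) ^+ (6 * m))%R%:R
      < 2 ^+ (6 * m) * (9 / 10) ^+ m :> R) ->
  measurable [set t | 0 <= t < M%:R /\ dotv (al q) (X t) = 0] /\
  leb [set t | 0 <= t < M%:R /\ dotv (al q) (X t) = 0] = 0%E.
Proof.
move=> cX modb pairs.
have mZ : measurable [set t | 0 <= t < M%:R /\ dotv (al q) (X t) = 0].
  have mu : measurable_fun setT (fun t : R => dotv (al q) (X (Num.max t 0))).
    apply: measurable_sum => i; apply: measurable_funM; first exact: measurable_cst.
    exact: cts_nonneg_measurable (cX i).
  rewrite (_ : [set t | _] = `[0, M%:R[%classic `&`
      (setT `&` (fun t : R => dotv (al q) (X (Num.max t 0))) @^-1` [set 0])).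
    by apply: measurableI; [exact: measurable_itv|exact: mu].
  apply/seteqP; split => [t [/andP[t0 tM] ut]|t [+ [_ /=]]].
    by split; [rewrite /= in_itv/= t0|split => //=; rewrite max_l].
  by rewrite /= in_itv/= => /andP[t0 tM]; rewrite max_l// t0.
split=> //.
pose V t := \int[leb]_(r in `[0, t]) `|dr (al q) r|.
apply: (@nonsticking R M (fun t => dotv (al q) (X t)) (fun t => dotv (al q) (b t))
  (fun t => dotv (al q) (X t - b t - x)) V (dotv (al q) x) C _ _ _ modb pairs mZ).
- by move=> t t0; rewrite -!dotvDr; congr dotv; apply/rowP => i; rewrite !mxE; ring.
- move=> s t s0 st.
  have -> : dotv (al q) (X t - b t - x) - dotv (al q) (X s - b s - x) =
      \int[leb]_(r in `]s, t]) dr (al q) r.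
    by rewrite -drift_increment// -dotvBr; congr dotv; apply/rowP => i; rewrite !mxE; ring.
  rewrite /V Rintegral_itvB ?bnd_simp//; last first.
    exact: (rint_norm (rint_dr0 (al q) (le_trans s0 st))).
  have mD : measurable (`]s, t]%classic : set (measurableTypeR R)) by exact: measurable_itv.
  apply: (le_normr_Rintegral mD).
  exact: rint_dr.
- by move=> t t0; apply: Rintegral_ge0 => r _; exact: normr_ge0.
Qed.

Hypothesis nonsticking : forall p, leb [set t | 0 <= t < M%:R /\ dotv (al p) (X t) = 0] = 0%E.
Hypothesis mhit : forall p, measurable [set t | 0 <= t < M%:R /\ dotv (al p) (X t) = 0].

(** The endpoint [M] is included because the hitting sets are taken over [[0, M)]. *)
Let bad : set R := [set t | (exists p, 0 <= t < M%:R /\ dotv (al p) (X t) = 0) \/ t = M%:R].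

Let mbad : measurable bad.
Proof.
rewrite (_ : bad = \bigcup_(p in [set: I]) [set t | 0 <= t < M%:R /\ dotv (al p) (X t) = 0] `|`
  [set M%:R]).
  by apply: measurableU => //; apply: fin_bigcup_measurable.
by apply/seteqP; split => t /= [[p h]|->]; [left; exists p|right|left; case: h; exists p|right].
Qed.

Let bad0 : leb bad = 0%E.
Proof.
apply: (proj1 (@negligibleP _ _ _ leb _ mbad)); pose Zp p : set R := [set t | 0 <= t < M%:R /\ dotv (al p) (X t) = 0].
apply: (@negligibleS _ _ _ leb (\big[setU/set0]_p Zp p `|` [set M%:R])).
  by move=> t [[p h]|->]; [left; rewrite (bigD1 p)//=; left|right].
apply: negligibleU; last first.
  by apply: (proj2 (@negligibleP _ _ _ leb _ _)); [exact: measurable_set1|exact: lebesgue_measure_set1].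
elim/big_ind: _ => [||p _]; [exact: negligible_set0|move=> A B; exact: negligibleU|].
by apply: (proj2 (@negligibleP _ _ _ leb _ _)); [exact: mhit|exact: nonsticking].
Qed.

Let good t : 0 <= t <= M%:R -> ~ bad t -> chamber al (X t).
Proof.
move=> /andP[t0 tM] nb p; rewrite lt_neqAle X_ge0// andbT eq_sym; apply/eqP => h.
apply: nb; move: tM; rewrite le_eqVlt => /predU1P[->|tM]; [by right|left].
by exists p; rewrite t0.
Qed.

Let Y n j := euler al kk x b n j.

Let h_gt0 n : 0 < (2 : R) ^- n. Proof. by rewrite invr_gt0 exprn_gt0. Qed.

Let YW n j : chamber al (Y n j.+1).
Proof. exact: (resolventP _ kk_gt0 Wv (h_gt0 n)).1. Qed.

Let YE n j : Y n j.+1 = Y n j + (b (grid n j.+1) - b (grid n j)) + 2 ^- n *: drift (Y n j.+1).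
Proof. exact: (resolventP _ kk_gt0 Wv (h_gt0 n)).2. Qed.

Lemma euler_ge0 n j p : 0 <= dotv (al p) (Y n j).
Proof. by case: j => [|j]; [exact: x_ge0|exact: ltW (YW n j p)]. Qed.

Variable C : R.
Hypothesis C_ge0 : 0 <= C.
Hypothesis drift_le : forall y, chamber al y -> nrm (drift y) <= C * dotv v (drift y).

(* On the boundary division by zero removes the singular terms from the drift, which is
   then no longer monotone: the comparison needs X to avoid the boundary almost everywhere. *)
Lemma scheme_error_sum n om m : 0 <= om -> (m <= M * 2 ^ n)%N ->
  (forall j, (j < M * 2 ^ n)%N -> forall s, grid n j <= s <= grid n j.+1 ->
     nrm (X (grid n j.+1) - X s) <= om) ->
  dotv (X (grid n m) - Y n m) (X (grid n m) - Y n m) <=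
  2 * om * C * (dotv v (X (grid n m) - b (grid n m) - x) + dotv v (Y n m - b (grid n m) - x)).
Proof.
move=> om0 mM modX; elim: m mM => [_|m IH mM].
  have -> : grid n 0 = 0 :> R by rewrite /grid mul0r.
  have -> : X 0 = x.
    rewrite (XE (lexx 0)) b0 addr0 [X in _ + X](_ : _ = 0) ?addr0//.
    by apply/rowP => i; rewrite !mxE set_itv1 Rintegral_set1.
  by rewrite b0 /Y /euler/= !subr0 subrr !dotv0r addr0 mulr0.
have {}IH := IH (ltnW mM).
set t : R := grid n m.+1; set s : R := grid n m; set h : R := 2 ^- n.
have s0 : 0 <= s by exact: grid_ge0.
have hE : t - s = h by rewrite /t /s /grid -[m.+1%:R]natr1; rewrite /h; ring.
have st : s <= t by exact: grid_le.
have tM : t <= M%:R by rewrite /t /grid ler_pdivrMr ?exprn_gt0// -natrX -natrM ler_nat.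
set e := X t - Y n m.+1; set e' := X s - Y n m; set y := Y n m.+1.
have Wy : chamber al y by exact: YW.
have yE : y = Y n m + (b t - b s) + h *: drift y := YE n m.
have mD : measurable (`]s, t]%classic : set (measurableTypeR R)) by exact: measurable_itv.
have mumu : leb `]s, t]%classic = h%:E.
  rewrite lebesgue_measure_itv/= lte_fin ltNge -subr_le0 hE -ltNge h_gt0/=.
  by rewrite -EFinB hE.
have rc (c : R) : rint leb `]s, t] (fun=> c).
  apply/integrableP; split; first exact: measurable_cst.
  rewrite (_ : (fun _ => _) = cst `|c|%:E); last by apply/funext.
  rewrite integral_cst//; apply: (@le_lt_trans _ _ (`|c|%:E * h%:E)%E); last by rewrite -EFinM ltry.
  by rewrite le_eqVlt; apply/orP; left; apply/eqP; congr (_ * _)%E; exact: mumu.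
have ic (c : R) : \int[leb]_(r in `]s, t]) c = h * c.
  rewrite Rintegral_cst// mulrC; congr (_ * _).
  by have -> : h = fine h%:E by []; congr fine; exact: mumu.
have i1 : \int[leb]_(r in `]s, t]) (dr e r - dotv e (drift y)) = dotv e (e - e').
  rewrite (RintegralB mD (rint_dr e s0 st) (rc _)) ic -drift_increment//.
  have -> : e - e' = ((X t - b t) - (X s - b s)) - h *: drift y.
    rewrite /e /e' -/y {1}yE.
    by move: (X t) (X s) (b t) (b s) (Y n m) (h *: _) => p1 p2 p3 p4 p5 p6; apply/rowP => i; rewrite !mxE; ring.
  by rewrite [RHS]dotvBr dotvZr.
have i2 : \int[leb]_(r in `]s, t]) (om * C * (dr v r + dotv v (drift y))) =
   om * C * (dotv v ((X t - b t) - (X s - b s)) + h * dotv v (drift y)).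
  rewrite (RintegralZl _ mD (rintD mD (rint_dr v s0 st) (rc _))).
  by rewrite (RintegralD mD (rint_dr v s0 st) (rc _)) ic -drift_increment.
(* The constant part of the drift of [Y] on the step is compared with the drift of [X] at every time
   of the step. What dissipativity leaves is at most [om] times the norms of the two drifts, and
   [drift_le] turns these into increments of [dotv v], which add up over the steps. *)
have le1 : dotv e (e - e') <= om * C * (dotv v ((X t - b t) - (X s - b s)) + h * dotv v (drift y)).
  rewrite -i1 -i2; apply: (le_Rintegral_ae mD mbad bad0).
  - exact: (rintB mD (rint_dr e s0 st) (rc _)).
  - exact: (rintZl mD _ (rintD mD (rint_dr v s0 st) (rc _))).
  move=> r; rewrite /= in_itv/= => /andP[sr rt] nb.
  have Wr : chamber al (X r).
    by apply: good => //; rewrite (le_trans s0 (ltW sr)) (le_trans rt).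
  have om1 : nrm (X t - X r) <= om by apply: (modX m mM); rewrite (ltW sr).
  rewrite /dr -dotvBr.
  have -> : e = (X r - y) + (X t - X r) by rewrite [RHS]addrC addrA subrK.
  rewrite dotvDl; have := rdrift_dissipative kk_gt0 Wr Wy.
  have : dotv (X t - X r) (drift (X r) - drift y) <= om * C * (dotv v (drift (X r)) + dotv v (drift y)).
    apply: le_trans (dotv_le _ _) _; rewrite -mulrA; apply: ler_pM; rewrite ?nrm_ge0//.
    apply: le_trans (nrmD _ _) _; rewrite nrmN mulrDr; apply: lerD; exact: drift_le.
  lra.
have E : dotv e e <= dotv e' e' + 2 * dotv e (e - e') := dotv_sqr_step e e'.
have yS : dotv v (y - b t - x) = dotv v (Y n m - b s - x) + h * dotv v (drift y).
  rewrite {1}yE -dotvZr -dotvDr; congr (dotv _ _).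
  by move: (b t) (b s) (Y n m) (h *: _) => p1 p2 p3 p4; apply/rowP => i; rewrite !mxE; ring.
rewrite -/e -/y yS.
have xS : dotv v (X t - b t - x) = dotv v (X s - b s - x) + dotv v ((X t - b t) - (X s - b s)).
  by rewrite -dotvDr; congr (dotv _ _); apply/rowP => i; rewrite !mxE; ring.
rewrite xS.
apply: (le_trans E); rewrite -/s -/e' in IH.
have := lerD IH (ler_wpM2l (ler0n R 2) le1) => /le_trans; apply.
by rewrite le_eqVlt; apply/orP; left; apply/eqP; ring.
Qed.


Hypothesis cX : forall i, cts_nonneg (fun t => X t ord0 i).

Let grid_in n j : (j <= M * 2 ^ n)%N -> grid n j <= M%:R :> R.
Proof. by move=> jM; rewrite /grid ler_pdivrMr ?exprn_gt0// -natrX -natrM ler_nat. Qed.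

Lemma path_uniform e : 0 < e -> exists n0, forall n, (n0 <= n)%N ->
  forall j, (j < M * 2 ^ n)%N -> forall s, grid n j <= s <= grid n j.+1 ->
  nrm (X (grid n j.+1) - X s) <= e.
Proof.
move=> e0; have e1 : 0 < e / N.+1%:R by rewrite divr_gt0.
have H i : exists n0, forall n, (n0 <= n)%N ->
    forall j, (j < M * 2 ^ n)%N -> forall s, grid n j <= s <= grid n j.+1 ->
    `|X (grid n j.+1) ord0 i - X s ord0 i| <= e / N.+1%:R.
  have [dl dl0 cdl] := cts_nonneg_uniform M%:R (cX i) e1.
  have [n0 hn0] := @geometric_small R 1 2^-1 (dl / 2) ltac:(lra) ltac:(lra) ltac:(lra) ltac:(lra).
  exists n0 => n nn j jM s /andP[s1 s2].
  have s0 : 0 <= s := le_trans (grid_ge0 n j) s1.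
  have gM := grid_in jM.
  apply/ltW/cdl; first by rewrite grid_ge0.
    by rewrite s0 (le_trans s2).
  have := hn0 n nn; rewrite mul1r exprVn.
  have : grid n j.+1 - grid n j = 2 ^- n :> R by rewrite /grid -[j.+1%:R]natr1; ring.
  rewrite ger0_norm ?subr_ge0//; lra.
exists (\max_(i < N) projT1 (cid (H i)))%N => n nn j jM s sj.
apply: (le_trans (nrm_le_sum _)).
apply: (@le_trans _ _ (\sum_(i < N) e / N.+1%:R)).
  apply: ler_sum => i _; rewrite !mxE; apply: (projT2 (cid (H i))) => //.
  by apply: leq_trans nn; exact: (@leq_bigmax _ (fun i => projT1 (cid (H i)))).
rewrite sumr_const card_ord -[leLHS]mulr_natl mulrA ler_pdivrMr// mulrC ler_wpM2l ?(ltW e0)//.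
by rewrite ler_nat.
Qed.

Let K := dotv v (X M%:R - b M%:R - x).

(** The drift pairs nonnegatively with the interior point [v], so the drift part of [dotv v (X t)]
    is nondecreasing in time. *)
Let dotA_le t : 0 <= t -> t <= M%:R -> dotv v (X t - b t - x) <= K.
Proof.
move=> t0 tM; rewrite -subr_ge0 /K -dotvBr.
have -> : X M%:R - b M%:R - x - (X t - b t - x) = (X M%:R - b M%:R) - (X t - b t).
  by apply/rowP => i; rewrite !mxE; ring.
rewrite drift_increment//; apply: Rintegral_ge0 => s; rewrite /= in_itv/= => /andP[ts sM].
rewrite /dr dot_rdrift; apply: sumr_ge0 => p _.
by rewrite divr_ge0 ?X_ge0 ?(le_trans t0 (ltW ts))// mulr_ge0 ?(ltW (kk_gt0 p)) ?(ltW (Wv p)).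
Qed.

(** In [scheme_error_sum] the term in [Y] is itself bounded by the term in [X] and the error [E],
    which yields [E^2 <= 2 om C (2 K + |v| E)]. If [E > e], then [2 K <= (2 K / e) E], and dividing
    by [E] contradicts the choice of [om]. *)
Lemma scheme_cvg e : 0 < e -> exists n0, forall n, (n0 <= n)%N ->
  forall m, (m <= M * 2 ^ n)%N -> nrm (X (grid n m) - Y n m) <= e.
Proof.
move=> e0.
have K0 : 0 <= K.
  have X0 : X 0 = x.
    rewrite (XE (lexx 0)) b0 addr0 [X in _ + X](_ : _ = 0) ?addr0//.
    by apply/rowP => i; rewrite !mxE set_itv1 Rintegral_set1.
  have := @dotA_le 0 (lexx 0) (ler0n _ _); by rewrite X0 b0 subr0 subrr dotv0r.
have nv := nrm_ge0 v.
pose L := 2 * C * (2 * K / e + nrm v).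
have L0 : 0 <= L by rewrite !mulr_ge0// addr_ge0// divr_ge0// ?mulr_ge0// ltW.
pose om := e / (L + 1).
have om0 : 0 < om by rewrite divr_gt0//; lra.
have [n0 hn0] := path_uniform om0.
exists n0 => n nn m mM; set E := nrm _; rewrite leNgt; apply/negP => Ee.
have := scheme_error_sum (ltW om0) mM (hn0 n nn).
rewrite -sqr_nrm -/E.
have a1 : dotv v (X (grid n m) - b (grid n m) - x) <= K by apply: dotA_le; rewrite ?grid_ge0 ?grid_in.
have a2 : dotv v (Y n m - b (grid n m) - x) <= K + nrm v * E.
  have -> : Y n m - b (grid n m) - x = (X (grid n m) - b (grid n m) - x) - (X (grid n m) - Y n m).
    by apply/rowP => i; rewrite !mxE; ring.
  rewrite dotvBr lerD// lerNl; have := dotv_le_nrm v (X (grid n m) - Y n m).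
  by rewrite -/E ler_norml => /andP[].
have omC : 0 <= 2 * om * C.
  by apply: mulr_ge0 => //; apply: mulr_ge0 => //; exact: ltW.
move=> h.
have {}h : E ^+ 2 <= 2 * om * C * (2 * K + nrm v * E).
  by apply: (le_trans h); rewrite ler_wpM2l//; lra.
have h2 : 2 * om * C * (2 * K + nrm v * E) <= om * L * E.
  rewrite /L.
  have : 2 * K <= 2 * K / e * E.
    by rewrite mulrAC ler_pdivlMr// ler_wpM2l ?mulr_ge0// ltW.
  move=> /(ler_wpM2l omC); lra.
have h3 : om * L < e by rewrite /om mulrAC ltr_pdivrMr; lra.
have E0 : 0 < E by apply: lt_trans Ee.
have : E ^+ 2 <= om * L * E by apply: le_trans h2.
rewrite expr2 ler_pM2r// => h4; lra.
Qed.

(** Let [S] be the displacement of [Y] with the noise removed. By [dot_rdrift_le], applied with the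
    fixed point [Y n l], a step increases [dotv S S] by at most [2 h] times [\sum_p kk p] plus
    [om C] times [dotv v] of the drift. The second part sums to [dotv v S <= |v| |S|], and the
    quadratic inequality in [|S|] is solved. *)
Lemma scheme_modulus n om l m : (l <= m)%N -> 0 <= om ->
  (forall j, (l <= j <= m)%N -> nrm (b (grid n j) - b (grid n l)) <= om) ->
  nrm (Y n m - Y n l) <=
    om + (Num.sqrt (2 * (\sum_p kk p) * ((m - l)%:R * 2 ^- n)) + 2 * om * C * nrm v).
Proof.
move=> lm om0 modb; set h : R := 2 ^- n; set ka := \sum_p kk p.
pose S j := (Y n j - Y n l) - (b (grid n j) - b (grid n l)).
have h0 : 0 < h by exact: h_gt0.
have ka0 : 0 <= ka by apply: sumr_ge0 => p _; exact: ltW.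
have omC : 0 <= 2 * om * C by rewrite !mulr_ge0.
have step r : (l + r <= m)%N -> dotv (S (l + r)%N) (S (l + r)%N) <=
    2 * ka * (r%:R * h) + 2 * om * C * dotv v (S (l + r)%N).
  elim: r => [_|r IH lrm]; first by rewrite addn0 /S !subrr !dotv0r mul0r !mulr0 addr0.
  have {}IH := IH (leq_trans (leq_add (leqnn l) (leqnSn r)) lrm).
  rewrite addnS in lrm *; set j := (l + r)%N in IH lrm *.
  have SS : S j.+1 - S j = h *: drift (Y n j.+1).
    have yE := YE n j; rewrite /S {1}yE -/h.
    by move: (h *: _) (Y n j) (Y n l) (b _) (b _) (b _) => p1 p2 p3 p4 p5 p6; apply/rowP => i; rewrite !mxE; ring.
  apply: (le_trans (dotv_sqr_step _ (S j))); rewrite SS dotvZr.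
  have d1 : dotv (S j.+1) (drift (Y n j.+1)) <= ka + om * C * dotv v (drift (Y n j.+1)).
    rewrite [X in dotv X _]/S dotvBl; apply: lerD.
      by apply: dot_rdrift_le => // p; exact: euler_ge0.
    rewrite -dotvNl; apply: (le_trans (dotv_le _ _)); rewrite nrmN -mulrA.
    apply: ler_pM; rewrite ?nrm_ge0//; last exact: drift_le.
    by apply: modb; rewrite lrm andbT /j -addnS leq_addr.
  have d2 : dotv v (S j.+1) = dotv v (S j) + h * dotv v (drift (Y n j.+1)).
    by rewrite -dotvZr -SS -dotvDr addrC subrK.
  rewrite d2 -[r.+1%:R]natr1.
  have := ler_wpM2l (ltW h0) d1; lra.
have := step (m - l)%N; rewrite subnKC// => /(_ (leqnn _)) hS.
have -> : Y n m - Y n l = (b (grid n m) - b (grid n l)) + S m by rewrite /S [RHS]addrC subrK.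
apply: (le_trans (nrmD _ _)); apply: lerD; first by apply: modb; rewrite lm leqnn.
set A := 2 * ka * _ in hS *; set E := nrm (S m).
have A0 : 0 <= A by rewrite !mulr_ge0// ltW.
have hE : E ^+ 2 <= A + 2 * om * C * nrm v * E.
  rewrite /E sqr_nrm; apply: (le_trans hS); rewrite lerD2l -(mulrA _ (nrm v)) ler_wpM2l//.
  exact: dotv_le.
have s0 := sqrtr_ge0 A; have sA := sqr_sqrtr A0.
have B0 : 0 <= 2 * om * C * nrm v by rewrite mulr_ge0// nrm_ge0.
rewrite leNgt; apply/negP; move: (Num.sqrt A) (2 * om * C * nrm v) s0 sA B0 hE => s B s0 sA B0 hE h1.
have h2 : s < E - B by lra.
have h3 : s < E by lra.
have : s * s < E * (E - B) by apply: ltr_pM.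
rewrite -expr2 sA mulrBr -expr2; lra.
Qed.

Let hit k j := `[< exists2 s, grid k j <= s <= grid k j.+1 & exists p, dotv (al p) (X s) = 0 >].

(** Proximity to the wall is carried from [X] at the hitting time to a nearby grid point by
    continuity, from [X] to [Y] by [scheme_cvg], and to the rest of the interval by
    [scheme_modulus]. The first two steps cost [eta / 2] each. The modulus of [b] is doubled because
    it is given from the left end of the interval. *)
Lemma hit_bound k om eta : 0 <= om -> 0 < eta ->
  (forall j, (j < M * 2 ^ k)%N -> forall s, grid k j <= s <= grid k j.+1 ->
    nrm (b s - b (grid k j)) <= om) ->
  exists n0, forall n, (n0 <= n)%N -> (k <= n)%N -> forall j, (j < M * 2 ^ k)%N -> hit k j ->
  exists p, forall i, (j * 2 ^ (n - k) <= i <= j.+1 * 2 ^ (n - k))%N ->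
    dotv (al p) (Y n i) <= nrm (al p) *
     ((2 * om + (Num.sqrt (2 * (\sum_p kk p) * 2 ^- k) + 2 * (2 * om) * C * nrm v)) + eta).
Proof.
move=> om0 eta0 modb.
have [n1 cvg1] := @scheme_cvg (eta / 2) ltac:(lra).
have [n2 unif] := @path_uniform (eta / 2) ltac:(lra).
exists (maxn n1 n2) => n; rewrite geq_max => /andP[nn1 nn2] kn j jM /asboolP[s /andP[s1 s2] [p ps]].
exists p => i /andP[i1 i2].
set q := (n - k)%N in i1 i2 *.
have gq l : grid n (l * 2 ^ q) = grid k l :> R by rewrite -(subnKC kn) grid_double.
have jqM : (j.+1 * 2 ^ q <= M * 2 ^ n)%N.
  by rewrite -(subnKC kn) -/q expnD mulnA leq_mul2r jM orbT.
have s0 : 0 <= s := le_trans (grid_ge0 k j) s1.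
have p0 : 0 < (2 : R) ^+ n by rewrite exprn_gt0.
(* The right end of the level-[n] cell containing [s], or the end of the interval if [s] is that
   end. *)
have [L [L1 L2 L3]] : exists L, [/\ (j * 2 ^ q <= L)%N, (L <= j.+1 * 2 ^ q)%N &
    nrm (X (grid n L) - X s) <= eta / 2].
  move: s2; rewrite le_eqVlt => /predU1P[->|s2].
    exists (j.+1 * 2 ^ q)%N; split => //; first by rewrite leq_mul2r leqnSn orbT.
    rewrite gq subrr (_ : nrm 0 = 0); first lra.
    by rewrite /nrm dotv0r sqrtr0.
  pose l := Num.truncn (s * 2 ^+ n).
  have /andP[h1 h2] := truncn_itv (mulr_ge0 s0 (ltW p0)).
  have g1 : grid n l <= s by rewrite /grid ler_pdivrMr.
  have g2 : s < grid n l.+1 by rewrite /grid ltr_pdivlMr.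
  have lq : (l < j.+1 * 2 ^ q)%N.
    by apply: (@grid_lt_nat R n); rewrite gq; exact: le_lt_trans g1 s2.
  exists l.+1; split => //.
    apply/ltnW; apply: (@grid_lt_nat R n); rewrite gq; exact: le_lt_trans g2.
  apply: unif => //; last by rewrite g1 ltW.
  exact: leq_trans jqM.
have YY : nrm (Y n i - Y n L) <=
    2 * om + (Num.sqrt (2 * (\sum_p kk p) * 2 ^- k) + 2 * (2 * om) * C * nrm v).
  have mono i' L' : (L' <= i')%N -> (j * 2 ^ q <= L')%N -> (i' <= j.+1 * 2 ^ q)%N ->
    nrm (Y n i' - Y n L') <= 2 * om + (Num.sqrt (2 * (\sum_p kk p) * 2 ^- k) + 2 * (2 * om) * C * nrm v).
    move=> Li jL ij.
    have om2 : 0 <= 2 * om by rewrite mulr_ge0.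
    apply: (le_trans (@scheme_modulus n (2 * om) L' i' Li om2 _)); last first.
      rewrite lerD2l lerD2r ler_wsqrtr// ler_wpM2l//.
        by rewrite mulr_ge0// sumr_ge0// => p' _; exact: ltW.
      rewrite ler_pdivrMr// -(subnKC kn) -/q exprD mulrA mulVf ?expf_neq0// mul1r.
      rewrite -natrX ler_nat leq_subLR; apply: (leq_trans ij).
      by rewrite mulSn addnC leq_add2r.
    move=> r /andP[r1 r2].
    have inI l : (j * 2 ^ q <= l)%N -> (l <= j.+1 * 2 ^ q)%N -> (grid k j : R) <= grid n l <= (grid k j.+1 : R).
      by move=> a1 a2; apply/andP; split; rewrite -gq; exact: grid_le.
    have b1 := modb j jM _ (inI r (leq_trans jL r1) (leq_trans r2 ij)).
    have b2 := modb j jM _ (inI L' jL (leq_trans Li ij)).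
    have -> : b (grid n r) - b (grid n L') = (b (grid n r) - b (grid k j)) - (b (grid n L') - b (grid k j)).
      by rewrite opprB addrA subrK.
    by apply: (le_trans (nrmD _ _)); rewrite nrmN; lra.
  have [Li|/ltnW iL] := leqP L i; first exact: mono.
  by rewrite nrmB; exact: mono.
have XL : nrm (Y n L - X (grid n L)) <= eta / 2.
  by rewrite nrmB; apply: cvg1 => //; exact: leq_trans L2 jqM.
have -> : Y n i = (Y n i - Y n L) + ((Y n L - X (grid n L)) + (X (grid n L) - X s)) + X s.
  by apply/rowP => r; rewrite !mxE; ring.
rewrite dotvDr ps addr0; apply: (le_trans (dotv_le _ _)); rewrite ler_wpM2l ?nrm_ge0//.
apply: (le_trans (nrmD _ _)); apply: lerD => //; apply: (le_trans (nrmD _ _)); lra.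
Qed.

(** The regularisation is [e = rho^k]. The condition on [rho] makes the displacement [2^(-k/2)] due
    to the drift at most [rho^k], so that on a hit interval some [dotv (al p) Y + e] is at most
    [D rho^k] at all [2^(n - k)] grid points. Comparing the potential there with the occupation
    bound gives the count. *)
Lemma path_count (a Kocc rho Cb : R) : 0 < a -> a < 1 -> 0 < rho -> rho < 1 ->
  1 / 2 <= rho ^+ 2 -> 0 <= Cb ->
  (exists m0, forall k, (m0 <= k)%N -> forall j, (j < M * 2 ^ k)%N ->
    forall s, grid k j <= s <= grid k j.+1 -> nrm (b s - b (grid k j)) <= Cb * rho ^+ k) ->
  (forall e, 0 < e -> e <= 1 -> forall n0, exists2 n, (n0 <= n)%N &
    2 ^- n * \sum_(i < M * 2 ^ n) potential al a e (Y n i.+1) <= Kocc) ->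
  exists2 C3, 0 <= C3 & exists m0, forall k, (m0 <= k)%N ->
    (\sum_(j < M * 2 ^ k) hit k j)%N%:R <= C3 * 2 ^+ k * (rho ^+ k) `^ (2 - a).
Proof.
move=> a0 a1 r0 r1 r2 Cb0 [m0 modb] occ.
set ka := \sum_p kk p.
have ka0 : 0 <= ka by apply: sumr_ge0 => p _; exact: ltW.
have nv := nrm_ge0 v.
pose A : R := 1 + \sum_p nrm (al p).
have nA p : nrm (al p) <= A.
  rewrite /A (bigD1 p)//= addrCA lerDl addr_ge0// sumr_ge0// => p' _; exact: nrm_ge0.
have A0 : 0 <= A by rewrite addr_ge0// sumr_ge0// => p' _; exact: nrm_ge0.
pose B0 := 2 * Cb + (Num.sqrt (2 * ka) + 2 * (2 * Cb) * C * nrm v) + 1.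
have B00 : 0 <= B0 by rewrite !addr_ge0 ?sqrtr_ge0// ?mulr_ge0.
pose D := A * B0 + 1.
have D0 : 0 < D by rewrite ltr_wpDl// mulr_ge0.
have Ko0 : 0 <= Kocc.
  have [n _] := occ 1 ltr01 (lexx 1) 0%N; apply: le_trans; apply: mulr_ge0.
    by rewrite invr_ge0 exprn_ge0.
  by apply: sumr_ge0 => i _; exact: potential_ge0.
exists (Kocc * D `^ (2 - a)); first by rewrite mulr_ge0// powR_ge0.
exists m0 => k mk.
have rk0 : 0 < rho ^+ k by rewrite exprn_gt0.
have rk1 : rho ^+ k <= 1 by rewrite exprn_ile1// ltW.
have om0 : 0 <= Cb * rho ^+ k by rewrite mulr_ge0// ltW.
have [n1 hb] := @hit_bound k (Cb * rho ^+ k) (rho ^+ k) om0 rk0 (modb k mk).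
have [n nn occn] := occ (rho ^+ k) rk0 rk1 (maxn n1 k).
move: nn; rewrite geq_max => /andP[n1n kn].
have {}hb := hb n n1n kn.
set q := (n - k)%N in hb.
have sq : Num.sqrt (2 * ka * 2 ^- k) <= Num.sqrt (2 * ka) * rho ^+ k.
  rewrite sqrtrM ?mulr_ge0// ler_wpM2l ?sqrtr_ge0//.
  rewrite -[leRHS]gtr0_norm// -sqrtr_sqr ler_wsqrtr// -exprM mulnC exprM -exprVn.
  by rewrite lerXn2r ?nnegrE//; lra.
have base p i y : dotv (al p) y <= nrm (al p) *
     ((2 * (Cb * rho ^+ k) + (Num.sqrt (2 * ka * 2 ^- k) + 2 * (2 * (Cb * rho ^+ k)) * C * nrm v)) + rho ^+ k) ->
    (i : nat) = i -> dotv (al p) y + rho ^+ k <= D * rho ^+ k.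
  move=> h _; rewrite /D mulrDl mul1r lerD2r; apply: (le_trans h).
  rewrite -(mulrA A); apply: ler_pM => //; first exact: nrm_ge0.
    by rewrite !addr_ge0 ?sqrtr_ge0// ?mulr_ge0// ltW.
  have -> : B0 * rho ^+ k = 2 * (Cb * rho ^+ k) + (Num.sqrt (2 * ka) * rho ^+ k +
      2 * (2 * (Cb * rho ^+ k)) * C * nrm v) + rho ^+ k by rewrite /B0; ring.
  by rewrite lerD2r lerD2l lerD2r.
pose lb := (D * rho ^+ k) `^ (a - 2).
have Dk0 : 0 < D * rho ^+ k by rewrite mulr_gt0.
have lb0 : 0 < lb by rewrite powR_gt0.
have blocks (F : nat -> R) m r : \sum_(i < m * r) F i = \sum_(j < m) \sum_(i < r) F (j * r + i)%N.
  elim: m => [|m IH]; first by rewrite mul0n !big_ord0.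
  rewrite big_ord_recr/= -IH mulSn addnC.
  by rewrite big_split_ord/=.
have le1 : (\sum_(j < M * 2 ^ k) hit k j)%N%:R * (2 ^+ q * lb) <=
    \sum_(i < M * 2 ^ n) potential al a (rho ^+ k) (Y n i.+1).
  have -> : (M * 2 ^ n = M * 2 ^ k * 2 ^ q)%N by rewrite -(subnKC kn) -/q expnD mulnA.
  rewrite (blocks (fun i => potential al a (rho ^+ k) (Y n i.+1))) natr_sum mulr_suml.
  apply: ler_sum => j _; case: (boolP (hit k j)) => hj; last first.
    by rewrite mul0r; apply: sumr_ge0 => i _; exact: potential_ge0.
  rewrite mul1r; have [p hp] := hb j (ltn_ord j) hj.
  rewrite -natrX -[X in X%:R * lb]card_ord mulr_natl -sumr_const; apply: ler_sum => i _.
  have inI : (j * 2 ^ q <= (j * 2 ^ q + i).+1 <= j.+1 * 2 ^ q)%N.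
    by rewrite leqW ?leq_addr//= mulSn addnC ltn_add2r.
  have := base p 0%N _ (hp _ inI) erefl => hD.
  rewrite /potential (bigD1 p)//=.
  apply: (@le_trans _ _ ((dotv (al p) (Y n (j * 2 ^ q + i).+1) + rho ^+ k) `^ (a - 2))).
    apply: powR_neg_le => //; last by lra.
    by rewrite ltr_wpDl// euler_ge0.
  by rewrite lerDl sumr_ge0// => p' _; exact: powR_ge0.
have p2n : 0 < (2 : R) ^+ n by rewrite exprn_gt0.
have p2q : 0 < (2 : R) ^+ q by rewrite exprn_gt0.
have le2 : (\sum_(j < M * 2 ^ k) hit k j)%N%:R * (2 ^+ q * lb) <= Kocc * 2 ^+ n.
  by apply: (le_trans le1); rewrite -ler_pdivrMr// mulrC.
have n2 : (2 : R) ^+ n = 2 ^+ k * 2 ^+ q by rewrite -exprD subnKC.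
have lbE : lb = (D `^ (2 - a) * (rho ^+ k) `^ (2 - a))^-1.
  by rewrite /lb -powRM ?(ltW D0) ?(ltW rk0)// -powRN opprB.
move: le2; rewrite n2 lbE.
have PP : 0 < D `^ (2 - a) * (rho ^+ k) `^ (2 - a) by rewrite mulr_gt0// powR_gt0.
set c : R := (\sum_(j < _) _)%N%:R.
move: PP p2q; move: c (D `^ _) ((rho ^+ k) `^ _) (2 ^+ k) (2 ^+ q) => c p1 p2 p3 p4 PP p4_gt0.
rewrite mulrA [Kocc * (p3 * p4)]mulrA [c * p4]mulrC -(mulrA p4) [Kocc * p3 * p4]mulrC ler_pM2l//.
by rewrite ler_pdivrMr// => /le_trans; apply; rewrite le_eqVlt; apply/orP; left; apply/eqP; ring.
Qed.

End bessel_path.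

(** * Hausdorff measure *)

Section hausdorff.
Context {R : realType}.

Lemma hterm_ge0 (s : R) (U : set R) : (0 <= hterm s U)%E.
Proof. by rewrite /hterm; case: (pselect (U = set0)) => ?; rewrite ?lee_fin ?powR_ge0. Qed.

Lemma hterm_set0 (s : R) : hterm s set0 = 0%E.
Proof. by rewrite /hterm; case: (pselect (set0 = set0)). Qed.

Lemma diam_itv (a c : R) : (diam `[a, c]%classic <= (c - a)%:E)%E.
Proof.
apply: ge_ereal_sup => _ [x + [y + <-]].
rewrite /= !in_itv/= => /andP[x1 x2] /andP[y1 y2].
by rewrite lee_fin ler_norml; apply/andP; split; lra.
Qed.

Lemma hterm_itv (s a c : R) : 0 <= s -> a <= c ->
  (hterm s `[a, c]%classic <= ((c - a) `^ s)%:E)%E.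
Proof.
move=> s0 ac; rewrite /hterm; case: (pselect (`[a, c]%classic = set0)) => [?|?]; first by rewrite lee_fin powR_ge0.
have d0 : (0 <= diam `[a, c]%classic)%E.
  apply: ereal_sup_ubound; exists a; first by rewrite /= in_itv/= lexx ac.
  by exists a; [rewrite /= in_itv/= lexx ac|rewrite subrr normr0].
have d1 := diam_itv a c.
rewrite lee_fin ge0_ler_powR ?nnegrE ?fine_ge0 ?subr_ge0//.
by rewrite -lee_fin fineK// ge0_fin_numE// (le_lt_trans d1)// ltry.
Qed.

(** The countably many covers are enumerated as one through a bijection of [nat] with pairs, and
    their bounds [e / 2^(M + 1)] add up to [e]. *)
Lemma hausdorff_content_double (s dl e : R) (A : set R) (U : nat -> nat -> set R) :
  A `<=` \bigcup_M \bigcup_j U M j -> (forall M j, (diam (U M j) <= dl%:E)%E) ->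
  0 <= e -> (forall M, (\sum_(j <oo) hterm s (U M j) <= (e / (2 ^ M.+1)%:R)%:E)%E) ->
  (hausdorff_content s dl A <= e%:E)%E.
Proof.
move=> AU dU e0 sU.
have /card_esym/ppcard_eqP[f] := @card_nat2.
pose V i := U (f i).1 (f i).2.
have h0 z : (0 <= hterm s (U z.1 z.2))%E by exact: hterm_ge0.
apply: (@le_trans _ _ (\sum_(i <oo) hterm s (V i))%E).
  apply: ereal_inf_lbound; exists V => //; split => [t /AU[M _ [j _ Ut]]|i]; last exact: dU.
  by exists (f^-1%FUN (M, j)) => //; rewrite /V invK ?inE.
rewrite nneseries_esumT; last by move=> i; exact: hterm_ge0.
rewrite -(@reindex_esum _ _ _ [set: nat] [set: nat * nat] f (fun z => hterm s (U z.1 z.2))); last first.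
  by have := @bij _ _ _ _ f; apply.
have -> : [set: nat * nat] = [set: nat] `*`` (fun=> [set: nat]).
  by apply/seteqP; split => -[].
rewrite -(@esum_esum _ _ _ [set: nat] (fun=> [set: nat]) (fun M j => hterm s (U M j)))//; last first.
  by move=> *; exact: hterm_ge0.
rewrite -nneseries_esumT; last by move=> M; apply: esum_ge0 => j _; exact: hterm_ge0.
apply: le_trans (epsilon_trick0 xpredT e0).
apply: lee_nneseries => [M _ _|M _]; first by apply: esum_ge0 => j _; exact: hterm_ge0.
by rewrite -nneseries_esumT; [exact: sU|move=> j; exact: hterm_ge0].
Qed.

Lemma powR_expr (x g : R) k : 0 <= x -> (x ^+ k) `^ g = (x `^ g) ^+ k.
Proof.
move=> x0; elim: k => [|k IH]; first by rewrite !expr0 powR1.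
by rewrite !exprS powRM ?exprn_ge0// IH.
Qed.

(** At level [k] the cover by hit intervals has total [s]-content at most [C q^k], with
    [q = 2 * 2^-s * rho^g < 1]. Since [C] depends on the time horizon, each bounded window of times
    gets a level of its own. *)
Lemma hausdorff_null (Z : set R) (s g rho : R) : 0 <= s -> 0 < rho ->
  (forall t, Z t -> 0 <= t) ->
  2 * (2^-1 `^ s * rho `^ g) < 1 ->
  (forall M : nat, exists2 C, 0 <= C & exists m0, forall k, (m0 <= k)%N ->
    (\sum_(j < M * 2 ^ k) `[< (exists2 t, grid k j <= t <= grid k j.+1 & Z t)%R >])%N%:R
      <= C * 2 ^+ k * (rho ^+ k) `^ g) ->
  hausdorff_measure s Z = 0%E.
Proof.
move=> s0 r0 Z0 q1 count; set q := 2 * _ in q1.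
pose hit k j := `[< exists2 t, grid k j <= t <= grid k j.+1 & Z t >].
have q0 : 0 <= q by rewrite !mulr_ge0// powR_ge0.
have fine_level (dl e : R) (M : nat) : 0 < dl -> 0 < e -> exists k, 2 ^- k <= dl /\
    (\sum_(j < M * 2 ^ k) hit k j)%N%:R * (2 ^- k) `^ s <= e.
  move=> dl0 e0; have [C C0 [m0 cC]] := count M.
  have [m1 h1] := geometric_small q0 q1 C0 e0.
  have [m2 h2] := @geometric_small R 1 2^-1 dl ltac:(lra) ltac:(lra) ltac:(lra) dl0.
  exists (maxn m0 (maxn m1 m2)); set k := maxn _ _.
  have km0 : (m0 <= k)%N by exact: leq_maxl.
  have km1 : (m1 <= k)%N by rewrite /k !leq_max leqnn orbT.
  have km2 : (m2 <= k)%N by rewrite /k !leq_max leqnn !orbT.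
  split; first by have := h2 k km2; rewrite mul1r exprVn.
  apply: le_trans (h1 k km1).
  apply: (@le_trans _ _ (C * 2 ^+ k * (rho ^+ k) `^ g * (2 ^- k) `^ s)).
    by rewrite ler_wpM2r ?powR_ge0//; exact: cC.
  rewrite -exprVn !powR_expr ?(ltW r0)// /q !exprMn le_eqVlt; apply/orP; left; apply/eqP; ring.
have content0 dl e : 0 < dl -> 0 < e -> (hausdorff_content s dl Z <= e%:E)%E.
  move=> dl0 e0.
  have eM M : 0 < e / (2 ^ M.+1)%:R by rewrite divr_gt0// ltr0n expn_gt0.
  pose k M := projT1 (cid (fine_level dl (e / (2 ^ M.+1)%:R) M.+1 dl0 (eM M))).
  have kP M := projT2 (cid (fine_level dl (e / (2 ^ M.+1)%:R) M.+1 dl0 (eM M))).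
  rewrite -/(k _) in kP.
  pose on M j := hit (k M) j && (j < M.+1 * 2 ^ k M)%N.
  pose U M j : set R := if on M j then `[grid (k M) j, grid (k M) j.+1]%classic else set0.
  have gE m j : grid m j.+1 - grid m j = 2 ^- m :> R by rewrite /grid -[j.+1%:R]natr1; ring.
  apply: (@hausdorff_content_double s dl e Z U); last first.
  - move=> M; apply: lime_le.
      by apply: is_cvg_nneseries => j _ _; exact: hterm_ge0.
    apply: nearW => m; pose c j : R := (on M j)%:R * (2 ^- k M) `^ s.
    have c0 j : 0 <= c j by rewrite mulr_ge0// powR_ge0.
    apply: (@le_trans _ _ (\sum_(0 <= j < m) (c j)%:E)%E).
      apply: lee_sum => j _; rewrite /U /c; case: ifP => _; last by rewrite hterm_set0 mul0r.
      by rewrite mul1r -(gE (k M) j); apply: hterm_itv => //; exact: grid_le.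
    rewrite sumEFin lee_fin; apply: le_trans (kP M).2.
    set n := (M.+1 * 2 ^ k M)%N.
    have -> : (\sum_(j < n) hit (k M) j)%N%:R * (2 ^- k M) `^ s = \sum_(0 <= j < n) c j.
      rewrite natr_sum mulr_suml big_mkord; apply: eq_bigr => j _.
      by rewrite /c /on ltn_ord andbT.
    have [mn|/ltnW nm] := leqP m n.
      by rewrite [leRHS](@big_cat_nat _ _ _ m)//= lerDl sumr_ge0.
    rewrite [leLHS](@big_cat_nat _ _ _ n)//= [X in _ + X]big_nat [X in _ + X]big1 ?addr0//.
    by move=> j /andP[nj _]; rewrite /c /on -/n ltnNge nj andbF mul0r.
  - exact: ltW.
  - move=> M j; rewrite /U; case: ifP => _; last first.
      by apply: ge_ereal_sup => _ [y []].
    by apply: (le_trans (diam_itv _ _)); rewrite lee_fin gE; exact: (kP M).1.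
  move=> t Zt; have t0 := Z0 t Zt.
  (* The cover of index [M] reaches up to time [M + 1], hence past [t]. *)
  pose M := Num.truncn t; exists M => //.
  have p0 : 0 < (2 : R) ^+ k M by rewrite exprn_gt0.
  have /andP[h1 h2] := truncn_itv (mulr_ge0 t0 (ltW p0)).
  set j := Num.truncn (t * 2 ^+ k M) in h1 h2; exists j => //.
  have g1 : grid (k M) j <= t by rewrite /grid ler_pdivrMr.
  have g2 : t < grid (k M) j.+1 by rewrite /grid ltr_pdivlMr.
  have jM : (j < M.+1 * 2 ^ k M)%N.
    by rewrite -(ltr_nat R) (le_lt_trans h1)// natrM natrX ltr_pM2r// truncnS_gt.
  rewrite /U; have -> : on M j.
    by rewrite /on jM andbT; apply/asboolP; exists t => //; rewrite g1 ltW.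
  by rewrite /= in_itv/= g1 ltW.
have content_ge0 dl : (0 <= hausdorff_content s dl Z)%E.
  by apply: le_ereal_inf_tmp => _ [U _ <-]; apply: nneseries_ge0 => i _ _; exact: hterm_ge0.
apply/eqP; rewrite eq_le; apply/andP; split.
  apply: ge_ereal_sup => _ [dl dl0 <-]; apply/lee_addgt0Pr => e e0.
  by rewrite add0e; exact: content0.
apply: (le_trans (content_ge0 1)); apply: ereal_sup_ubound; exists 1 => //=.
Qed.

End hausdorff.

Lemma path_modulus {R : realType} {N : nat} (b : R -> 'rV[R]_N) (rho : R) (M m0 : nat) :
  (forall i, cts_nonneg (fun t => b t ord0 i)) -> 0 <= rho -> rho < 1 ->
  (forall m, (m0 <= m)%N -> forall j, (j < M * 2 ^ m)%N -> forall i : 'I_N,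
    `|b (grid m j.+1) ord0 i - b (grid m j) ord0 i| <= rho ^+ m) ->
  forall k, (m0 <= k)%N -> forall j, (j < M * 2 ^ k)%N ->
  forall s, grid k j <= s <= grid k j.+1 ->
  nrm (b s - b (grid k j)) <= N%:R / (1 - rho) * rho ^+ k.
Proof.
move=> cb r0 r1 incr k mk j jM s sj; apply: (le_trans (nrm_le_sum _)).
apply: (@le_trans _ _ (\sum_(i < N) rho ^+ k / (1 - rho))).
  apply: ler_sum => i _; rewrite !mxE.
  apply: (@dyadic_modulus R (fun t => b t ord0 i) rho M m0) => //.
  by move=> m mm j' jM'; exact: incr.
by rewrite sumr_const card_ord -[leLHS]mulr_natl mulrAC mulrA.
Qed.

Lemma ae_forall_nat {d} {T : measurableType d} {R : realType} (mu : {measure set T -> \bar R})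
    (Q : nat -> T -> Prop) :
  (forall n, {ae mu, forall w, Q n w}) -> {ae mu, forall w, forall n, Q n w}.
Proof. by move=> H; apply/ae_foralln => n; exact: H. Qed.

Section zero_set.
Context d {T : measurableType d} {R : realType} (P : probability T R) {N : nat} {I : finType}.
Variables (al : I -> 'rV[R]_N) (kk : I -> R) (v x : 'rV[R]_N) (B X : R -> T -> 'rV[R]_N).
Variable k' : R.
Hypothesis kk_gt0 : forall p, 0 < kk p.
Hypothesis Wv : chamber al v.
Hypothesis bm : brownian_motion P B.
Hypothesis x_ge0 : forall p, 0 <= dotv (al p) x.
Hypotheses (k'_gt0 : 0 < k') (k'_lt : k' < 1 / 2) (k'_le : forall p, k' <= kk p).
Hypothesis al_ge1 : forall p, 1 <= dotv (al p) (al p).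
Hypothesis cross : positive_cross_terms al kk.
Hypothesis B_path : {ae P, forall w, B 0 w = 0 /\ forall i, cts_nonneg (fun t => B t w ord0 i)}.
Hypothesis X_path : {ae P, forall w, (forall i, cts_nonneg (fun t => X t w ord0 i)) /\
  forall t, 0 <= t -> (forall p, 0 <= dotv (al p) (X t w)) /\
    (forall i, (@lebesgue_measure R).-integrable `[0, t]
      (fun s => (rdrift al kk (X s w) ord0 i)%:E)) /\
    X t w = x + B t w + \row_i Rintegral (@lebesgue_measure R) `[0, t]
      (fun s => rdrift al kk (X s w) ord0 i)}.

Lemma root_coord_neq0 p : exists i0, al p ord0 i0 != 0.
Proof.
apply: contrapT => h; have := al_ge1 p; rewrite /dotv big1 ?ler10// => i _.
have [->|n0] := eqVneq (al p ord0 i) 0; first by rewrite mul0r.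
by exfalso; apply: h; exists i.
Qed.

(** The constant in the modulus of [dotv (al p) (B t w)] at [rho = 3/4], a value admissible for
    [bm_modulus_ae] because [9/16 > 1/2]. *)
Let root_modulus p : R := nrm (al p) * (N%:R / (1 - 3 / 4)).

Let root_modulus_ge0 p : 0 <= root_modulus p.
Proof. by rewrite mulr_ge0 ?nrm_ge0// divr_ge0//; lra. Qed.

Lemma nonsticking_ae : {ae P, forall w, forall M p,
  measurable [set t | 0 <= t < M%:R /\ dotv (al p) (X t w) = 0] /\
  (@lebesgue_measure R) [set t | 0 <= t < M%:R /\ dotv (al p) (X t w) = 0] = 0%E}.
Proof.
have H1 : {ae P, forall w, forall M, exists m0, forall m, (m0 <= m)%N -> forall j,
    (j < M * 2 ^ m)%N -> forall i : 'I_N,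
    `|B (grid m j.+1) w ord0 i - B (grid m j) w ord0 i| <= (3 / 4) ^+ m}.
  by apply: ae_forall_nat => M; apply: bm_modulus_ae => //; lra.
have H2 : {ae P, forall w, forall M dl p, (0 < dl)%N -> exists m0, forall m, (m0 <= m)%N ->
    \sum_(j < M * 2 ^ (6 * m))
      \1_[set w | `|dotv (al p) (B (grid (6 * m) (j + dl * 4 ^ m)) w - B (grid (6 * m) j) w)|
                  <= (2 * root_modulus p + 1) * (3 / 4) ^+ (6 * m)] w
      < 2 ^+ (6 * m) * (9 / 10) ^+ m :> R}.
  apply: ae_forall_nat => M; apply: ae_forall_nat => dl; apply: filter_forall => p.
  have [->|dl0] := posnP dl; first by apply: aeW.
  have [i0 p0] := root_coord_neq0 p.
  have C0 : 0 <= 2 * root_modulus p + 1 by rewrite addr_ge0// mulr_ge0.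
  by apply: filterS (bm_close_pairs_ae bm M p0 dl0 C0) => w h _.
apply: (filterS _ (filterI B_path (filterI X_path (filterI H1 H2)))) => w [[B0 cB] [[cX Xw] [h1 h2]]] M p.
have di t (t0 : 0 <= t) := (Xw t t0).2.1; have XE t (t0 : 0 <= t) := (Xw t t0).2.2.
apply: (@path_nonsticking R N I al kk x (B^~ w) (X^~ w) M di XE p (root_modulus p) cX).
  have [m0 h] := h1 M.+1; exists m0 => m mm j jM s sj.
  have mm6 : (m0 <= 6 * m)%N by lia.
  have r0 : (0 : R) <= 3 / 4 by lra.
  have r1 : (3 / 4 : R) < 1 by lra.
  have := path_modulus cB r0 r1 h mm6 jM sj; rewrite -dotvBr.
  move=> /(ler_wpM2l (nrm_ge0 (al p))); rewrite mulrA; apply: le_trans.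
  exact: dotv_le_nrm.
move=> dl dl0; have [m0 h] := h2 M dl p dl0; exists m0 => m mm; apply: le_lt_trans (h m mm).
rewrite le_eqVlt; apply/orP; left; apply/eqP; apply: eq_bigr => j _.
rewrite indicE; congr (nat_of_bool _)%:R; rewrite -dotvBr.
by apply/idP/idP; rewrite inE.
Qed.

Lemma zero_set_null (s : R) : 1 / 2 - k' < s -> s < 1 ->
  {ae P, forall w, hausdorff_measure s
    [set t | 0 <= t /\ exists p, dotv (al p) (X t w) = 0] = 0%E}.
Proof.
move=> s1 s2; have kg0 := k'_gt0; have kl := k'_lt.
(* The exponent [a] is the midpoint of [1 - 2 k'] and [mn]: large enough for a positive generator
   constant, below 1 for concavity, and below [2 s] so that a suitable [th] exists. *)
pose mn := Num.min 1 (2 * s).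
have [mn1 mn2 mn3] : [/\ mn <= 1, mn <= 2 * s & 1 - 2 * k' < mn].
  by split; rewrite /mn ?ge_min ?lexx ?orbT// lt_min; apply/andP; split; lra.
pose a := (1 - 2 * k' + mn) / 2.
have a0 : 0 < a by rewrite /a; lra.
have a1 : a < 1 by rewrite /a; lra.
have ak' : (1 - a) / 2 < k' by rewrite /a; lra.
have a2s : a < 2 * s by rewrite /a; lra.
(* With [rho = 2^-th], the bound [th < 1/2] makes the modulus available, and
   [th > (1 - s) / (2 - a)] makes the covering ratio [2^(1 - s - th (2 - a))] less than 1. *)
pose th := ((1 - s) / (2 - a) + 1 / 2) / 2.
have th1 : (1 - s) / (2 - a) < 1 / 2 by rewrite ltr_pdivrMr; lra.
have th2 : 0 < (1 - s) / (2 - a) by rewrite divr_gt0; lra.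
have th0 : 0 < th by rewrite /th; lra.
have thlt : th < 1 / 2 by rewrite /th; lra.
have hpow (y z : R) : y < z -> (2^-1 : R) `^ z < 2^-1 `^ y.
  move=> yz; rewrite /powR gt_eqF ?invr_gt0// ltr_expR.
  by rewrite ltr_nM2r// ln_lt0//; apply/andP; split; lra.
pose rho : R := 2^-1 `^ th.
have rho0 : 0 < rho by rewrite powR_gt0.
have rho1 : rho < 1 by rewrite -(powRr0 (2^-1 : R)); exact: hpow.
have rho2 : 1 / 2 < rho ^+ 2.
  rewrite -powR_mulrn ?(ltW rho0)// -powRrM mul1r.
  have := @hpow (th * 2) 1; rewrite powRr1 ?invr_ge0//; apply; lra.
have small : 2 * (2^-1 `^ s * rho `^ (2 - a)) < 1.
  rewrite -powRrM -powRD; last by apply/implyP => _; rewrite gt_eqF ?invr_gt0.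
  have := @hpow 1 (s + th * (2 - a)); rewrite powRr1 ?invr_ge0// => h.
  have : 1 < s + th * (2 - a).
    have : (1 - s) / (2 - a) < th by rewrite /th; lra.
    rewrite ltr_pdivrMr; lra.
  by move=> /h; lra.
have H1 : {ae P, forall w, forall M, exists m0, forall m, (m0 <= m)%N -> forall j,
    (j < M * 2 ^ m)%N -> forall i : 'I_N,
    `|B (grid m j.+1) w ord0 i - B (grid m j) w ord0 i| <= rho ^+ m}.
  by apply: ae_forall_nat => M; exact: bm_modulus_ae.
have H2 : {ae P, forall w, forall M : nat, exists K, forall e, 0 < e -> e <= 1 ->
    forall n0, exists2 n, (n0 <= n)%N & 2 ^- n *
      \sum_(i < M * 2 ^ n) potential al a e (euler al kk x (B^~ w) n i.+1) <= K}.
  by apply: ae_forall_nat => M; exact: (occupation_ae M kk_gt0 Wv bm x_ge0 a0 a1 ak' k'_le al_ge1 cross).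
have [C C0 drift_le] := nrm_rdrift_le kk_gt0 Wv.
apply: (filterS _ (filterI B_path (filterI X_path (filterI nonsticking_ae (filterI H1 H2))))) => w [[B0 cB] [[cX Xw] [ns [h1 h2]]]].
have Xge t (t0 : 0 <= t) := (Xw t t0).1.
have di t (t0 : 0 <= t) := (Xw t t0).2.1; have XE t (t0 : 0 <= t) := (Xw t t0).2.2.
apply: (@hausdorff_null R _ s (2 - a) rho); [lra|exact: rho0|by move=> t []|exact: small|].
move=> M; have [m0 hm0] := h1 M; have [K hK] := h2 M.
have Cb0 : 0 <= N%:R / (1 - rho) by rewrite divr_ge0//; lra.
have [C3 C30 [m1 hm1]] := @path_count R N I al kk v x (B^~ w) (X^~ w) M kk_gt0 Wv B0 x_ge0
  Xge di XE (fun p => (ns M p).2) (fun p => (ns M p).1) C C0 drift_le cX a K rho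
  (N%:R / (1 - rho)) a0 a1 rho0 rho1 (ltW rho2) Cb0
  (ex_intro _ m0 (path_modulus cB (ltW rho0) rho1 hm0)) hK.
exists C3 => //; exists m1 => k mk; apply: le_trans (hm1 k mk).
rewrite ler_nat; apply: leq_sum => j _.
case: asboolP => // -[t tj [_ tp]]; case: asboolP => //; case.
by exists t.
Qed.

End zero_set.

(** * Root systems of type A and B *)

Section unordered_pairs.
Context {R : realType} {N : nat}.

Definition upair : finType := {p : 'I_N * 'I_N | (p.1 < p.2)%N}.

Lemma sum_upair (F : 'I_N -> 'I_N -> R) : (forall i j, F i j = F j i) ->
  2 * \sum_(p : upair) F (val p).1 (val p).2 = \sum_i \sum_(j | j != i) F i j.
Proof.
move=> FC; rewrite pair_big_dep/=.
have <- : \sum_(z : 'I_N * 'I_N | (z.1 < z.2)%N) F z.1 z.2 =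
    \sum_(p : upair) F (val p).1 (val p).2.
  rewrite (reindex_omap (val : upair -> _) insub)/=; last first.
    by move=> z zlt; rewrite insubT.
  by apply: eq_bigl => p; rewrite (valP p) valK eqxx.
rewrite [RHS](bigID (fun z : 'I_N * 'I_N => (z.1 < z.2)%N))/= mulr_natl mulr2n; congr (_ + _).
  apply: eq_bigl => -[i j]/=; case: (ltnP i j) => ij; rewrite ?andbF ?andbT//.
  by apply/esym; rewrite eq_sym -(inj_eq val_inj) neq_ltn ij.
rewrite (reindex (fun z : 'I_N * 'I_N => (z.2, z.1)))/=; last first.
  by exists (fun z => (z.2, z.1)) => -[].
apply: eq_big => -[i j]/=; last by move=> _; exact: FC.
by rewrite -(inj_eq val_inj) /= neq_ltn -leqNgt; case: ltngtP.
Qed.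

Lemma sum_offdiag_snd (A : 'I_N -> 'I_N -> R) m :
  \sum_i \sum_(j | j != i) A i j * (j == m)%:R = \sum_(i | i != m) A i m.
Proof.
rewrite [RHS]big_mkcond; apply: eq_bigr => i _; rewrite eq_sym.
case: ifPn => [im|/negbNE/eqP im].
  rewrite (bigD1 m)//= eqxx mulr1 big1 ?addr0// => j /andP[_ /negbTE ->].
  by rewrite mulr0.
by rewrite big1// => j; rewrite -im => /negbTE ->; rewrite mulr0.
Qed.

Lemma sum_offdiag_fst (A : 'I_N -> 'I_N -> R) m :
  \sum_i \sum_(j | j != i) A i j * (i == m)%:R = \sum_(j | j != m) A m j.
Proof.
rewrite (bigD1 m)//= [X in _ + X]big1 ?addr0.
  by apply: eq_bigr => j _; rewrite eqxx mulr1.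
by move=> i /negbTE im; rewrite big1// => j _; rewrite im mulr0.
Qed.

(** Extended by zero to all triples, the sum is invariant under cyclic rotation of the indices;
    three times its value is the sum of the cyclic averages assumed nonnegative. *)
Lemma sum_triples_ge0 (F : 'I_N -> 'I_N -> 'I_N -> R) :
  (forall i j l, i != j -> j != l -> l != i -> 0 <= F i j l + F j l i + F l i j) ->
  0 <= \sum_i \sum_(j | j != i) \sum_(l | (l != i) && (l != j)) F i j l.
Proof.
move=> F0.
pose G i j l := if [&& i != j, j != l & l != i] then F i j l else 0.
have -> : \sum_i \sum_(j | j != i) \sum_(l | (l != i) && (l != j)) F i j l =
    \sum_i \sum_j \sum_l G i j l.
  apply: eq_bigr => i _; rewrite big_mkcond; apply: eq_bigr => j _.
  rewrite [j == i]eq_sym; case: (boolP (i == j)) => /= ij.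
    by rewrite big1// => l _; rewrite /G ij.
  rewrite big_mkcond; apply: eq_bigr => l _; rewrite /G ij/= [j == l]eq_sym andbC.
  by [].
set S := \sum_i _.
have rot (H : 'I_N -> 'I_N -> 'I_N -> R) :
    \sum_i \sum_j \sum_l H i j l = \sum_i \sum_j \sum_l H j l i.
  by rewrite [RHS]exchange_big; apply: eq_bigr => i _; rewrite [RHS]exchange_big.
have E1 := rot G; have E2 := rot (fun i j l => G j l i); rewrite -/S in E1 E2.
suff : 0 <= S + S + S by move=> h; lra.
have -> : S + S + S = S + \sum_i \sum_j \sum_l G j l i + \sum_i \sum_j \sum_l G l i j.
  by rewrite -E2 -E1.
rewrite /S -!big_split/=; apply: sumr_ge0 => i _.
rewrite -!big_split/=; apply: sumr_ge0 => j _; rewrite -!big_split/=; apply: sumr_ge0 => l _.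
rewrite /G; case: (boolP (i == j)) => [|ij]/=; first by rewrite !andbF !addr0.
case: (boolP (j == l)) => [|jl]/=; first by rewrite !andbF !addr0.
case: (boolP (l == i)) => [|li]/=; first by rewrite !addr0.
exact: F0.
Qed.

End unordered_pairs.

Arguments upair : clear implicits.

Section three_bodies.
Context {R : realType}.

(** For [H u = |u| g |u|] and [x < y] this equals [g (y - x) * ((y - z)^-1 - (x - z)^-1)]: the pull
    of a third particle [z] on the gap between [x] and [y], weighted by [g]. *)
Definition three_body (H : R -> R) (x y z : R) : R := - H (x - y) / ((x - z) * (y - z)).

(* For x < y < z, multiplying by (y - x) (z - y) (z - x) turns the sum into
   H (z - x) (z - x) - H (y - x) (y - x) - H (z - y) (z - y). *)
Lemma three_body_sum_ge0 (H : R -> R) (x y z : R) :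
  (forall u w, u != 0 -> `|u| <= `|w| -> H u <= H w) ->
  x != y -> y != z -> z != x ->
  0 <= three_body H x y z + three_body H y z x + three_body H z x y.
Proof.
move=> Hmono.
have Hev u : u != 0 -> H (- u) = H u.
  by move=> u0; apply/le_anti; rewrite !Hmono ?oppr_eq0 ?normrN.
have sorted a b c : a < b -> b < c ->
    0 <= three_body H a b c + three_body H b c a + three_body H c a b.
  move=> ab bc; rewrite /three_body.
  have ba0 : 0 < b - a by rewrite subr_gt0.
  have cb0 : 0 < c - b by rewrite subr_gt0.
  have ca0 : 0 < c - a by lra.
  have h1 : H (a - b) <= H (c - a).
    by apply: Hmono; rewrite ?subr_eq0 ?lt_eqF// distrC !gtr0_norm//; lra.
  have h2 : H (b - c) <= H (c - a).
    by apply: Hmono; rewrite ?subr_eq0 ?lt_eqF// distrC !gtr0_norm//; lra.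
  have -> : - H (a - b) / ((a - c) * (b - c)) + - H (b - c) / ((b - a) * (c - a)) +
      - H (c - a) / ((c - b) * (a - b)) =
      ((H (c - a) - H (a - b)) * (b - a) + (H (c - a) - H (b - c)) * (c - b)) /
        ((b - a) * (c - b) * (c - a)).
    have ac : a < c := lt_trans ab bc.
    by field; rewrite !(subr_eq0, lt_eqF ab, gt_eqF ab, lt_eqF bc, gt_eqF bc, lt_eqF ac, gt_eqF ac).
  apply: divr_ge0; last by rewrite ltW// !mulr_gt0.
  by apply: addr_ge0; apply: mulr_ge0; rewrite ?(ltW ba0) ?(ltW cb0) ?subr_ge0.
have swap a b c : a != b -> three_body H a b c = three_body H b a c.
  by move=> ab; rewrite /three_body -opprB Hev ?subr_eq0 1?eq_sym// [X in _ / X]mulrC.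
move=> xy yz zx.
have [xy'|xy'] : x < y \/ y < x by move: xy; rewrite neq_lt => /orP[]; auto.
- have [yz'|yz'] : y < z \/ z < y by move: yz; rewrite neq_lt => /orP[]; auto.
    exact: sorted.
  have [zx'|zx'] : z < x \/ x < z by move: zx; rewrite neq_lt => /orP[]; auto.
    by have := sorted _ _ _ zx' xy'; lra.
  have := sorted _ _ _ zx' yz'; rewrite (swap x z) 1?eq_sym// (swap z y) 1?eq_sym// (swap y x) 1?eq_sym//; lra.
- have [zx'|zx'] : z < x \/ x < z by move: zx; rewrite neq_lt => /orP[]; auto.
    have [yz'|yz'] : y < z \/ z < y by move: yz; rewrite neq_lt => /orP[]; auto.
      by have := sorted _ _ _ yz' zx'; lra.
    have := sorted _ _ _ yz' xy'; rewrite (swap z y) 1?eq_sym// (swap y x) 1?eq_sym// (swap x z) 1?eq_sym//; lra.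
  have := sorted _ _ _ xy' zx'; rewrite (swap z y) 1?eq_sym// (swap y x) 1?eq_sym// (swap x z) 1?eq_sym//; lra.
Qed.

End three_bodies.

Section cross_terms.
Context {R : realType} {N : nat} {I : finType}.
Variables (al : I -> 'rV[R]_N) (kk : I -> R) (y : 'rV[R]_N).

(** The off-diagonal sum is the whole drift minus its diagonal term, so cross terms can be read off
    the explicit drift in coordinates without tabulating inner products of roots. *)
Lemma cross_terms_rdrift (g : R -> R) p :
  \sum_(q | q != p) kk q * dotv (al p) (al q) * g (dotv (al p) y) / dotv (al q) y =
  g (dotv (al p) y) * (dotv (al p) (rdrift al kk y) - kk p * dotv (al p) (al p) / dotv (al p) y).
Proof.
rewrite dot_rdrift [in RHS](bigD1 p)//= [X in _ * (X - _)]addrC addrK mulr_sumr.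
by apply: eq_bigr => q _; rewrite (dotvC (al q) (al p)); ring.
Qed.

End cross_terms.

Section coordinate_roots.
Context {R : realType} {N : nat}.
Implicit Types y : 'rV[R]_N.

Local Notation e i := (delta_mx (ord0 : 'I_1) (i : 'I_N) : 'rV[R]_N).

Definition rootA (p : upair N) : 'rV[R]_N := e (val p).2 - e (val p).1.

Definition indexB : finType := ((upair N * bool) + 'I_N)%type.

Definition rootB (p : indexB) : 'rV[R]_N :=
  match p with
  | inl (p, s) => e (val p).2 + (if s then 1 else -1) *: e (val p).1
  | inr i => e i
  end.

Definition multB (k alpha : R) (p : indexB) : R := if p is inl _ then k else k * alpha.

Lemma dotv_deltal i y : dotv (e i) y = y ord0 i.
Proof. by rewrite dotvC dotv_delta. Qed.

Lemma dot_rootA p y : dotv (rootA p) y = y ord0 (val p).2 - y ord0 (val p).1.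
Proof. by rewrite dotvBl !dotv_deltal. Qed.

Lemma dot_rootB p s y : dotv (rootB (inl (p, s))) y =
  y ord0 (val p).2 + (if s then 1 else -1) * y ord0 (val p).1.
Proof. by rewrite dotvDl dotvZl !dotv_deltal. Qed.

Lemma delta_neq (p : upair N) : ((val p).1 == (val p).2) = false.
Proof. by apply/negbTE; rewrite -(inj_eq val_inj) neq_ltn (valP p). Qed.

Lemma delta_neqC (p : upair N) : ((val p).2 == (val p).1) = false.
Proof. by rewrite eq_sym delta_neq. Qed.

Lemma sqr_rootA p : dotv (rootA p) (rootA p) = 2.
Proof.
rewrite dot_rootA /rootA !mxE !eqxx /= delta_neq delta_neqC /=; ring.
Qed.

Lemma sqr_rootB p s : dotv (rootB (inl (p, s))) (rootB (inl (p, s))) = 2.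
Proof.
rewrite dot_rootB /rootB !mxE !eqxx /= delta_neq delta_neqC.
by case: s => /=; ring.
Qed.

Lemma sqr_rootB_short i : dotv (rootB (inr i)) (rootB (inr i)) = 1.
Proof. by rewrite dotv_deltal mxE !eqxx. Qed.

Lemma chamberA : chamber rootA = weyl_chamber typeA N.
Proof.
apply/seteqP; split => [y h i j ij|y h p].
  by have := h (exist _ (i, j) ij); rewrite dot_rootA subr_gt0.
by rewrite dot_rootA subr_gt0; apply: h; exact: (valP p).
Qed.

Lemma chamberB alpha : chamber rootB = weyl_chamber (typeB alpha) N.
Proof.
apply/seteqP; split => [y h|y [h1 h2] p].
  split=> [i|i j ij]; first by have := h (inr i); rewrite dotv_deltal.
  by have := h (inl (exist _ (i, j) ij, false)); rewrite dot_rootB /= mulN1r subr_gt0.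
case: p => [[p s]|i]; last by rewrite dotv_deltal.
have h12 := h2 _ _ (valP p); have := h1 (val p).1; have := h1 (val p).2.
rewrite dot_rootB; case: s; rewrite ?mul1r ?mulN1r ?subr_gt0//; exact: addr_gt0.
Qed.

(** Doubling turns the sum over unordered pairs into one over ordered pairs. The identity holds at
    every [y], walls included, since inversion is odd at 0 as well; it is applied along the whole
    path of [X]. *)
Lemma rdriftA k y : rdrift rootA (fun=> k) y = bessel_drift typeA k y.
Proof.
apply/rowP => m; rewrite !mxE summxE.
pose F i j := k / (y ord0 j - y ord0 i) * ((m == j)%:R - (m == i)%:R).
have FC i j : F i j = F j i.
  by rewrite /F -opprB invrN; ring.
have h2 : (2 : R) != 0 by [].
apply: (mulfI h2); rewrite (eq_bigr (fun p : upair N => F (val p).1 (val p).2)); last first.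
  by move=> p _; rewrite dot_rootA !mxE.
rewrite (sum_upair FC).
have -> : \sum_i \sum_(j | j != i) F i j =
   \sum_i \sum_(j | j != i) k / (y ord0 j - y ord0 i) * (j == m)%:R +
   \sum_i \sum_(j | j != i) k / (y ord0 i - y ord0 j) * (i == m)%:R.
  rewrite -big_split; apply: eq_bigr => i _; rewrite -big_split; apply: eq_bigr => j _.
  by rewrite /F /= ![m == _]eq_sym -(opprB (y ord0 j)) invrN; ring.
rewrite sum_offdiag_snd sum_offdiag_fst mulrA [2 * k]mulr_natl mulr2n mulrDl !mulr_sumr.
by [].
Qed.

Lemma rdriftB k alpha y : rdrift rootB (multB k alpha) y = bessel_drift (typeB alpha) k y.
Proof.
apply/rowP => m; rewrite !mxE summxE big_sumType/=.
pose F i j := k / (y ord0 j - y ord0 i) * ((m == j)%:R - (m == i)%:R) +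
  k / (y ord0 j + y ord0 i) * ((m == j)%:R + (m == i)%:R).
have FC i j : F i j = F j i.
  by rewrite /F -[in LHS](opprB (y ord0 i)) invrN [in LHS](addrC (y ord0 j)); ring.
rewrite addrC; congr (_ + _).
  rewrite (bigD1 m)//= dotv_deltal !mxE !eqxx mulr1 big1 ?addr0// => i /negbTE im.
  by rewrite !mxE eqxx/= eq_sym im mulr0.
have h2 : (2 : R) != 0 by [].
apply: (mulfI h2).
rewrite (eq_bigr (fun p : upair N * bool => (fun (p : upair N) s =>
    k / (y ord0 (val p).2 + (if s then 1 else -1) * y ord0 (val p).1) *
     ((m == (val p).2)%:R + (if s then 1 else -1) * (m == (val p).1)%:R)) p.1 p.2)); last first.
  by move=> [p s] _; rewrite dot_rootB !mxE.
rewrite -(pair_bigA _ (fun (p : upair N) s =>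
    k / (y ord0 (val p).2 + (if s then 1 else -1) * y ord0 (val p).1) *
     ((m == (val p).2)%:R + (if s then 1 else -1) * (m == (val p).1)%:R))).
rewrite (eq_bigr (fun p : upair N => F (val p).1 (val p).2)); last first.
  by move=> p _; rewrite big_bool/= !mul1r !mulN1r /F addrC.
rewrite (sum_upair FC).
have -> : \sum_i \sum_(j | j != i) F i j =
   \sum_i \sum_(j | j != i) (k * ((y ord0 j - y ord0 i)^-1 + (y ord0 j + y ord0 i)^-1)) * (j == m)%:R +
   \sum_i \sum_(j | j != i) (k * ((y ord0 i - y ord0 j)^-1 + (y ord0 i + y ord0 j)^-1)) * (i == m)%:R.
  rewrite -big_split; apply: eq_bigr => i _; rewrite -big_split; apply: eq_bigr => j _.
  rewrite /F /= ![m == _]eq_sym -(opprB (y ord0 j) (y ord0 i)) invrN (addrC (y ord0 i) (y ord0 j)); ring.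
rewrite sum_offdiag_snd sum_offdiag_fst -!mulr_sumr; ring.
Qed.

Let coord_inj y : (forall i j : 'I_N, (i < j)%N -> y ord0 i < y ord0 j) ->
  forall i j, i != j -> y ord0 i != y ord0 j.
Proof.
move=> h i j; rewrite -(inj_eq val_inj) neq_ltn => /orP[] /h; first by move/lt_eqF ->.
by move/gt_eqF ->.
Qed.

Lemma bessel_driftA_diff k y i j : i != j ->
  bessel_drift typeA k y ord0 j - bessel_drift typeA k y ord0 i =
  2 * k / (y ord0 j - y ord0 i) +
  \sum_(l | (l != i) && (l != j)) k * ((y ord0 j - y ord0 l)^-1 - (y ord0 i - y ord0 l)^-1).
Proof.
move=> ij; rewrite !mxE (bigD1 i)//= [X in _ - _ * X](bigD1 j)//= 1?eq_sym//.
rewrite (eq_bigl (fun l => (l != i) && (l != j))); last by move=> l; rewrite andbC.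
rewrite -mulr_sumr sumrB -(opprB (y ord0 j) (y ord0 i)) invrN; ring.
Qed.

Let Hfun (g : R -> R) (u : R) := `|u| * g `|u|.

Let Hfun_mono (g : R -> R) : (forall u w, 0 < u -> u <= w -> u * g u <= w * g w) ->
  forall u w, u != 0 -> `|u| <= `|w| -> Hfun g u <= Hfun g w.
Proof. by move=> gm u w u0 uw; apply: gm; rewrite ?normr_gt0. Qed.

(** Twice the sum of the cross terms is a sum over ordered triples of distinct indices of three-body
    terms, whose cyclic sums are nonnegative. *)
Lemma crossA k : 0 < k -> positive_cross_terms rootA (fun=> k).
Proof.
move=> k0 g g0 gm y Wy.
have Wy' := Wy; rewrite chamberA in Wy'.
have yinj := coord_inj Wy'.
pose H := Hfun g; have Hm := Hfun_mono gm.
have Hev u : H (- u) = H u by rewrite /H /Hfun normrN.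
pose F i j := \sum_(l | (l != i) && (l != j)) k * three_body H (y ord0 i) (y ord0 j) (y ord0 l).
have FC i j : F i j = F j i.
  rewrite /F; apply: eq_big => [l|l _]; first by rewrite andbC.
  by rewrite /three_body -opprB Hev [X in _ / X]mulrC.
rewrite (eq_bigr (fun p : upair N => F (val p).1 (val p).2)); last first.
  move=> p _; rewrite cross_terms_rdrift rdriftA sqr_rootA !dot_rootA.
  have lt := Wy' _ _ (valP p).
  set i := (val p).1 in lt *; set j := (val p).2 in lt *.
  have ij : i != j by rewrite /i /j delta_neq.
  rewrite (bessel_driftA_diff k y ij) [2 * k]mulrC [X in _ * (X - _)]addrC addrK mulr_sumr.
  apply: eq_bigr => l /andP[li lj].
  have d1 := lt; rewrite -subr_gt0 in d1.
  have e1 := negbTE (yinj _ _ ij); have e2 := negbTE (yinj _ _ li).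
  have e3 := negbTE (yinj _ _ lj); have e1' := e1; have e2' := e2; have e3' := e3.
  rewrite eq_sym in e1'; rewrite eq_sym in e2'; rewrite eq_sym in e3'.
  rewrite /three_body /H /Hfun distrC gtr0_norm//.
  by field; rewrite !(subr_eq0, e1, e2, e3, e1', e2', e3').
suff : 0 <= 2 * \sum_(p : upair N) F (val p).1 (val p).2 by rewrite pmulr_rge0.
rewrite (sum_upair FC).
apply: (@sum_triples_ge0 R N (fun i j l => k * three_body H (y ord0 i) (y ord0 j) (y ord0 l))).
move=> i j l ij jl li; rewrite -!mulrDr mulr_ge0 ?(ltW k0)//.
by apply: three_body_sum_ge0; [exact: Hm|exact: yinj..].
Qed.

Lemma bessel_driftB_split k alpha y i j : i != j ->
  bessel_drift (typeB alpha) k y ord0 j = k * alpha / y ord0 j +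
  k * ((y ord0 j - y ord0 i)^-1 + (y ord0 j + y ord0 i)^-1) +
  k * \sum_(l | (l != i) && (l != j)) ((y ord0 j - y ord0 l)^-1 + (y ord0 j + y ord0 l)^-1).
Proof.
move=> ij; rewrite !mxE (bigD1 i)//= mulrDr addrA; congr (_ + _ * _).
by apply: eq_bigl => l; rewrite andbC.
Qed.

(** Partial fractions for the action of a third coordinate [z] on the two long roots [w - u] and
    [w + u]; the four terms on the right are those of [TB] in [crossB]. *)
Lemma bodyB_field (u w z Hm Hp : R) : u != w -> u != z -> w != z ->
  u + w != 0 -> u + z != 0 -> w + z != 0 ->
  Hm / (w - u) * (((w - z)^-1 + (w + z)^-1) - ((u - z)^-1 + (u + z)^-1)) +
  Hp / (w + u) * (((w - z)^-1 + (w + z)^-1) + ((u - z)^-1 + (u + z)^-1)) =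
  - Hm / ((u - z) * (w - z)) + - Hm / ((u + z) * (w + z)) +
  Hp / ((u - z) * (w + z)) + Hp / ((u + z) * (w - z)).
Proof.
move=> uw uz wz puw puz pwz; field.
rewrite !subr_eq0 [w == u]eq_sym [w + u]addrC.
by rewrite uw uz wz puw puz pwz.
Qed.

(* The pair terms of the long roots are sums of three-body terms of (y_i, y_j, y_l) with
   at most one sign changed; what remains, against the short roots, is positive pairwise. *)
Lemma crossB k alpha : 0 < k -> 0 < alpha -> positive_cross_terms rootB (multB k alpha).
Proof.
move=> k0 al0 g g0 gm y Wy.
have [ypos Wy'] : weyl_chamber (typeB alpha) N y by rewrite -chamberB.
have yinj := coord_inj Wy'.
pose H := Hfun g; have Hm := Hfun_mono gm.
have Hev u : H (- u) = H u by rewrite /H /Hfun normrN.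
pose b m := bessel_drift (typeB alpha) k y ord0 m.
pose TB (u w z : R) := three_body H u w z + three_body H u w (- z) +
  three_body H u (- w) z + three_body H (- u) w z.
have TBE u w z : TB u w z = - H (u - w) / ((u - z) * (w - z)) + - H (u - w) / ((u + z) * (w + z)) +
    H (u + w) / ((u - z) * (w + z)) + H (u + w) / ((u + z) * (w - z)).
  rewrite /TB /three_body !opprK.
  have -> : (u - z) * (- w - z) = - ((u - z) * (w + z)) by ring.
  have -> : (- u - z) * (w - z) = - ((u + z) * (w - z)) by ring.
  have -> : H (- u - w) = H (u + w) by rewrite -Hev; congr H; ring.
  by rewrite !invrN !mulrNN !mulNr.
have TBC u w z : TB u w z = TB w u z.
  have e1 : H (w - u) = H (u - w) by rewrite -(opprB u w) Hev.
  by rewrite !TBE e1 (addrC w u) !invfM; ring.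
(* The action of the short roots on the long roots [y_j - y_i] and [y_j + y_i]. The long roots of
   one pair are orthogonal and do not act on each other. *)
pose G i j := k * alpha * ((H (y ord0 i + y ord0 j) - H (y ord0 i - y ord0 j)) / (y ord0 i * y ord0 j)).
pose F i j := G i j +
  \sum_(l | (l != i) && (l != j)) k * TB (y ord0 i) (y ord0 j) (y ord0 l).
have FC i j : F i j = F j i.
  rewrite /F /G; congr (_ + _).
    by rewrite (addrC (y ord0 j)) (mulrC (y ord0 j)) -(opprB (y ord0 i)) Hev.
  apply: eq_big => [l|l _]; first by rewrite andbC.
  by rewrite TBC.
(* The action on the short root [y_i] of the two long roots joining it to [y_j]. Its sign is
   indefinite until it is added to [E j i]. *)
pose E i j := 2 * k * H (y ord0 i) / (y ord0 i ^+ 2 - y ord0 j ^+ 2).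
have shortE : \sum_(i < N) \sum_(q | q != inr i) multB k alpha q * dotv (rootB (inr i)) (rootB q) *
    g (dotv (rootB (inr i)) y) / dotv (rootB q) y = \sum_i \sum_(j | j != i) E i j.
  apply: eq_bigr => i _; rewrite cross_terms_rdrift rdriftB sqr_rootB_short !dotv_deltal mulr1.
  rewrite mxE addrC addKr !mulr_sumr; apply: eq_bigr => j ji.
  have yi := ypos i; have yj := ypos j; have ne := yinj _ _ ji.
  have s0 : 0 < y ord0 i + y ord0 j by rewrite addr_gt0.
  rewrite /E /H /Hfun gtr0_norm//.
  rewrite subr_sqr; field.
  have ne' := negbTE ne; rewrite eq_sym in ne'.
  by rewrite !(subr_eq0, negbTE ne, ne', gt_eqF s0, gt_eqF yi).
have longE : \sum_(p : upair N * bool) \sum_(q | q != inl p) multB k alpha q *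
    dotv (rootB (inl p)) (rootB q) * g (dotv (rootB (inl p)) y) / dotv (rootB q) y =
    \sum_(p : upair N) F (val p).1 (val p).2.
  pose Q (p : upair N) (s : bool) := \sum_(q | q != inl (p, s)) multB k alpha q *
    dotv (rootB (inl (p, s))) (rootB q) * g (dotv (rootB (inl (p, s))) y) / dotv (rootB q) y.
  rewrite (eq_bigr (fun p : upair N * bool => Q p.1 p.2)); last by move=> [].
  rewrite -(pair_bigA _ Q); apply: eq_bigr => p _; rewrite big_bool /Q !cross_terms_rdrift rdriftB.
  rewrite !sqr_rootB !dot_rootB !mul1r !mulN1r.
  have lt := Wy' _ _ (valP p).
  set i := (val p).1 in lt *; set j := (val p).2 in lt *.
  have ij : i != j by rewrite /i /j delta_neq.
  have ji : j != i by rewrite eq_sym.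
  rewrite (bessel_driftB_split k alpha y ij) (bessel_driftB_split k alpha y ji).
  rewrite (eq_bigl (fun l => (l != i) && (l != j)) (fun l => _ + (y ord0 i + _)^-1)); last first.
    by move=> l; rewrite andbC.
  rewrite /multB /F /G.
  have d1 : 0 < y ord0 j - y ord0 i by rewrite subr_gt0.
  have yi := ypos i; have yj := ypos j.
  have s1 : 0 < y ord0 j + y ord0 i by rewrite addr_gt0.
  have HmE : H (y ord0 i - y ord0 j) / (y ord0 j - y ord0 i) = g (y ord0 j - y ord0 i).
    by rewrite /H /Hfun distrC gtr0_norm// mulrAC mulfV ?mul1r// gt_eqF.
  have HpE : H (y ord0 i + y ord0 j) / (y ord0 j + y ord0 i) = g (y ord0 j + y ord0 i).
    by rewrite addrC /H /Hfun gtr0_norm// mulrAC mulfV ?mul1r// gt_eqF.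
  have -> : \sum_(l | (l != i) && (l != j)) k * TB (y ord0 i) (y ord0 j) (y ord0 l) =
     k * \sum_(l | (l != i) && (l != j))
       (g (y ord0 j - y ord0 i) * (((y ord0 j - y ord0 l)^-1 + (y ord0 j + y ord0 l)^-1) -
                                   ((y ord0 i - y ord0 l)^-1 + (y ord0 i + y ord0 l)^-1)) +
        g (y ord0 j + y ord0 i) * (((y ord0 j - y ord0 l)^-1 + (y ord0 j + y ord0 l)^-1) +
                                   ((y ord0 i - y ord0 l)^-1 + (y ord0 i + y ord0 l)^-1))).
    rewrite mulr_sumr; apply: eq_bigr => l /andP[li lj]; congr (_ * _).
    have yl := ypos l.
    rewrite TBE -HmE -HpE bodyB_field//; first by apply: yinj.
    - by apply: yinj; rewrite eq_sym.
    - by apply: yinj; rewrite eq_sym.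
    - by rewrite gt_eqF ?addr_gt0.
    - by rewrite gt_eqF ?addr_gt0.
    - by rewrite gt_eqF ?addr_gt0.
  set Sa := \sum_(l | _) ((y ord0 j - y ord0 l)^-1 + _).
  set Sc := \sum_(l | _) ((y ord0 i - y ord0 l)^-1 + _).
  rewrite [X in _ = _ + k * X](_ : _ = g (y ord0 j - y ord0 i) * (Sa - Sc) +
      g (y ord0 j + y ord0 i) * (Sa + Sc)); last first.
    by rewrite big_split/= -!mulr_sumr sumrB; congr (_ + _ * _); rewrite big_split.
  rewrite -HmE -HpE /=.
  field.
  have ne := negbTE (yinj _ _ ij); have ne' := ne; rewrite eq_sym in ne'.
  have s2 : 0 < y ord0 i + y ord0 j by rewrite addrC.
  by rewrite !(subr_eq0, ne, ne', gt_eqF yi, gt_eqF yj, gt_eqF s1, gt_eqF s2).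
rewrite big_sumType longE shortE.
suff : 0 <= 2 * (\sum_(p : upair N) F (val p).1 (val p).2 + \sum_i \sum_(j | j != i) E i j).
  by rewrite pmulr_rge0.
rewrite mulrDr (sum_upair FC); apply: addr_ge0.
  rewrite /F (eq_bigr (fun i => \sum_(j | j != i) G i j + \sum_(j | j != i)
      \sum_(l | (l != i) && (l != j)) k * TB (y ord0 i) (y ord0 j) (y ord0 l))); last first.
    by move=> i _; rewrite big_split.
  rewrite big_split/=; apply: addr_ge0.
    apply: sumr_ge0 => i _; apply: sumr_ge0 => j ji; rewrite /G.
    have yi := ypos i; have yj := ypos j; have ne := yinj _ _ ji.
    apply: mulr_ge0; first by rewrite mulr_ge0// ltW.
    apply: divr_ge0; last by rewrite mulr_ge0// ltW.
    rewrite subr_ge0; apply: Hm; first by rewrite subr_eq0 eq_sym.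
    by rewrite [leRHS]gtr0_norm ?addr_gt0// ler_norml; apply/andP; split; lra.
  apply: (@sum_triples_ge0 R N (fun i j l => k * TB (y ord0 i) (y ord0 j) (y ord0 l))).
  move=> i j l ij jl li; rewrite -!mulrDr mulr_ge0 ?(ltW k0)//.
  have body a b' c : a != b' -> b' != c -> c != a -> 0 <= three_body H a b' c +
    three_body H b' c a + three_body H c a b' by exact: three_body_sum_ge0.
  have yi := ypos i; have yj := ypos j; have yl := ypos l.
  have n1 := yinj _ _ ij; have n2 := yinj _ _ jl; have n3 := yinj _ _ li.
  have t1 := body _ _ _ n1 n2 n3.
  have nn (a c : R) : 0 < a -> 0 < c -> a != - c.
    by move=> a0 c0; rewrite gt_eqF//; lra.
  have nm (a c : R) : 0 < a -> 0 < c -> - a != c.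
    by move=> a0 c0; rewrite lt_eqF//; lra.
  have t2 := body _ _ _ n1 (nn _ _ yj yl) (nm _ _ yl yi).
  have t3 := body _ _ _ (nn _ _ yi yj) (nm _ _ yj yl) n3.
  have t4 := body _ _ _ (nm _ _ yi yj) n2 (nn _ _ yl yi).
  have := addr_ge0 (addr_ge0 t1 t2) (addr_ge0 t3 t4).
  by rewrite /TB; congr (0 <= _); ring.
(* Exchanging the indices pairs [E i j] with [E j i]; their sum is nonnegative because [H u] and
   [u^2] are both nondecreasing on positive [u]. *)
have EE : \sum_i \sum_(j | j != i) E i j = \sum_i \sum_(j | j != i) E j i.
  rewrite (exchange_big_dep xpredT)//=; apply: eq_bigr => i _; apply: eq_bigl => j.
  by rewrite eq_sym.
rewrite mulr_natl mulr2n {2}EE -big_split; apply: sumr_ge0 => i _.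
rewrite -big_split; apply: sumr_ge0 => j ji /=.
have yi := ypos i; have yj := ypos j; have ne := yinj _ _ ji.
have E2 : E i j + E j i = 2 * k * ((H (y ord0 i) - H (y ord0 j)) / (y ord0 i ^+ 2 - y ord0 j ^+ 2)).
  by rewrite /E -[y ord0 j ^+ 2 - _]opprB invrN; ring.
rewrite E2; apply: mulr_ge0; first by rewrite mulr_ge0// ltW.
have mono u w : 0 < u -> u < w -> 0 <= (H w - H u) / (w ^+ 2 - u ^+ 2).
  move=> u0 uw; have w0 := lt_trans u0 uw; apply: divr_ge0.
    rewrite subr_ge0; apply: Hm; first by rewrite gt_eqF.
    by rewrite !gtr0_norm//; exact: ltW.
  by rewrite subr_ge0 lerXn2r ?nnegrE//; exact: ltW.
move: ne; rewrite neq_lt => /orP[] h; first exact: mono.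
by rewrite -mulrNN -invrN !opprB; exact: mono.
Qed.

End coordinate_roots.

(** * Boundary of the chamber and conclusion *)

Section chamber_topology.
Context {R : realType} {N : nat} {I : finType}.
Variable al : I -> 'rV[R]_N.

Lemma closure_chamber_ge0 x : closure (chamber al) x -> forall p, 0 <= dotv (al p) x.
Proof.
move=> clx p.
have cl : closed [set y : 'rV[R]_N | 0 <= dotv (al p) y].
  rewrite (_ : [set y | _] = dotv (al p) @^-1` [set u | 0 <= u]); last by [].
  by apply: closed_comp; [move=> y _; exact: continuous_dotv|exact: closed_ge].
have sub : chamber al `<=` [set y | 0 <= dotv (al p) y] by move=> y Wy; exact/ltW.
by have := closureS sub clx; rewrite -(iffLR (closure_id _) cl).
Qed.

Lemma chamber_interior x : chamber al x -> (chamber al)° x.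
Proof.
move=> Wx; apply: (filter_forall (F := nbhs x)) => p.
have : nbhs (dotv (al p) x) [set u | 0 < u].
  by apply: open_nbhs_nbhs; split; [exact: open_gt|exact: Wx].
exact: continuous_dotv.
Qed.

Lemma boundary_chamber x : closure (chamber al) x ->
  boundary (chamber al) x <-> exists p, dotv (al p) x = 0.
Proof.
move=> clx; split=> [[_ nint]|[p p0]].
  apply: contrapT => h; apply/nint/chamber_interior => p.
  rewrite lt_neqAle closure_chamber_ge0// andbT eq_sym; apply/eqP => p0.
  by apply: h; exists p.
by split=> // /interior_subset /(_ p); rewrite p0 ltxx.
Qed.

End chamber_topology.

Lemma cts_nonneg_coord {R : realType} {N : nat} (f : R -> 'rV[R]_N) i :
  {within [set t : R | 0 <= t], continuous f} -> cts_nonneg (fun t => f t ord0 i).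
Proof.
move=> /subspace_continuousP cf t t0 e e0.
have /cvgrPdist_lt/(_ e e0) := cvg_comp _ _ (cf t t0) (@coord_continuous R 1 N ord0 i (f t)).
rewrite /prop_near1 /within/= => /nbhs_ballP[dl /= dl0 h].
exists dl => // s s0 st; rewrite distrC; apply: h => //.
by rewrite /ball/= distrC.
Qed.

Section hausdorff_dim_zero_set.
Context d {T : measurableType d} {R : realType} (P : probability T R) {N : nat} {I : finType}.
Variables (typ : bessel_type R) (k : R) (al : I -> 'rV[R]_N) (kk : I -> R).
Variables (x : 'rV[R]_N) (B X : R -> T -> 'rV[R]_N).
Hypothesis kk_gt0 : forall p, 0 < kk p.
Hypothesis k'_itv : 0 < kprime typ k < 1 / 2.
Hypothesis k'_le : forall p, kprime typ k <= kk p.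
Hypothesis al_ge1 : forall p, 1 <= dotv (al p) (al p).
Hypothesis cross : positive_cross_terms al kk.
Hypothesis chamberE : chamber al = weyl_chamber typ N.
Hypothesis driftE : forall y, rdrift al kk y = bessel_drift typ k y.
Hypothesis bm : brownian_motion P B.
Hypothesis x_bnd : boundary (weyl_chamber typ N) x.
Hypothesis sol : bessel_solution P typ k B x X.

(** Positive strictly increasing coordinates, hence an interior point of the chamber for both
    types. *)
Let v : 'rV[R]_N := \row_i i.+1%:R.

Let Wv : chamber al v.
Proof.
rewrite chamberE; have lt (i j : 'I_N) : (i < j)%N -> v ord0 i < v ord0 j.
  by move=> ij; rewrite !mxE ltr_nat.
by case: typ => [|alpha] /=; [exact: lt|split=> // i; rewrite mxE].
Qed.

(** For each exponent [s] the null measure holds outside a null set depending on [s], so the infimum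
    defining the dimension is approached along a countable sequence of exponents. *)
Lemma hausdorff_dim_hitting_times : {ae P, forall w,
  (hausdorff_dim [set t : R | (0 <= t)%R /\ boundary (weyl_chamber typ N) (X t w)]
    <= (1 / 2 - kprime typ k)%:E)%E}.
Proof.
have /andP[k'0 k'1] := k'_itv; move: (kprime typ k) k'0 k'1 k'_le => k' k'0 k'1 k'_le'.
have x_ge0 p : 0 <= dotv (al p) x.
  by apply: closure_chamber_ge0; rewrite chamberE; case: x_bnd.
have B_path : {ae P, forall w, B 0 w = 0 /\ forall i, cts_nonneg (fun t => B t w ord0 i)}.
  have [_ [Bw _]] := bm; apply: filterS Bw => w [B0 cB].
  by split=> // i; exact: cts_nonneg_coord.
have [_ Xw] := sol.
have X_path : {ae P, forall w, (forall i, cts_nonneg (fun t => X t w ord0 i)) /\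
  forall t, 0 <= t -> (forall p, 0 <= dotv (al p) (X t w)) /\
    (forall i, (@lebesgue_measure R).-integrable `[0, t]
      (fun s => (rdrift al kk (X s w) ord0 i)%:E)) /\
    X t w = x + B t w + \row_i Rintegral (@lebesgue_measure R) `[0, t]
      (fun s => rdrift al kk (X s w) ord0 i)}.
  have -> : rdrift al kk = bessel_drift typ k by apply/funext => y; exact: driftE.
  apply: filterS Xw => w [cX h]; split; first by move=> i; exact: cts_nonneg_coord.
  move=> t t0; have [clX [iX eX]] := h t t0; split; last by split.
  by apply: closure_chamber_ge0; rewrite chamberE.
(* Exponents decreasing to [1/2 - k']; starting the denominators at 2 keeps them below 1, as
   [zero_set_null] requires. *)
pose s q : R := 1 / 2 - k' + (1 / 2 + k') / q.+2%:R.
have null : {ae P, forall w, forall q, hausdorff_measure (s q)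
    [set t | 0 <= t /\ exists p, dotv (al p) (X t w) = 0] = 0%E}.
  apply: ae_forall_nat => q.
  apply: (zero_set_null kk_gt0 Wv bm x_ge0 k'0 k'1 k'_le' al_ge1 cross B_path X_path).
    by rewrite /s ltrDl divr_gt0//; lra.
  have : (1 / 2 + k') / q.+2%:R <= (1 / 2 + k') / 2.
    by rewrite ler_wpM2l ?lef_pV2 ?posrE ?ler_nat//; lra.
  by rewrite /s; move: (_ / q.+2%:R) => z; lra.
apply: (filterS _ (filterI Xw null)) => w [[_ h] hnull].
have -> : [set t : R | (0 <= t)%R /\ boundary (weyl_chamber typ N) (X t w)] =
    [set t | 0 <= t /\ exists p, dotv (al p) (X t w) = 0].
  apply/seteqP; split => t [t0 bt]; split => //; have [clX _] := h t t0;
    rewrite -chamberE in clX bt *; by apply/boundary_chamber.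
apply/lee_addgt0Pr => e e0; rewrite -EFinD.
pose q := Num.truncn ((1 / 2 + k') / e).
apply: (@le_trans _ _ (s q)%:E).
  apply: ereal_inf_lbound; exists (s q) => //; split; last exact: hnull.
  by rewrite /s addr_ge0 ?divr_ge0//; lra.
rewrite lee_fin lerD2l ler_pdivrMr// [leRHS]mulrC -ler_pdivrMr//.
apply: (le_trans (ltW (truncnS_gt _))); rewrite -/q ler_nat.
exact: leqnSn.
Qed.

End hausdorff_dim_zero_set.

Theorem theorem3p1 (R : realType) (d : measure_display) (T : measurableType d)
  (P : probability T R) (typ : bessel_type R) (N : nat) (k : R)
  (B : R -> T -> 'rV[R]_N) (x : 'rV[R]_N) (X : R -> T -> 'rV[R]_N) :
  admissible typ N k ->
  0 < kprime typ k < 1 / 2 ->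
  brownian_motion P B ->
  boundary (weyl_chamber typ N) x ->
  bessel_solution P typ k B x X ->
  {ae P, forall w,
     (hausdorff_dim [set t : R | (0 <= t)%R /\ boundary (weyl_chamber typ N) (X t w)]
      <= (1 / 2 - kprime typ k)%:E)%E}.
Proof.
case: typ => [|alpha] adm k'_itv bm x_bnd sol.
  have [_ k0] := adm.
  apply: (@hausdorff_dim_hitting_times d T R P N (upair N) typeA k rootA (fun=> k) x B X) => //.
  - by move=> p; rewrite sqr_rootA ler1n.
  - exact: crossA.
  - exact: chamberA.
  - exact: rdriftA.
have [_ [k0 al0]] := adm.
(* [kprime] is the smaller of the two multiplicities, [k] on the long roots and [k * alpha] on the
   short ones. *)
have kal : k * Num.min 1 alpha <= k * alpha.
  by rewrite ler_pM2l// ge_min lexx orbT.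
have k1 : k * Num.min 1 alpha <= k by rewrite ler_piMr ?(ltW k0)// ge_min lexx.
apply: (@hausdorff_dim_hitting_times d T R P N (@indexB N) (typeB alpha) k rootB
  (multB k alpha) x B X) => //.
- by case=> [p|i] //=; rewrite mulr_gt0.
- by case.
- case=> [[p s]|i]; first by rewrite sqr_rootB ler1n.
  by rewrite sqr_rootB_short.
- exact: crossB.
- exact: chamberB.
- exact: rdriftB.
Qed.
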